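(* Let $(R,\Phi)$ be a form ring for which the Weight Enumerator Conjecture holds, and let $\rho=(V,\rho_M,\rho_\Phi,\beta)$ be a finite representation of $(R,\Phi)$ with conductor $f=f(\rho)$ such that for some $N_0\ge1$ there is a self-dual isotropic code in $\rho^{(1,\ldots,1)}$ ($N_0$ ones). Let $m\ge1$. Let $K=K(\rho)$, $F$ and $\Gamma=\mathrm{Gal}(K/F)=\{\alpha_1,\ldots,\alpha_n\}$ be as defined in the context. Assume that $\rho$ satisfies the Weight Enumerator Conjecture and that ${\bf a}=(a_1,\ldots,a_N)$, a tuple of integers prime to $f$, satisfies the sign condition. Let ${\bf d}=(d_1,\ldots,d_n)$ with $d_j=|\{i\in\{1,\ldots,N\}\mid\gamma_{a_i}=\alpha_j\}|$. Then the space of invariants of the genus-$m$ Clifford-Weil group $\mathcal C_m(\rho)$ in $K[{\bf x}^{(m)}\circ\Gamma]_{\bf d}$ is spanned by the $\Gamma$-conjugate complete weight enumerators of genus $m$, $\mathrm{ccwe}_m(C)$, of the codes $C$ of Type $\rho^{\bf a}$.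
   Context: **Form rings.** For a ring $R$ (unital, associative), an $R$-qmodule is an abelian group $\Phi$ with a map $[\,]:R\to\mathrm{End}_{\mathbb Z}(\Phi)$ (written on the right, $\phi\mapsto\phi[r]$) that is pointed quadratic ($[0]=0$ and $(r,s)\mapsto[r+s]-[r]-[s]$ is biadditive) with $[1]=1$, $[rs]=[r][s]$. A right $R\otimes R$-module $M$ is a qmodule via $m[r]=m(r\otimes r)$; qmodule homomorphisms are additive maps commuting with all $[r]$. A form ring $(R,M,\psi,\Phi)$ consists of a ring $R$, a right $R\otimes R$-module $M$, an isomorphism of right $R$-modules $\psi:R_R\to M_{1\otimes R}$, an additive involution $\tau:M\to M$ with $\tau(m)(s\otimes r)=\tau(m(r\otimes s))$ such that $\psi^{-1}(\tau(\psi(1)))$ is a unit of $R$, an $R$-qmodule $\Phi$, and qmodule homomorphisms $\{\!\{\ \}\!\}:M\to\Phi$, $\lambda:\Phi\to M$ with $\{\!\{\tau(m)\}\!\}=\{\!\{m\}\!\}$, $\tau(\lambda(\phi))=\lambda(\phi)$, $\lambda(\{\!\{m\}\!\})=m+\tau(m)$, $\{\!\{\lambda(\phi)(r\otimes s)\}\!\}=\phi[r+s]-\phi[r]-\phi[s]$. It is abbreviated $(R,\Phi)$. The map $r^J:=\psi^{-1}(\psi(1)(r\otimes1))$ is an anti-automorphism of $R$. **Representations.** A finite representation $\rho=(V,\rho_M,\rho_\Phi,\beta)$ of $(R,\Phi)$ consists of a finite left $R$-module $V$; an $R\otimes R$-module homomorphism $\rho_M$ from $M$ to the group $\mathrm{Bil}(V)$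 of biadditive maps $V\times V\to\mathbb Q/\mathbb Z$ (where $(b(r\otimes s))(x,y)=b(rx,sy)$) with $\rho_M(\tau(m))(x,y)=\rho_M(m)(y,x)$ and such that $\beta:=\rho_M(\psi(1))$ is non-singular; and a qmodule homomorphism $\rho_\Phi$ from $\Phi$ to the group of $\mathbb Q/\mathbb Z$-valued (pointed) quadratic maps on $V$ (where $(q[r])(x)=q(rx)$) with $\rho_\Phi(\{\!\{m\}\!\})(x)=\rho_M(m)(x,x)$ and $\rho_M(\lambda(\phi))(x,y)=\rho_\Phi(\phi)(x+y)-\rho_\Phi(\phi)(x)-\rho_\Phi(\phi)(y)$. The conductor $f(\rho)$ is the order of the (finite cyclic) subgroup of $\mathbb Q/\mathbb Z$ generated by all $\beta(x,y)$ and all $\rho_\Phi(\phi)(x)$. **Codes.** A code in $\rho$ is an $R$-submodule $C\le V$; $C^\perp=\{x\in V\mid\beta(x,c)=0\ \forall c\in C\}$; $C$ is self-dual if $C=C^\perp$; a code $C\subseteq C^\perp$ is isotropic if $\rho_\Phi(\phi)(C)=\{0\}$ for all $\phi\in\Phi$. A code of Type $\rho$ is a self-dual isotropic code in $\rho$. **Sums.** For ${\bf a}=(a_1,\ldots,a_N)$ with all $a_i\in\mathbb Z$ prime to $f(\rho)$, $\rho^{\bf a}$ is the finite representation of $(R,\Phi)$ on $V^N$ given by $m\mapsto\big((x,y)\mapsto\sum_i a_i\rho_M(m)(x_i,y_i)\big)$, $\phi\mapsto\big(x\mapsto\sum_i a_i\rho_\Phi(\phi)(x_i)\big)$ and the form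 $\sum_i a_i\beta(x_i,y_i)$. **Clifford-Weil groups.** An idempotent $\iota\in R$ is symmetric if $\iota R\cong\iota^JR$ as right $R$-modules; then one fixes $v_\iota\in\iota^JR\iota$, $u_\iota\in\iota R\iota^J$ with $u_\iota v_\iota=\iota$, $v_\iota u_\iota=\iota^J$. For a finite representation $\rho$ on $V$, let $\mathbb CV$ have basis $(b_w:w\in V)$. The Clifford-Weil group $\mathcal C(\rho)$ is the group of linear operators on $\mathbb CV$ generated by $m_r:b_w\mapsto b_{rw}$ ($r\in R^\times$), $d_\phi:b_w\mapsto\exp(2\pi i\rho_\Phi(\phi)(w))\,b_w$ ($\phi\in\Phi$), and $h_{\iota,u_\iota,v_\iota}:b_w\mapsto|\iota V|^{-1/2}\sum_{u\in\iota V}\exp(2\pi i\beta(u,v_\iota w))\,b_{u+(1-\iota)w}$, where $\iota$ runs through representatives of the $R^\times$-conjugacy classes of symmetric idempotents of $R$. The genus-$m$ Clifford-Weil group is $\mathcal C_m(\rho):=\mathcal C(R^m\otimes\rho)$, where $R^m\otimes\rho$ is the following representation of the matrix form ring of $(R,\Phi)$: the ring is $\mathrm{Mat}_m(R)$ with anti-automorphism $((r_{ij})^J)_{ij}=r_{ji}^J$, acting on $V^m=R^m\otimes V$ (columns); the bilinear module is $\mathrm{Mat}_m(M)$, acting by $(m_{ij})\mapsto\big((x,y)\mapsto\sum_{i,j}\rho_M(m_{ij})(x_i,y_j)\big)$, with form $\beta(x,y)=\sum_i\beta(x_i,y_i)$; the quadratic module consists of the upper triangular arrays with diagonal entries $\phi_i\in\Phi$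 and entries $m_{ij}\in M$ for $i<j$, acting as the quadratic maps $x\mapsto\sum_i\rho_\Phi(\phi_i)(x_i)+\sum_{i<j}\rho_M(m_{ij})(x_i,x_j)$. **Weight Enumerator Conjecture.** The full weight enumerator of a code $C$ in a finite representation $\rho'$ on $V'$ is $\mathrm{fwe}(C)=\sum_{c\in C}b_c\in\mathbb CV'$. The representation $\rho'$ satisfies the Weight Enumerator Conjecture if the subspace of $\mathbb CV'$ fixed by $\mathcal C(\rho')$ is spanned by the full weight enumerators of the codes of Type $\rho'$. The conjecture holds for the form ring $(R,\Phi)$ if this is the case for all finite representations $\rho'$ of $(R,\Phi)$. **Fields and signs.** Put $f=f(\rho)$, $\zeta_f=\exp(2\pi i/f)$, $F_1=\mathbb Q(\{\sqrt{|\iota V|}:\iota\in R\text{ symmetric idempotent}\})$, $K=K(\rho)=\mathbb Q(\zeta_f)F_1$. Choose a complement $F$ of $F_1\cap\mathbb Q(\zeta_f)$ in $F_1$ (a subfield $F\le F_1$ with $F\cdot(F_1\cap\mathbb Q(\zeta_f))=F_1$ and $F\cap\mathbb Q(\zeta_f)=\mathbb Q$). For $a$ prime to $f$, $\gamma_a\in\mathrm{Gal}(K/F)$ is the automorphism that is the identity on $F$ with $\gamma_a(\zeta_f)=\zeta_f^a$; $a\mapsto\gamma_a$ is an isomorphism $(\mathbb Z/f\mathbb Z)^\times\to\Gamma:=\mathrm{Gal}(K/F)=\{\alpha_1,\ldots,\alpha_n\}$. Define $\epsilon(\iota,a)\in\{1,-1\}$ by $\gamma_a(\sqrt{|\iota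 V|})=\epsilon(\iota,a)\sqrt{|\iota V|}$. The tuple ${\bf a}$ satisfies the sign condition if $\prod_{i=1}^N\epsilon(\iota,a_i)=1$ for all symmetric idempotents $\iota\in R$. **Conjugate polynomials and weight enumerators.** Let $v=|V|$ and let $x_w$ ($w\in V^m$) be the coordinate functions on $K^{V^m}\cong K^{v^m}$. $K[{\bf x}^{(m)}\circ\Gamma]$ is the $K$-algebra of functions $K^{V^m}\to K$ spanned by the monomials $\prod_{j=1}^n\prod_{w\in V^m}(x_w\circ\alpha_j)^{m_{wj}}$, where $(x_w\circ\alpha_j)(k)=\alpha_j(k_w)$; such a monomial has degree $(d_1,\ldots,d_n)$, $d_j=\sum_wm_{wj}$, and $K[{\bf x}^{(m)}\circ\Gamma]_{\bf d}$ is the span of the monomials of degree ${\bf d}$. An element $g\in\mathcal C_m(\rho)$, $g:b_w\mapsto\sum_ug_{uw}b_u$, is identified with the matrix $(g_{uw})\in\mathrm{GL}_{v^m}(K)$, acting on row vectors in $K^{V^m}$ from the right, and on functions by $(f\cdot g)(k)=f(kg^{-1})$; invariants are the functions fixed by all $g\in\mathcal C_m(\rho)$. For a code $C\le V^N$ in $\rho^{\bf a}$, an element $c\in C^m$ is viewed as a matrix in $V^{m\times N}$ whose rows are codewords, with columns $c_1,\ldots,c_N\in V^m$. With $D_j=\{i\mid\gamma_{a_i}=\alpha_j\}$ and $d_j=|D_j|$, $\mathrm{ccwe}_m(C)=\sum_{c\in C^m}\prod_{j=1}^n\prod_{i\in D_j}x_{c_i}\circ\alpha_j\in K[{\bf x}^{(m)}\circ\Gamma]_{\bf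 d}$. *)

(* Defs.v *)
From HB Require Import structures.
From mathcomp Require Import all_boot all_order all_algebra all_field.
From mathcomp Require Import finmap complex.
From mathcomp Require Import boolp classical_sets functions cardinality.
From mathcomp Require Import reals trigo.

Set Implicit Arguments.
Unset Strict Implicit.
Unset Printing Implicit Defensive.

Import Order.TTheory GRing.Theory Num.Theory.
Local Open Scope classical_set_scope.
Local Open Scope ring_scope.
Local Open Scope complex_scope.

Definition rat_integral : {pred rat} := [pred x | x \is a Num.int].

Fact rat_integral_zmod : zmod_closed rat_integral.
Proof. by split=> [|x y]; rewrite !inE; [exact: rpred0 | exact: rpredB]. Qed.

HB.instance Definition _ :=
  GRing.isZmodClosed.Build rat rat_integral rat_integral_zmod.

Definition QmodZ := {ideal_quot rat_integral}.

HB.instance Definition _ (I : finType) (V : finZmodType) :=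
  GRing.Zmodule.on {ffun I -> V}.

Definition biadditive (X Y Z : zmodType) (b : X -> Y -> Z) : Prop :=
  (forall y, {morph b^~ y : x x' / x + x'}) /\
  (forall x, {morph b x : y y' / y + y'}).

Definition pointed_quadratic (X Y : zmodType) (q : X -> Y) : Prop :=
  q 0 = 0 /\ biadditive (fun x y => q (x + y) - q x - q y).

Definition is_unit (R : pzRingType) (r : R) : Prop :=
  exists s, r * s = 1 /\ s * r = 1.

(* [fmact x r s] is x(r (x) s): a right R (x) R-module is an abelian group with
   such a triadditive, multiplicative operation.  [fqact phi r] is phi[r], and
   [fpsiV] is the inverse of psi. *)
Record form_data := FormData {
  fring :> pzRingType;
  fmod : zmodType;
  fmact : fmod -> fring -> fring -> fmod;
  fpsi : fring -> fmod;
  fpsiV : fmod -> fring;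
  ftau : fmod -> fmod;
  fquad : zmodType;
  fqact : fquad -> fring -> fquad;
  fdbl : fmod -> fquad;
  flam : fquad -> fmod }.

Record is_form_ring (A : form_data) : Prop := IsFormRing {
  fmact_add : forall r s : A, {morph (fun x : fmod A => fmact x r s) : x y / x + y};
  fmact_biadd : forall x : fmod A, biadditive (@fmact A x);
  fmact_one : forall x : fmod A, fmact x 1 1 = x;
  fmact_mul : forall (x : fmod A) r s r' s',
    fmact x (r * r') (s * s') = fmact (fmact x r s) r' s';
  fpsi_add : {morph @fpsi A : r s / r + s};
  fpsi_mul : forall r s : A, fpsi (r * s) = fmact (fpsi r) 1 s;
  fpsiK : cancel (@fpsi A) (@fpsiV A);
  fpsiVK : cancel (@fpsiV A) (@fpsi A);
  ftau_add : {morph @ftau A : x y / x + y};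
  ftauK : involutive (@ftau A);
  ftau_act : forall (x : fmod A) r s, fmact (ftau x) s r = ftau (fmact x r s);
  ftau_unit : is_unit (fpsiV (ftau (fpsi (1 : A))));
  fqact_add : forall r : A, {morph (@fqact A)^~ r : phi chi / phi + chi};
  fqact_quad : forall phi : fquad A, pointed_quadratic (@fqact A phi);
  fqact_one : forall phi : fquad A, fqact phi 1 = phi;
  fqact_mul : forall (phi : fquad A) r s,
    fqact phi (r * s) = fqact (fqact phi r) s;
  fdbl_add : {morph @fdbl A : x y / x + y};
  fdbl_act : forall (x : fmod A) r, fdbl (fmact x r r) = fqact (fdbl x) r;
  flam_add : {morph @flam A : phi chi / phi + chi};
  flam_act : forall (phi : fquad A) r, flam (fqact phi r) = fmact (flam phi) r r;
  fdbl_tau : forall x : fmod A, fdbl (ftau x) = fdbl x;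
  ftau_lam : forall phi : fquad A, ftau (flam phi) = flam phi;
  flam_dbl : forall x : fmod A, flam (fdbl x) = x + ftau x;
  fdbl_lam : forall (phi : fquad A) r s,
    fdbl (fmact (flam phi) r s) = fqact phi (r + s) - fqact phi r - fqact phi s }.

(* r |-> r^J *)
Definition fconj (A : form_data) (r : A) : A := fpsiV (fmact (fpsi 1) r 1).

Record rep_data (A : form_data) := RepData {
  rspace :> finZmodType;
  rscale : A -> rspace -> rspace;
  rbil : fmod A -> rspace -> rspace -> QmodZ;
  rquad : fquad A -> rspace -> QmodZ }.

Definition rbeta (A : form_data) (rho : rep_data A) : rho -> rho -> QmodZ :=
  rbil (fpsi 1).

Definition nonsingular (V : finZmodType) (b : V -> V -> QmodZ) : Prop :=
  forall h : V -> QmodZ, {morph h : x y / x + y} ->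
    exists! x, forall y, b x y = h y.

Record is_rep (A : form_data) (rho : rep_data A) : Prop := IsRep {
  rscale_biadd : biadditive (@rscale A rho);
  rscale_one : forall x : rho, rscale 1 x = x;
  rscale_mul : forall r s (x : rho), rscale (r * s) x = rscale r (rscale s x);
  rbil_biadd : forall m, biadditive (@rbil A rho m);
  rbil_add : forall m m' (x y : rho),
    rbil (m + m') x y = rbil m x y + rbil m' x y;
  rbil_act : forall m r s (x y : rho),
    rbil (fmact m r s) x y = rbil m (rscale r x) (rscale s y);
  rbil_tau : forall m (x y : rho), rbil (ftau m) x y = rbil m y x;
  rbeta_nonsingular : nonsingular (@rbeta A rho);
  rquad_quad : forall phi, pointed_quadratic (@rquad A rho phi);
  rquad_add : forall phi chi (x : rho),
    rquad (phi + chi) x = rquad phi x + rquad chi x;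
  rquad_act : forall phi r (x : rho),
    rquad (fqact phi r) x = rquad phi (rscale r x);
  rquad_dbl : forall m (x : rho), rquad (fdbl m) x = rbil m x x;
  rbil_lam : forall phi (x y : rho),
    rbil (flam phi) x y = rquad phi (x + y) - rquad phi x - rquad phi y }.

Definition is_subgroup (G : set QmodZ) : Prop :=
  G 0 /\ forall x y, G x -> G y -> G (x - y).

Definition conductor (A : form_data) (rho : rep_data A) : nat :=
  #|` fset_set (smallest is_subgroup
        ([set z | exists x y : rho, z = rbeta x y] `|`
         [set z | exists phi (x : rho), z = rquad phi x]))|%fset.

Definition is_code (A : form_data) (rho : rep_data A) (C : {set rho}) : Prop :=
  [/\ 0 \in C,
      forall x y, x \in C -> y \in C -> x + y \in C
    & forall r x, x \in C -> rscale r x \in C].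

Definition dual_code (A : form_data) (rho : rep_data A) (C : {set rho}) :
    {set rho} :=
  [set x | [forall c in C, rbeta x c == 0]]%SET.

Definition isotropic (A : form_data) (rho : rep_data A) (C : {set rho}) : Prop :=
  C \subset dual_code C /\ forall phi x, x \in C -> rquad phi x = 0.

Definition type_code (A : form_data) (rho : rep_data A) (C : {set rho}) : Prop :=
  [/\ is_code C, C = dual_code C & isotropic C].

(* rho^a *)
Definition sum_rep (A : form_data) (rho : rep_data A) (N : nat)
    (a : 'I_N -> int) : rep_data A :=
  @RepData A {ffun 'I_N -> rho}
    (fun r x => [ffun i => rscale r (x i)])
    (fun m x y => \sum_i (rbil m (x i) (y i)) *~ a i)
    (fun phi x => \sum_i (rquad phi (x i)) *~ a i).

Definition upper_idx (m : nat) := {p : 'I_m * 'I_m | (p.1 < p.2)%N}.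

Definition upper_entry (M : zmodType) (m : nat) (q : {ffun upper_idx m -> M})
    (i j : 'I_m) : M :=
  if insub (i, j) is Some p then q p else 0.

(* The matrix form ring of A.  An upper triangular array is a pair (diagonal,
   strict upper part), and stands for the formal quadratic map
   x |-> \sum_i phi_i(x_i) + \sum_(i < j) m_ij(x_i, x_j); the structure maps
   are what this forces.  Its anti-automorphism is (r_ij) |-> (r_ji^J). *)
Definition mat_form (A : form_data) (m : nat) : form_data :=
  @FormData 'M[A]_m 'M[fmod A]_m
    (fun B r s => \matrix_(k, l) \sum_i \sum_j fmact (B i j) (r i k) (s j l))
    (fun r => \matrix_(i, j) fpsi (r i j))
    (fun B => \matrix_(i, j) fpsiV (B i j))
    (fun B => \matrix_(i, j) ftau (B j i))
    ({ffun 'I_m -> fquad A} * {ffun upper_idx m -> fmod A})%type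
    (fun q r =>
      ([ffun k => \sum_i fqact (q.1 i) (r i k) +
          \sum_p fdbl (fmact (q.2 p) (r (val p).1 k) (r (val p).2 k))],
       [ffun kl => let: (k, l) := val kl in
          \sum_i fmact (flam (q.1 i)) (r i k) (r i l) +
          \sum_p (fmact (q.2 p) (r (val p).1 k) (r (val p).2 l) +
                  ftau (fmact (q.2 p) (r (val p).1 l) (r (val p).2 k)))]))
    (fun B =>
      ([ffun i => fdbl (B i i)],
       [ffun p => B (val p).1 (val p).2 + ftau (B (val p).2 (val p).1)]))
    (fun q => \matrix_(i, j)
      if i == j then flam (q.1 i)
      else upper_entry q.2 i j + ftau (upper_entry q.2 j i)).

(* R^m (x) rho *)
Definition genus_rep (A : form_data) (rho : rep_data A) (m : nat) :
    rep_data (mat_form A m) :=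
  @RepData (mat_form A m) {ffun 'I_m -> rho}
    (fun (r : 'M[A]_m) x => [ffun i => \sum_j rscale (r i j) (x j)])
    (fun (B : 'M[fmod A]_m) x y => \sum_i \sum_j rbil (B i j) (x i) (y j))
    (fun q x => \sum_i rquad (q.1 i) (x i) +
       \sum_p rbil (q.2 p) (x (val p).1) (x (val p).2)).

Definition symmetric_idempotent (A : form_data) (e : A) : Prop :=
  e * e = e /\
  exists g : A -> A,
    [/\ set_bij (range ( *%R e)) (range ( *%R (fconj e))) g,
        (forall x y, range ( *%R e) x -> range ( *%R e) y ->
           g (x + y) = g x + g y)
      & (forall x r, range ( *%R e) x -> g (x * r) = g x * r)].

Definition unit_conjugate (R : pzRingType) (x y : R) : Prop :=
  exists r s : R, [/\ r * s = 1, s * r = 1 & y = r * x * s].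

(* Representatives e of the R^x-conjugacy classes of symmetric idempotents, each
   with the chosen u_e in e R e^J and v_e in e^J R e. *)
Record symm_choice (A : form_data) := SymmChoice {
  sreps : set A;
  s_u : A -> A;
  s_v : A -> A }.

Record is_symm_choice (A : form_data) (T : symm_choice A) : Prop :=
  IsSymmChoice {
  sreps_symm : forall e, sreps T e -> symmetric_idempotent e;
  sreps_transversal : forall e, symmetric_idempotent e ->
    exists! e', sreps T e' /\ unit_conjugate e e';
  s_v_corner : forall e, sreps T e -> exists r, s_v T e = fconj e * r * e;
  s_u_corner : forall e, sreps T e -> exists r, s_u T e = e * r * fconj e;
  s_uv : forall e, sreps T e -> s_u T e * s_v T e = e;
  s_vu : forall e, sreps T e -> s_v T e * s_u T e = fconj e }.

(* exp(2 pi i x) *)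
Definition exp2pi (RR : realType) (x : RR) : RR[i] :=
  cos (2 * pi * x) +i* sin (2 * pi * x).

(* exp(2 pi i q) does not depend on the representative of q. *)
Definition expQZ (RR : realType) (q : QmodZ) : RR[i] :=
  exp2pi (ratr (repr q) : RR).

(* The group generated by a set of invertible matrices. *)
Inductive gen_group (K : fieldType) (n : nat) (S : set 'M[K]_n) :
    'M[K]_n -> Prop :=
| GenIn g of S g : gen_group S g
| GenOne : gen_group S 1%:M
| GenMul g h of gen_group S g & gen_group S h : gen_group S (g *m h)
| GenInv g of gen_group S g : gen_group S (invmx g).

(* The matrix of b_w |-> \sum_u k u w b_u. *)
Definition op_mx (K : pzRingType) (V : finType) (k : V -> V -> K) : 'M[K]_#|V| :=
  \matrix_(i, j) k (enum_val i) (enum_val j).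

(* e V *)
Definition idem_image (A : form_data) (rho : rep_data A) (e : A) : {set rho} :=
  finset.imset (rscale e) (mem (finset.setTfor rho)).

Definition cw_m (RR : realType) (A : form_data) (rho : rep_data A) (r : A) :
    'M[RR[i]]_#|rho| :=
  op_mx (fun u w : rho => (u == rscale r w)%:R).

Definition cw_d (RR : realType) (A : form_data) (rho : rep_data A)
    (phi : fquad A) : 'M[RR[i]]_#|rho| :=
  op_mx (fun u w : rho => expQZ RR (rquad phi w) *+ (u == w)).

Definition cw_h (RR : realType) (A : form_data) (rho : rep_data A) (e v : A) :
    'M[RR[i]]_#|rho| :=
  op_mx (fun u w : rho =>
    (sqrtC #|idem_image rho e|%:R)^-1 *
    \sum_(t in idem_image rho e)
       expQZ RR (rbeta t (rscale v w)) *+ (u == t + rscale (1 - e) w)).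

Definition clifford_weil (RR : realType) (A : form_data) (T : symm_choice A)
    (rho : rep_data A) : set 'M[RR[i]]_#|rho| :=
  gen_group
    ([set g | exists2 r : A, is_unit r & g = cw_m RR rho r] `|`
     [set g | exists phi : fquad A, g = cw_d RR rho phi] `|`
     [set g | exists2 e : A, sreps T e & g = cw_h RR rho e (s_v T e)]).
Arguments clifford_weil : clear implicits.
Arguments clifford_weil RR {A} T rho _.

Definition lin_span (K : pzRingType) (U : lmodType K) (S : set U) : set U :=
  [set x | exists n (c : 'I_n -> K) (y : 'I_n -> U),
     (forall i, S (y i)) /\ x = \sum_i c i *: y i].

(* Elements of CV are column vectors, b_w being the unit vector at w. *)
Definition fwe (RR : realType) (A : form_data) (rho : rep_data A)
    (C : {set rho}) : 'cV[RR[i]]_#|rho| :=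
  \sum_(c in C) delta_mx (enum_rank c) 0.

Definition weight_enumerator_property (RR : realType) (A : form_data)
    (T : symm_choice A) (rho : rep_data A) : Prop :=
  [set x : 'cV[RR[i]]_#|rho| |
     forall g, clifford_weil RR T rho g -> g *m x = x] =
  lin_span [set x | exists2 C : {set rho}, type_code C & x = fwe RR C].

Definition weight_enumerator_conjecture (RR : realType) (A : form_data)
    (T : symm_choice A) : Prop :=
  forall rho : rep_data A, is_rep rho -> weight_enumerator_property RR T rho.

Definition is_subfield (K : fieldType) (E : set K) : Prop :=
  [/\ E 1, forall x y, E x -> E y -> E (x - y)
    & forall x y, E x -> E y -> E (x / y)].

Definition field_gen (K : fieldType) (S : set K) : set K :=
  smallest (@is_subfield K) S.

Definition zeta (RR : realType) (f : nat) : RR[i] := exp2pi (f%:R^-1 : RR).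

Definition cyclotomic_field (RR : realType) (f : nat) : set RR[i] :=
  field_gen [set zeta RR f].
Arguments cyclotomic_field : clear implicits.

Definition sqrt_field (RR : realType) (A : form_data) (rho : rep_data A) :
    set RR[i] :=
  field_gen [set z | exists2 e : A, symmetric_idempotent e &
                       z = sqrtC #|idem_image rho e|%:R].
Arguments sqrt_field RR {A} rho _.

Definition K_field (RR : realType) (A : form_data) (rho : rep_data A) :
    set RR[i] :=
  field_gen (cyclotomic_field RR (conductor rho) `|` sqrt_field RR rho).
Arguments K_field RR {A} rho _.

Definition is_complement (K : fieldType) (E B F : set K) : Prop :=
  [/\ F `<=` B, field_gen (F `|` (B `&` E)) = B & F `&` E = range (@ratr K)].

Section ConjugatePolynomials.

(* The field L with the embedding iota is a copy of K(rho) inside RR[i], and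
   Gal(K/F) is 'Gal({:L} / F). *)
Variables (RR : realType) (A : form_data) (rho : rep_data A).
Variables (L : splittingFieldType rat) (iota : {rmorphism L -> RR[i]}).
Variable F : {subfield L}.

(* The element of Gal(K/F) sending zeta_f to zeta_f^a; the default 1 is only used
   for a not prime to f. *)
Definition gamma (a : int) : gal_of {:L} :=
  odflt 1%g [pick g in 'Gal({:L} / F)%g |
    `[< forall z : L, iota z = zeta RR (conductor rho) ->
          iota (g z) = zeta RR (conductor rho) ^ a >]].

(* The sign with gamma_a(sqrt |e V|) = epsilon(e, a) sqrt |e V|. *)
Definition epsilon (e : A) (a : int) : int :=
  if `[< forall s : L, iota s = sqrtC #|idem_image rho e|%:R ->
           gamma a s = s >] then 1 else -1.

Definition sign_condition (N : nat) (a : 'I_N -> int) : Prop :=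
  forall e : A, symmetric_idempotent e -> \prod_i epsilon e (a i) = 1.

Variable m : nat.
Local Notation Vm := (genus_rep rho m).

Definition coord (w : Vm) (k : 'rV[L]_#|Vm|) : L := k 0 (enum_rank w).

Definition conj_monomial (e : Vm -> gal_of {:L} -> nat) :
    'rV[L]_#|Vm| -> L^o :=
  fun k => \prod_(alpha in 'Gal({:L} / F)%g) \prod_(w : Vm)
             alpha (coord w k) ^+ e w alpha.

(* The multidegree d is indexed by the elements of Gal(K/F) themselves. *)
Definition conj_poly (d : gal_of {:L} -> nat) : set ('rV[L]_#|Vm| -> L^o) :=
  lin_span [set p | exists2 e : Vm -> gal_of {:L} -> nat,
      (forall alpha, alpha \in 'Gal({:L} / F)%g -> (\sum_w e w alpha)%N = d alpha)
    & p = conj_monomial e].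

(* An element of C_m(rho) has its entries in K(rho); it is identified with the
   matrix G over L that iota maps to it. *)
Definition cw_invariant (T : symm_choice (mat_form A m))
    (p : 'rV[L]_#|Vm| -> L^o) : Prop :=
  forall G : 'M[L]_#|Vm|,
    clifford_weil RR T (genus_rep rho m) (map_mx iota G) ->
    forall k, p (k *m invmx G) = p k.

Definition gamma_fiber (N : nat) (a : 'I_N -> int) (alpha : gal_of {:L}) :
    {set 'I_N} :=
  [set i | gamma (a i) == alpha]%SET.

Definition ccwe (N : nat) (a : 'I_N -> int) (C : {set sum_rep rho a}) :
    'rV[L]_#|Vm| -> L^o :=
  fun k =>
    \sum_(c : {ffun 'I_m -> sum_rep rho a} | [forall r, c r \in C])
      \prod_(alpha in 'Gal({:L} / F)%g)
        \prod_(i in gamma_fiber a alpha)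
          alpha (coord [ffun r => (c r : {ffun 'I_N -> rho}) i] k).

End ConjugatePolynomials.

Arguments conj_monomial {A} rho {L} F {m} e _.
Arguments conj_poly {A} rho {L} F m d _.
Arguments cw_invariant {RR A rho L} iota {m} T p.
Arguments gamma_fiber {RR A} rho {L} iota F {N} a alpha.
Arguments ccwe {RR A rho L} iota F m {N a} C _.

(* Main.v *)
Require Import Defs.
From HB Require Import structures.
From mathcomp Require Import all_boot all_order all_algebra all_field.
From mathcomp Require Import finmap complex.
From mathcomp Require Import boolp classical_sets functions cardinality.
From mathcomp Require Import reals trigo.
From mathcomp Require Import zify ring lra.

Set Implicit Arguments.
Unset Strict Implicit.
Unset Printing Implicit Defensive.

Import Order.TTheory GRing.Theory Num.Theory.
Local Open Scope classical_set_scope.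
Local Open Scope ring_scope.

(* Fix a tuple a.  An element of degree d in the conjugate coordinates is a sum of
   monomials prod_i gamma_(a_i)(x_(w_i)), so it is given by a tensor t on (V^m)^N,
   on which a matrix G acts through the tensor product of the gamma_(a_i)(G).  By the
   sign condition the generators of C_1(rho), placed in one coordinate of V^m, act as
   the generators of C_1(rho^a).  Hence an invariant tensor y, viewed as a function
   on (V^N)^m, lies in each coordinate in the span U_1 of the indicators of the codes
   of Type rho^a, by the Weight Enumerator Conjecture, and the operators d_phi with
   off-diagonal phi force distinct coordinates of its support to be orthogonal.
   Such a y is a combination of the indicators of the C^m: on a component orthogonal
   to them, Poisson summation over the codes, together with a maximum principle,
   gives y = 0.

   The operators used generate all of C_m(rho).  They generate a finite group, since
   they normalise a Heisenberg group and a self-dual isotropic code in rho^(1,..,1)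
   leaves only finitely many scalars; and it has the same invariants as C_m(rho) in
   all tensor powers, by the above for a = (1,..,1).  Finally, the invariants are
   defined over K because the indicators are. *)

(** * Characters of Q/Z *)

(** The conjecture is given for [A] and the sign condition speaks of idempotents of R, while
    C_m(rho) also contains operators h for idempotents of Mat_m(R), whose Galois conjugates are not
    controlled directly. This is why generation by one-coordinate operators must be proved. It
    follows by comparing invariants: a finite matrix group is determined by its invariants in all
    tensor powers, and for a = (1,..,1) self-duality and isotropy alone show that all of C_m(rho)
    fixes the indicators of the C^m.

    In the descent, averaging over an isotropic code D turns the indicator of C into a multiple of
    that of (C ∩ D⊥) + D, again of Type rho^a; this permits an induction on D. The maximum principle
    is strict because |D| |D⊥| = |V^N|, while t = 0 lies in D⊥ and gives no Fourier coefficient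
    unless D is of Type.

    A conjugate polynomial does not determine its tensor, since coordinates with equal gamma_(a_i)
    can be permuted; averaging over the finite group yields an invariant tensor with the same
    polynomial. *)

Section Exponential.
Variable RR : realType.
Implicit Types (x y : RR) (p q : QmodZ).

Lemma exp2piD x y : exp2pi (x + y) = exp2pi x * exp2pi y.
Proof.
rewrite /exp2pi mulrDr cosD sinD; apply/eqP; rewrite eq_complex /=.
by apply/andP; split; apply/eqP => //; rewrite addrC.
Qed.

Lemma exp2pi0 : exp2pi (0 : RR) = 1.
Proof. by rewrite /exp2pi mulr0 cos0 sin0. Qed.

Lemma exp2pi_nat (n : nat) : exp2pi (n%:R : RR) = 1.
Proof.
elim: n => [|n IH]; first exact: exp2pi0.
rewrite -addn1 natrD exp2piD IH mul1r /exp2pi mulr1 mulr_natl.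
by rewrite cos2pi sin2pi.
Qed.

Lemma exp2piN x : exp2pi (- x) * exp2pi x = 1.
Proof. by rewrite -exp2piD addNr exp2pi0. Qed.

Lemma exp2pi_int (n : int) : exp2pi (n%:~R : RR) = 1.
Proof.
case: n => n; first exact: exp2pi_nat.
rewrite NegzE mulrNz; have := exp2piN (n.+1%:R).
by rewrite exp2pi_nat mulr1.
Qed.

Lemma exp2pi_eq1 x : 0 <= x < 1 -> exp2pi x = 1 -> x = 0.
Proof.
move=> /andP[x0 x1] /(congr1 (@complex.Re RR)); rewrite /exp2pi /= => Hc.
have pi0 := pi_gt0 RR.
apply: contra_eq Hc => xn0; have {}x0 : 0 < x by rewrite lt0r xn0.
suff: cos (2 * pi * x) < cos 0 by rewrite cos0 => /lt_eqF ->.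
case: (lerP (2 * pi * x) pi) => h.
  have x0' : 0 < 2 * pi * x by rewrite !mulr_gt0.
  by rewrite ltr_cos // in_itv /= ?lexx ?(ltW pi0) ?(ltW x0').
(* In the second half of the period the angle is reflected to 2 pi - 2 pi x, back in the range where
   the cosine is strictly decreasing. *)
have h2 : 0 < - (2 * pi * x) + pi *+ 2 <= pi.
  by rewrite -mulr_natl; apply/andP; split; nra.
rewrite -cosN -(cosD2pi (- _)) ltr_cos ?in_itv /= ?lexx ?(ltW pi0) //.
  by case/andP: h2.
by case/andP: h2 => /ltW -> ->.
Qed.

Lemma reprQZP q r : \pi_(QmodZ)%qT r = q -> repr q - r \is a Num.int.
Proof.
move=> <-; have : repr (\pi_(QmodZ)%qT r) - r \in rat_integral.
  by rewrite Quotient.idealrBE reprK.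
by [].
Qed.

Lemma expQZ_pi (r : rat) : expQZ RR (\pi_(QmodZ)%qT r) = exp2pi (ratr r).
Proof.
have /intrP[n hn] := reprQZP (erefl (\pi_(QmodZ)%qT r)).
rewrite /expQZ -[repr _](subrK r) hn rmorphD /= ratr_int exp2piD exp2pi_int.
by rewrite mul1r.
Qed.

Lemma expQZD p q : expQZ RR (p + q) = expQZ RR p * expQZ RR q.
Proof.
by rewrite -{1}[p]reprK -{1}[q]reprK -raddfD expQZ_pi rmorphD exp2piD.
Qed.

Lemma expQZ0 : expQZ RR 0 = 1.
Proof. by rewrite -(raddf0 (\pi_(QmodZ)%qT)) expQZ_pi rmorph0 exp2pi0. Qed.

Lemma expQZN q : expQZ RR (- q) = (expQZ RR q)^-1.
Proof.
have h : expQZ RR (- q) * expQZ RR q = 1 by rewrite -expQZD addNr expQZ0.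
have nz : expQZ RR q != 0.
  by apply: contra_eq_neq h => ->; rewrite mulr0 eq_sym oner_eq0.
by apply: (mulIf nz); rewrite mulVf.
Qed.

Lemma expQZB p q : expQZ RR (p - q) = expQZ RR p / expQZ RR q.
Proof. by rewrite expQZD expQZN. Qed.

Lemma expQZ_neq0 q : expQZ RR q != 0.
Proof.
have h : expQZ RR (- q) * expQZ RR q = 1 by rewrite -expQZD addNr expQZ0.
by apply: contra_eq_neq h => ->; rewrite mulr0 eq_sym oner_eq0.
Qed.

Lemma expQZMn q n : expQZ RR (q *+ n) = expQZ RR q ^+ n.
Proof.
elim: n => [|n IH]; first by rewrite mulr0n expr0 expQZ0.
by rewrite mulrS exprS expQZD IH.
Qed.

Lemma expQZMz q (n : int) : expQZ RR (q *~ n) = expQZ RR q ^ n.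
Proof.
case: n => n; first by rewrite -pmulrn expQZMn.
by rewrite NegzE mulrNz expQZN -pmulrn expQZMn.
Qed.

Lemma expQZ_sum (I : Type) (s : seq I) (P : pred I) (F : I -> QmodZ) :
  expQZ RR (\sum_(i <- s | P i) F i) = \prod_(i <- s | P i) expQZ RR (F i).
Proof. by apply: (big_morph _ expQZD expQZ0). Qed.

Lemma expQZ_eq1 q : expQZ RR q = 1 -> q = 0.
Proof.
(* The representative is replaced by its fractional part, since [exp2pi_eq1] needs an argument in
   [0, 1). *)
set r := repr q; set n := Num.floor r.
have hr : \pi_(QmodZ)%qT (r - n%:~R) = q.
  rewrite -[RHS]reprK; apply/eqP; rewrite -Quotient.idealrBE.
  rewrite -/r [_ - r]addrC addKr; change ((- n%:~R : rat) \is a Num.int).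
  by rewrite rpredN intr_int.
rewrite -{1}hr expQZ_pi => /exp2pi_eq1 h.
have h1 := floor_le r; have h2 := floorD1_gt r; rewrite intrD in h2.
have : ratr (r - n%:~R) = 0 :> RR.
  apply: h; rewrite -(rmorph0 (@ratr RR)) -(rmorph1 (@ratr RR)).
  by rewrite ler_rat ltr_rat; move: h1 h2; rewrite -/n; lra.
move/eqP; rewrite fmorph_eq0 => /eqP h0.
by rewrite -hr h0 raddf0.
Qed.

Lemma expQZ_inj : injective (expQZ RR).
Proof.
move=> p q h; apply/eqP; rewrite -subr_eq0; apply/eqP/expQZ_eq1.
by rewrite expQZB h divff // expQZ_neq0.
Qed.

Lemma normr_exp2pi x : `|exp2pi x| = 1.
Proof. by rewrite normc_def /exp2pi /= cos2Dsin2 sqrtr1. Qed.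

Lemma normr_expQZ q : `|expQZ RR q| = 1.
Proof. exact: normr_exp2pi. Qed.

Lemma exp2piMn x n : exp2pi (x *+ n) = exp2pi x ^+ n.
Proof.
elim: n => [|n IH]; first by rewrite mulr0n expr0 exp2pi0.
by rewrite mulrS exprS exp2piD IH.
Qed.

Lemma zeta_exp f : (0 < f)%N -> zeta RR f ^+ f = 1.
Proof.
move=> f0; rewrite /zeta -exp2piMn -[_ *+ f]mulr_natr mulVf ?pnatr_eq0 -?lt0n //.
exact: (exp2pi_nat 1).
Qed.

Lemma zeta_prim f : (0 < f)%N -> f.-primitive_root (zeta RR f).
Proof.
move=> f0; rewrite /primitive_root_of_unity f0 /=; apply/forallP => /= i.
rewrite unity_rootE -exp2piMn; apply/eqP.
case: (eqVneq i.+1 f) => [->|ne].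
  by rewrite exp2piMn zeta_exp // !eqxx.
apply/negP => /eqP /exp2pi_eq1 h.
have /eqP : f%:R^-1 *+ i.+1 = 0 :> RR.
  have f0' : 0 < f%:R :> RR by rewrite ltr0n.
  apply: h; rewrite -[_ *+ _]mulr_natr mulrC.
  rewrite divr_ge0 ?ler0n //= ltr_pdivrMr // mul1r ltr_nat.
  by have := ltn_ord i; rewrite leq_eqVlt (negPf ne).
by rewrite -[_ *+ i.+1]mulr_natr mulf_eq0 invr_eq0 !pnatr_eq0 -[f == 0]leqn0 leqNgt f0.
Qed.

(** This places the roots of unity in the operators inside Q(zeta_f), where gamma_a is known. *)
Lemma expQZ_zeta f q : (0 < f)%N -> q *+ f = 0 ->
  exists k : 'I_f, expQZ RR q = zeta RR f ^+ k.
Proof.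
move=> f0 qf.
have h1 : expQZ RR q ^+ f = 1 by rewrite -expQZMn qf expQZ0.
by have [k hk] := prim_rootP (zeta_prim f0) h1; exists k.
Qed.

End Exponential.

(** What the Fourier and Heisenberg arguments need of a representation. Kept apart from [is_rep] so
    that it can be checked directly for V^m over the matrix form ring, without verifying all axioms
    there. The form need not be symmetric, hence the separate clause for the right radical. *)
Record is_hermitian (A : form_data) (rho : rep_data A) : Prop := IsHermitian {
  hscale_biadd : biadditive (@rscale A rho);
  hscale_one : forall x : rho, rscale 1 x = x;
  hscale_mul : forall r s (x : rho), rscale (r * s) x = rscale r (rscale s x);
  hbeta_biadd : biadditive (@rbeta A rho);
  hbeta_nonsingular : nonsingular (@rbeta A rho);
  hbeta_nondegr : forall y : rho, (forall x, rbeta x y = 0) -> y = 0;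
  hbeta_adj : forall r (x y : rho),
    rbeta (rscale r x) y = rbeta x (rscale (fconj r) y) }.

Lemma morph_add0 (X Y : zmodType) (h : X -> Y) :
  {morph h : x y / x + y} -> h 0 = 0.
Proof. by move=> hD; apply: (addrI (h 0)); rewrite -hD !addr0. Qed.

Lemma morph_addN (X Y : zmodType) (h : X -> Y) :
  {morph h : x y / x + y} -> {morph h : x / - x}.
Proof.
by move=> hD x; apply: (addrI (h x)); rewrite -hD !subrr (morph_add0 hD).
Qed.

Lemma morph_addB (X Y : zmodType) (h : X -> Y) :
  {morph h : x y / x + y} -> {morph h : x y / x - y}.
Proof. by move=> hD x y; rewrite hD (morph_addN hD). Qed.

Lemma morph_sum (X Y : zmodType) (h : X -> Y) (I : Type) (s : seq I)
    (P : pred I) (F : I -> X) :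
  {morph h : x y / x + y} ->
  h (\sum_(i <- s | P i) F i) = \sum_(i <- s | P i) h (F i).
Proof. by move=> hD; apply: (big_morph h hD (morph_add0 hD)). Qed.

Section CharacterSums.
Variables (RR : realType) (V : finZmodType).

(** If h(b) is non-zero for some b in B, translating the summation by b multiplies the sum by exp(2
    pi i h(b)), which is not 1. *)
Lemma sum_char (B : {set V}) (h : V -> QmodZ) :
    0 \in B -> {in B &, forall x y, x - y \in B} ->
    {morph h : x y / x + y} ->
  \sum_(x in B) expQZ RR (h x) = #|B|%:R *+ [forall x in B, h x == 0].
Proof.
move=> B0 BB hD; case: (boolP [forall x in B, _]) => [/forall_inP h0|].
  rewrite mulr1n (eq_bigr (fun _ => 1)) ?sumr_const // => x /h0/eqP ->.
  exact: expQZ0.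
rewrite negb_forall_in => /exists_inP[b bB hb].
have BN x : x \in B -> - x \in B by move=> xB; rewrite -sub0r BB.
set S := \sum_(x in B) _.
have SE : S = expQZ RR (h b) * S.
  rewrite {1}/S (reindex_inj (addrI b)) /= /S mulr_sumr.
  apply: eq_big => [x|x _]; last by rewrite hD expQZD.
  apply/idP/idP => [h1|h1]; first by rewrite -[x](addKr b) addrC BB.
  by rewrite -[x]opprK BB // BN.
rewrite mulr0n; have [//|S0] := eqVneq S 0.
move: hb; rewrite (_ : h b = 0) ?eqxx //; apply: (@expQZ_eq1 RR).
by apply: (mulIf S0); rewrite mul1r -SE.
Qed.

Lemma sum_charT (h : V -> QmodZ) : {morph h : x y / x + y} ->
  \sum_x expQZ RR (h x) = #|V|%:R *+ [forall x, h x == 0].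
Proof.
move=> hD; rewrite -[in RHS]cardsT.
rewrite (_ : [forall x, h x == 0] = [forall x in [set: V]%SET, h x == 0]).
  rewrite -sum_char //; first by apply: eq_bigl => x; rewrite inE.
    by rewrite inE.
  by move=> *; rewrite inE.
by apply: eq_forallb => x; rewrite inE.
Qed.

End CharacterSums.

(** * Codes and their duals *)

Section HermitianTheory.
Variables (A : form_data) (rho : rep_data A) (hrho : is_hermitian rho).
Implicit Types (r s : A) (x y z : rho) (C D B : {set rho}).

Lemma scaleDr r : {morph @rscale A rho r : x y / x + y}.
Proof. exact: (hscale_biadd hrho).2. Qed.
Lemma scaleDl x : {morph (@rscale A rho)^~ x : r s / r + s}.
Proof. exact: (hscale_biadd hrho).1. Qed.
Lemma scale0r r : rscale r 0 = 0 :> rho.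
Proof. exact: morph_add0 (scaleDr r). Qed.
Lemma scale0l x : rscale 0 x = 0.
Proof. exact: morph_add0 (scaleDl x). Qed.
Lemma scaleBr r : {morph @rscale A rho r : x y / x - y}.
Proof. exact: morph_addB (scaleDr r). Qed.
Lemma scaleBl x : {morph (@rscale A rho)^~ x : r s / r - s}.
Proof. exact: morph_addB (scaleDl x). Qed.
Lemma scaleN1 x : rscale (- 1) x = - x.
Proof. by rewrite (morph_addN (scaleDl x)) (hscale_one hrho). Qed.

Lemma betaDl y : {morph (@rbeta A rho)^~ y : x x' / x + x'}.
Proof. exact: (hbeta_biadd hrho).1. Qed.
Lemma betaDr x : {morph @rbeta A rho x : y y' / y + y'}.
Proof. exact: (hbeta_biadd hrho).2. Qed.
Lemma beta0l y : rbeta 0 y = 0 :> QmodZ.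
Proof. exact: morph_add0 (betaDl y). Qed.
Lemma beta0r x : rbeta x 0 = 0.
Proof. exact: morph_add0 (betaDr x). Qed.
Lemma betaBl y : {morph (@rbeta A rho)^~ y : x x' / x - x'}.
Proof. exact: morph_addB (betaDl y). Qed.
Lemma betaBr x : {morph @rbeta A rho x : y y' / y - y'}.
Proof. exact: morph_addB (betaDr x). Qed.

Lemma beta_nondegl x : (forall y, rbeta x y = 0) -> x = 0.
Proof.
move=> x0; have [|z [_ zu]] := @hbeta_nonsingular _ _ hrho (fun=> 0).
  by move=> a b; rewrite addr0.
by rewrite -(zu x x0) (zu 0) // => y; rewrite beta0l.
Qed.

Lemma code0 C : is_code C -> 0 \in C.
Proof. by case. Qed.
Lemma codeD C x y : is_code C -> x \in C -> y \in C -> x + y \in C.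
Proof. by case=> _ h _; apply: h. Qed.
Lemma codeZ C r x : is_code C -> x \in C -> rscale r x \in C.
Proof. by case=> _ _ h; apply: h. Qed.
Lemma codeN C x : is_code C -> x \in C -> - x \in C.
Proof. by move=> hC xC; rewrite -scaleN1 codeZ. Qed.
Lemma codeB C x y : is_code C -> x \in C -> y \in C -> x - y \in C.
Proof. by move=> hC xC yC; rewrite codeD ?codeN. Qed.
Lemma codeDr C x y : is_code C -> y \in C -> (x + y \in C) = (x \in C).
Proof.
move=> hC yC; apply/idP/idP => [h|h]; last exact: codeD.
by rewrite -[x](addrK y) codeB.
Qed.
Lemma codeDl C x y : is_code C -> x \in C -> (x + y \in C) = (y \in C).
Proof. by move=> hC yC; rewrite addrC codeDr. Qed.

Lemma dualP C x : reflect (forall c, c \in C -> rbeta x c = 0) (x \in dual_code C).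
Proof.
rewrite inE; apply: (iffP forall_inP) => h c cC; first by apply/eqP/h.
by apply/eqP/h.
Qed.

Lemma dual_is_code C : is_code C -> is_code (dual_code C).
Proof.
move=> hC; split.
- by apply/dualP => c _; rewrite beta0l.
- by move=> x y /dualP hx /dualP hy; apply/dualP => c cC; rewrite betaDl hx ?hy ?addr0.
- move=> r x /dualP hx; apply/dualP => c cC.
  by rewrite (hbeta_adj hrho) hx // codeZ.
Qed.

Lemma dualS C D : C \subset D -> dual_code D \subset dual_code C.
Proof.
by move=> /fintype.subsetP CD; apply/fintype.subsetP => x /dualP h; apply/dualP => c /CD/h.
Qed.

Lemma scode C D : is_code C -> is_code D -> is_code (C :&: D)%SET.
Proof.
move=> hC hD; split; first by rewrite inE !code0.
  by move=> x y; rewrite !inE => /andP[a b] /andP[c d]; rewrite !codeD.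
by move=> r x; rewrite !inE => /andP[a b]; rewrite !codeZ.
Qed.

Definition add_code C D : {set rho} := [set x + y | x in C, y in D]%SET.

Lemma add_codeP C D x :
  reflect (exists c d, [/\ c \in C, d \in D & x = c + d]) (x \in add_code C D).
Proof.
apply: (iffP imset2P) => [[c d ? ? ->]|[c [d [? ? ->]]]]; first by exists c, d.
by exists c d.
Qed.

Lemma add_is_code C D : is_code C -> is_code D -> is_code (add_code C D).
Proof.
move=> hC hD; split.
- by apply/add_codeP; exists 0, 0; rewrite !code0 ?addr0.
- move=> x y /add_codeP[c [d [cC dD ->]]] /add_codeP[c' [d' [c'C d'D ->]]].
  by apply/add_codeP; exists (c + c'), (d + d'); rewrite !codeD // addrACA.
- move=> r x /add_codeP[c [d [cC dD ->]]]; apply/add_codeP.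
  by exists (rscale r c), (rscale r d); rewrite !codeZ // scaleDr.
Qed.

Lemma sub_addl C D : is_code D -> C \subset add_code C D.
Proof.
move=> hD; apply/fintype.subsetP => x xC; apply/add_codeP; exists x, 0.
by rewrite addr0 code0.
Qed.

Lemma sub_addr C D : is_code C -> D \subset add_code C D.
Proof.
move=> hC; apply/fintype.subsetP => x xC; apply/add_codeP; exists 0, x.
by rewrite add0r code0.
Qed.

Lemma add_subset B C D : is_code B ->
  C \subset B -> D \subset B -> add_code C D \subset B.
Proof.
move=> hB /fintype.subsetP CB /fintype.subsetP DB; apply/fintype.subsetP => x /add_codeP[c [d [cC dD ->]]].
by apply: codeD => //; [apply: CB|apply: DB].
Qed.

(** The double sum of exp(2 pi i beta(x, c)) is evaluated in both orders: over c first it detects x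
    in the dual, over x first only c = 0 survives. *)
Lemma card_dual (RR : realType) C : is_code C -> (#|C| * #|dual_code C|)%N = #|rho|.
Proof.
move=> hC; apply/eqP; rewrite -(eqr_nat (RR[i])).
pose S : RR[i] := \sum_x \sum_(c in C) expQZ RR (rbeta x c).
have S1 : S = (#|C| * #|dual_code C|)%N%:R.
  rewrite natrM mulr_natr -sumr_const big_mkcond /= /S.
  apply: eq_bigr => x _; rewrite sum_char ?code0 //; first by rewrite inE; case: ifP.
    by move=> c d cC dC; apply: codeB.
  exact: betaDr.
rewrite -S1 /S exchange_big /= (bigD1 0) ?code0 //= [X in _ + X]big1 ?addr0.
  rewrite (eq_bigr (fun _ => 1)) => [|x _]; last by rewrite beta0r expQZ0.
  by rewrite sumr_const.
move=> c /andP[_ c0].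
rewrite sum_charT; last exact: betaDl.
rewrite (_ : [forall x, _] = false) ?mulr0n //.
apply: contraNF c0 => /forallP h; apply/eqP; apply: (hbeta_nondegr hrho) => x.
exact/eqP/h.
Qed.

End HermitianTheory.

Section RepresentationTheory.
Variables (A : form_data) (hA : is_form_ring A).
Variables (rho : rep_data A) (hrho : is_rep rho).
Implicit Types (r s : A) (x y z w : rho) (C D B E : {set rho}).

Lemma rbil_psi r x y : rbil (fpsi r) x y = rbeta x (rscale r y).
Proof.
by rewrite -[r]mul1r (fpsi_mul hA) (rbil_act hrho) mul1r (rscale_one hrho).
Qed.

Lemma rbilE m x y : rbil m x y = rbeta x (rscale (fpsiV m) y).
Proof. by rewrite -rbil_psi (fpsiVK hA). Qed.

(** The unit that exchanges the arguments of beta. As codes are R-modules, it makes left and right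
    orthogonality to a code the same. *)
Definition eps_tau : A := fpsiV (ftau (fpsi 1)).

Lemma rbetaC x y : rbeta y x = rbeta x (rscale eps_tau y).
Proof. by rewrite -rbilE (rbil_tau hrho). Qed.

Lemma rep_hermitian : is_hermitian rho.
Proof.
split.
- exact: rscale_biadd hrho.
- exact: rscale_one hrho.
- exact: rscale_mul hrho.
- exact: rbil_biadd hrho _.
- exact: rbeta_nonsingular hrho.
- move=> y hy; have [s [es se]] := ftau_unit hA.
  have nd z : (forall x, rbeta z x = 0) -> z = 0.
    move=> z0; have [|t [_ tu]] := @rbeta_nonsingular _ _ hrho (fun=> 0).
      by move=> a b; rewrite addr0.
    rewrite -(tu z z0) (tu 0) // => x.
    exact: morph_add0 ((rbil_biadd hrho (fpsi 1)).1 x).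
  (* [nonsingular] gives uniqueness in the left argument only. As s inverts [eps_tau], beta(s y, x)
     = beta(x, y) = 0 for all x. *)
  have : rscale s y = 0.
    apply: nd => x; rewrite rbetaC -(rscale_mul hrho) es (rscale_one hrho).
    exact: hy.
  move/(congr1 (rscale eps_tau)); rewrite -(rscale_mul hrho) es (rscale_one hrho).
  by rewrite (morph_add0 ((rscale_biadd hrho).2 _)).
- by move=> r x y; rewrite /fconj -rbilE (rbil_act hrho) (rscale_one hrho).
Qed.

Let hh := rep_hermitian.

Lemma dual_sym C x y : is_code C -> x \in C -> y \in dual_code C -> rbeta x y = 0.
Proof. by move=> hC xC /dualP yC; rewrite rbetaC yC // codeZ. Qed.

Lemma dualK (RR : realType) C : is_code C -> dual_code (dual_code C) = C.
Proof.
move=> hC; apply/esym/eqP; rewrite eqEcard; apply/andP; split.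
  by apply/fintype.subsetP => x xC; apply/dualP => y; exact: dual_sym.
have h1 := card_dual hh RR hC; have hd := dual_is_code hh hC.
have := card_dual hh RR hd; rewrite -h1 mulnC => /eqP.
rewrite eqn_pmul2r => [/eqP -> //|]; apply/card_gt0P; exists 0.
exact: code0.
Qed.

Lemma dual_add C D : is_code C -> is_code D ->
  dual_code (add_code C D) = (dual_code C :&: dual_code D)%SET.
Proof.
move=> hC hD; apply/finset.setP => x; rewrite finset.in_setI; apply/idP/andP => [h|[/dualP h1 /dualP h2]].
  split; first exact: (fintype.subsetP (dualS (sub_addl C hD))).
  exact: (fintype.subsetP (dualS (sub_addr D hC))).
apply/dualP => c /add_codeP[a [b [aC bD ->]]].
by rewrite (betaDr hh) h1 ?h2 ?addr0.
Qed.

Lemma dual_cap (RR : realType) C D : is_code C -> is_code D ->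
  dual_code (C :&: D)%SET = add_code (dual_code C) (dual_code D).
Proof.
move=> hC hD; have dC := dual_is_code hh hC; have dD := dual_is_code hh hD.
by rewrite -[RHS](dualK RR) ?dual_add ?(dualK RR) //; apply: add_is_code hh _ _ _ _.
Qed.

Definition iso_code C := is_code C /\ isotropic C.

Lemma type_iso C : type_code C -> iso_code C.
Proof. by case. Qed.

Lemma type_is_code C : type_code C -> is_code C.
Proof. by case. Qed.

Lemma type_dual C : type_code C -> dual_code C = C.
Proof. by case. Qed.

Lemma iso_sub C D : iso_code C -> is_code D -> D \subset C -> iso_code D.
Proof.
move=> [hC [CC CQ]] hD DC; split=> //; split.
  exact: (fintype.subset_trans DC (fintype.subset_trans CC (dualS DC))).
by move=> phi x xD; apply/CQ/(fintype.subsetP DC).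
Qed.

Lemma iso_add C D : iso_code C -> iso_code D -> C \subset dual_code D ->
  iso_code (add_code C D).
Proof.
move=> [hC [CC CQ]] [hD [DD DQ]] CD; split; first exact: add_is_code.
split.
  apply: add_subset; first exact/dual_is_code/add_is_code.
    by rewrite dual_add // finset.subsetI CC.
  rewrite dual_add // finset.subsetI DD andbT; apply/fintype.subsetP => d dD.
  apply/dualP => c cC; apply: (dual_sym hD dD).
  exact: (fintype.subsetP CD).
move=> phi x /add_codeP[c [d [cC dD ->]]].
have := rbil_lam hrho phi c d; rewrite rbilE (CQ _ c) // (DQ _ d) // !subr0 => <-.
have /dualP := fintype.subsetP CD _ cC; apply; exact: codeZ.
Qed.

(** The neighbour of C along D: among the codes containing an isotropic D, it is the one of Type
    obtained from C. *)
Definition ext_code C D := add_code (C :&: dual_code D)%SET D.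

Lemma ext_type (RR : realType) C D :
  type_code C -> iso_code D -> type_code (ext_code C D).
Proof.
move=> tC iD; have [hC dC iC] := tC; have [hD [DD _]] := iD.
have hd := dual_is_code hh hD.
have hc : is_code (C :&: dual_code D)%SET by apply: scode.
have ie : iso_code (ext_code C D).
  apply: iso_add => //; last exact: finset.subsetIr.
  by apply: iso_sub (type_iso tC) hc _; exact: finset.subsetIl.
split; [exact: ie.1| |exact: ie.2].
apply/eqP; rewrite finset.eqEsubset ie.2.1 /=; apply/fintype.subsetP => x.
rewrite dual_add // finset.in_setI (dual_cap RR) // (dualK RR) // -dC.
move=> /andP[/add_codeP[c [d [cC dD ->]]] xd]; apply/add_codeP.
exists c, d; split=> //; rewrite finset.in_setI cC /=.
by move: xd; rewrite (codeDr hh) // (fintype.subsetP DD).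
Qed.

Lemma sub_ext C D : is_code C -> is_code D -> D \subset ext_code C D.
Proof. by move=> hC hD; apply: sub_addr; apply: scode => //; exact: dual_is_code. Qed.

Lemma type_card (RR : realType) C : type_code C -> (#|C| * #|C|)%N = #|rho|.
Proof. by move=> tC; rewrite -{2}(type_dual tC) (card_dual hh RR) //; case: tC. Qed.

Definition cyc w : {set rho} := [set x | `[< exists r, x = rscale r w >]]%SET.

Lemma cycP w x : reflect (exists r, x = rscale r w) (x \in cyc w).
Proof. by rewrite inE; apply: asboolP. Qed.

Lemma cyc_code w : is_code (cyc w).
Proof.
split; first by apply/cycP; exists 0; rewrite (scale0l hh).
  move=> x y /cycP[r ->] /cycP[s ->]; apply/cycP; exists (r + s).
  by rewrite (scaleDl hh).
move=> r x /cycP[s ->]; apply/cycP; exists (r * s).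
by rewrite (rscale_mul hrho).
Qed.

Lemma cyc_id w : w \in cyc w.
Proof. by apply/cycP; exists 1; rewrite (rscale_one hrho). Qed.

Lemma cyc_sub w C : is_code C -> (cyc w \subset C) = (w \in C).
Proof.
move=> hC; apply/fintype.subsetP/idP => [h|wC x]; first exact/h/cyc_id.
by case/cycP => r ->; apply: codeZ.
Qed.

(** Dualising C ∩ E⊥ = D gives D⊥ = C + E. An element of E⊥ lies in D⊥, so it is c + e, and its part
    c lies in C ∩ E⊥ = D, hence in E. *)
Lemma type_max (RR : realType) C D E : type_code C -> iso_code D -> iso_code E ->
  D \subset E -> (C :&: dual_code E)%SET = D -> type_code E.
Proof.
move=> tC iD iE DE CE; have hE := iE.1; have hd := dual_is_code hh hE.
split; [exact: hE| |exact: iE.2].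
apply/eqP; rewrite finset.eqEsubset iE.2.1 /=; apply/fintype.subsetP => x xE.
have : x \in dual_code D by apply: (fintype.subsetP (dualS DE)).
have hC := type_is_code tC.
rewrite -CE (dual_cap RR) // (dualK RR) // (type_dual tC).
case/add_codeP => c [e [cC eE xE']]; rewrite xE'.
have cd : c \in dual_code E.
  by rewrite -(addrK e c) -xE' (codeB hh) // (fintype.subsetP iE.2.1).
apply: codeD => //; apply: (fintype.subsetP DE).
by rewrite -CE finset.in_setI cC.
Qed.

End RepresentationTheory.

(** Gram-Schmidt, one vector of [s] at a time, along the component h of the new vector orthogonal to
    the earlier ones. That u lies in the span is expressed by closure predicates, which lets later
    properties be transported to u without a vector space structure. *)
Lemma orthogonal_decomposition (CC : numClosedFieldType) (T : finType)
    (s : seq (T -> CC)) (y : T -> CC) :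
  exists u : T -> CC,
    (forall P : (T -> CC) -> Prop, P (fun=> 0) ->
       (forall a f g, P f -> P g -> P (fun x => f x + a * g x)) ->
       (forall g, List.In g s -> P g) -> P u) /\
    (forall g, List.In g s -> \sum_x (y x - u x) * (g x)^* = 0).
Proof.
elim: s y => [|g0 s IH] y; first by exists (fun=> 0); split=> // P.
have [ug [Pug oug]] := IH g0; have [u [Pu ou]] := IH y.
pose h x := g0 x - ug x.
pose n := \sum_x h x * (h x)^*.
pose k := (\sum_x (y x - u x) * (h x)^*) / n.
pose u' x := u x + k * (g0 x + (- 1) * ug x).
have uE x : y x - u' x = (y x - u x) - k * h x.
  by rewrite /u' /h mulN1r opprD addrA.
have os g : List.In g s -> \sum_x (y x - u' x) * (g x)^* = 0.
  move=> gs; rewrite (eq_bigr (fun x => (y x - u x) * (g x)^* - k * (h x * (g x)^*))).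
    by rewrite sumrB ou // -mulr_sumr oug // mulr0 subr0.
  by move=> x _; rewrite uE mulrBl mulrA.
have oh : \sum_x (y x - u' x) * (h x)^* = 0.
  rewrite (eq_bigr (fun x => (y x - u x) * (h x)^* - k * (h x * (h x)^*))); last first.
    by move=> x _; rewrite uE mulrBl mulrA.
  rewrite sumrB -mulr_sumr -/n /k; have [n0|n0] := eqVneq n 0; last first.
    by rewrite divfK // subrr.
  (* When n = 0 the new vector already lies in the span, and the division by n in [k] is
     harmless. *)
  have h0 x : h x = 0.
    have /psumr_eq0P := n0 => /(_ (fun x _ => mul_conjC_ge0 (h x))) /(_ x isT).
    by move/eqP; rewrite mul_conjC_eq0 => /eqP.
  by rewrite n0 mulr0 subr0 big1 // => x _; rewrite h0 conjC0 mulr0.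
exists u'; split.
  move=> P P0 Pl Ps; apply: (Pl k u _ (Pu P P0 Pl _)); first by move=> g gs; apply: Ps; right.
  apply: (Pl (- 1) g0 ug); first by apply: Ps; left.
  by apply: Pug => // g gs; apply: Ps; right.
move=> g [<-|]; last exact: os.
rewrite (eq_bigr (fun x => (y x - u' x) * (h x)^* + (y x - u' x) * (ug x)^*)); last first.
  by move=> x _; rewrite -mulrDr -rmorphD subrK.
rewrite big_split /= oh add0r.
pose P f := \sum_x (y x - u' x) * (f x : CC)^* = 0.
apply: (Pug P) => //.
  by rewrite /P big1 // => x _; rewrite conjC0 mulr0.
move=> a f f' Pf Pf'; rewrite /P.
rewrite (eq_bigr (fun x => (y x - u' x) * (f x)^* + a^* * ((y x - u' x) * (f' x)^*))).
  by rewrite big_split /= -mulr_sumr Pf Pf' mulr0 addr0.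
by move=> x _; rewrite rmorphD rmorphM mulrDr; congr (_ + _); rewrite mulrCA.
Qed.

(** * Fourier analysis on codes *)

Section GenusDescent.
Variables (RR : realType) (A : form_data) (hA : is_form_ring A).
Variables (rho : rep_data A) (hrho : is_rep rho).
Local Notation CC := (RR[i]).
Implicit Types (r s : A) (w x t : rho) (C D B E : {set rho}).

Let hh := rep_hermitian hA hrho.

Definition is_type C : bool := `[< type_code C >].
Lemma is_typeP C : reflect (type_code C) (is_type C).
Proof. exact: asboolP. Qed.

Definition code_span (T : Type) (ch : {set rho} -> T -> bool) (f : T -> CC) :=
  exists c : {set rho} -> CC, forall v, f v = \sum_(C | is_type C) c C *+ ch C v.

Lemma eq_code_span (T : Type) (ch : {set rho} -> T -> bool) (f g : T -> CC) :
  f =1 g -> code_span ch g -> code_span ch f.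
Proof. by move=> fg [c hc]; exists c => v; rewrite fg. Qed.

Lemma code_span_sum (T I : Type) (s : seq I) (P : pred I) (a : I -> CC)
    (ch : {set rho} -> T -> bool) (f : I -> T -> CC) :
  (forall i, P i -> code_span ch (f i)) ->
  code_span ch (fun v => \sum_(i <- s | P i) a i * f i v).
Proof.
move=> h; elim: s => [|i s [c hc]].
  exists (fun=> 0) => v; rewrite big_nil big1 // => C _; exact: mul0rn.
case Pi: (P i); last by exists c => v; rewrite big_cons Pi.
have [c' hc'] := h i Pi.
exists (fun C => a i * c' C + c C) => v; rewrite big_cons Pi hc hc'.
rewrite mulr_sumr -big_split /=; apply: eq_bigr => C _.
by rewrite mulrnDl mulrnAr.
Qed.

Lemma code_span0 (T : Type) (ch : {set rho} -> T -> bool) : code_span ch (fun=> 0).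
Proof. by exists (fun=> 0) => v; rewrite big1 // => C _; exact: mul0rn. Qed.

Lemma code_span_lin (T : Type) (ch : {set rho} -> T -> bool) (a : CC) (f g : T -> CC) :
  code_span ch f -> code_span ch g -> code_span ch (fun v => f v + a * g v).
Proof.
move=> [c hc] [d hd]; exists (fun C => c C + a * d C) => v.
rewrite hc hd mulr_sumr -big_split /=; apply: eq_bigr => C _.
by rewrite mulrnDl mulrnAr.
Qed.

Lemma code_span_type (T : Type) (ch : {set rho} -> T -> bool) C :
  type_code C -> code_span ch (fun v => (ch C v)%:R).
Proof.
move=> /is_typeP tC; exists (fun D => (D == C)%:R) => v; rewrite (bigD1 C) //= eqxx.
by rewrite big1 ?addr0 // => D /andP[_ /negPf ->]; exact: mul0rn.
Qed.

Definition in_code C w : bool := w \in C.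
Definition U1 := code_span in_code.

Lemma U1_supp f w : U1 f -> f w != 0 -> exists2 C, type_code C & w \in C.
Proof.
move=> [c hc] fw; apply: contrapT => h; move/negP: fw; apply; apply/eqP.
rewrite hc big1 // => C /is_typeP tC; rewrite /in_code.
by case: (boolP (w \in C)) => // wC; case: h; exists C.
Qed.

Lemma right_dual C x : is_code C ->
  [forall c in C, rbeta c x == 0] = (x \in dual_code C).
Proof.
move=> hC; apply/forall_inP/idP => [h|h c cC]; last by apply/eqP/(dual_sym hA hrho hC).
have [s [es se]] := ftau_unit hA; apply/dualP => c cC.
rewrite -[c](rscale_one hrho) -es (rscale_mul hrho) -(rbetaC hA hrho).
by apply/eqP/h/codeZ.
Qed.

(** The indicator of a self-dual code is its own Fourier transform up to the order of the code. That
    order is the square root of |V| for every code of Type, so the factor is common to the span. *)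
Lemma U1_fourier f C v : U1 f -> type_code C ->
  f v * #|C|%:R = \sum_w f w * expQZ RR (rbeta w v).
Proof.
move=> [c hc] tC; rewrite hc mulr_suml.
under [RHS]eq_bigr do rewrite hc mulr_suml.
rewrite exchange_big /=; apply: eq_bigr => D /is_typeP tD.
have -> : #|C| = #|D|.
  by apply/eqP; rewrite -(@eqn_exp2r _ _ 2) // -!mulnn !(type_card hA hrho RR).
rewrite (eq_bigr (fun w => c D * (if w \in D then expQZ RR (rbeta w v) else 0))); last first.
  by move=> w _; rewrite /in_code; case: (w \in D); rewrite !(mulr1n, mulr0n, mulr0, mul0r) //.
rewrite -mulr_sumr -big_mkcond /=.
have hD := type_is_code tD.
rewrite sum_char ?code0 //.
- rewrite (right_dual _ hD) (type_dual tD) /in_code.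
  by case: (v \in D); rewrite !(mulr1n, mulr0n, mulr0, mul0r).
- by move=> x y xD yD; apply: (codeB hh).
- exact: (betaDl hh).
Qed.

(** By [U1_fourier], f is a combination of the characters beta(w, .) with w in its support, and
    these are trivial on B. Without any code of Type, f is zero. *)
Lemma U1_translate f B : U1 f -> (forall w, f w != 0 -> w \in dual_code B) ->
  forall v b, b \in B -> f (v + b) = f v.
Proof.
move=> Uf sf v b bB.
have [[w [C tC _]]|h] := pselect (exists w, exists2 C, type_code C & w \in C); last first.
  have f0 w : f w = 0.
    apply/eqP; apply: contrapT => /negP /(U1_supp Uf) [C tC wC].
    by apply: h; exists w, C.
  by rewrite !f0.
have C0 : #|C|%:R != 0 :> CC.
  by rewrite pnatr_eq0 -lt0n; apply/card_gt0P; exists 0; case: tC => /code0.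
apply: (mulIf C0); rewrite !(U1_fourier _ Uf tC); apply: eq_bigr => x _.
have [->|/sf /dualP xB] := eqVneq (f x) 0; first by rewrite !mul0r.
by rewrite (betaDr hh) (xB b) // addr0.
Qed.

(** [U1_fourier] is inserted for f(w); summing over w in C first leaves the frequencies in t + C⊥ =
    t + C. *)
Lemma U1_poisson f C t : U1 f -> type_code C ->
  \sum_(w in C) f w * expQZ RR (- rbeta t w) = \sum_(x in C) f (t + x).
Proof.
move=> Uf tC; have hC := type_is_code tC.
have C0 : #|C|%:R != 0 :> CC.
  by rewrite pnatr_eq0 -lt0n; apply/card_gt0P; exists 0; exact: code0.
apply: (mulIf C0); rewrite mulr_suml.
under eq_bigr do rewrite mulrAC (U1_fourier _ Uf tC) mulr_suml.
rewrite exchange_big /= (reindex_inj (addrI t)) /= [RHS]mulr_suml [RHS]big_mkcond /=.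
apply: eq_bigr => x _.
rewrite (eq_bigr (fun w => f (t + x) * expQZ RR (rbeta x w))); last first.
  by move=> w _; rewrite -mulrA -expQZD (betaDl hh) addrAC subrr add0r.
rewrite -mulr_sumr sum_char ?code0 //.
- rewrite (_ : [forall y in C, _] = (x \in C)); last first.
    by rewrite -{2}(type_dual tC) inE.
  by case: (x \in C); rewrite !(mulr1n, mulr0n, mulr0).
- by move=> y z yC zC; apply: (codeB hh).
- exact: (betaDr hh).
Qed.

(** The coefficients are those of F cut off outside C, in the form to which [U1_poisson] applies. *)
Lemma fourier_inversion (F : rho -> CC) C w : w \in C ->
  F w * #|rho|%:R =
  \sum_t expQZ RR (rbeta t w) * \sum_(x in C) F x * expQZ RR (- rbeta t x).
Proof.
move=> wC; under [RHS]eq_bigr do rewrite mulr_sumr.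
rewrite exchange_big /= (bigD1 w) //= [X in _ + X]big1 ?addr0.
  rewrite (eq_bigr (fun _ => F w)) ?sumr_const ?mulr_natr // => t _.
  by rewrite mulrCA -expQZD subrr expQZ0 mulr1.
move=> x /andP[_ xw].
rewrite (eq_bigr (fun t => F x * expQZ RR (rbeta t (w - x)))); last first.
  by move=> t _; rewrite mulrCA -expQZD (betaBr hh).
rewrite -mulr_sumr sum_charT; last exact: (betaDl hh).
rewrite (_ : [forall y, _] = false) ?mulr0n ?mulr0 //.
apply: contraNF xw => /forallP h; rewrite eq_sym -subr_eq0; apply/eqP.
by apply: (hbeta_nondegr hh) => y; apply/eqP.
Qed.

End GenusDescent.

HB.instance Definition _ (V W : finZmodType) := GRing.Zmodule.on (V * W)%type.

(* [pw V m] is V^(m+1). *)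
Fixpoint pw (V : finZmodType) (m : nat) : finZmodType :=
  match m with 0%N => V | m'.+1 => (V * pw V m')%type end.

Fixpoint pin (V : finZmodType) (m : nat) (C : {set V}) : pw V m -> bool :=
  match m return pw V m -> bool with
  | 0%N => fun v => v \in C
  | m'.+1 => fun v => (v.1 \in C) && pin C v.2
  end.

Lemma sum_pw (K : nmodType) (V : finZmodType) m (C : {set V}) (F : pw V m.+1 -> K) :
  \sum_(v | pin C v) F v = \sum_(w in C) \sum_(v | @pin V m C v) F (w, v).
Proof. by rewrite pair_big /=; apply: eq_big => [[w v]|[w v]]. Qed.

Lemma card_pin (V : finZmodType) m (C : {set V}) :
  #|[pred v | @pin V m C v]| = (#|C| ^ m.+1)%N.
Proof.
elim: m => [|m IH]; first by rewrite expn1; apply: eq_card.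
rewrite expnS -IH; transitivity (\sum_(v | @pin V m.+1 C v) 1)%N.
  by rewrite -sum1_card; apply: eq_bigl.
rewrite sum_pw.
under eq_bigr do rewrite sum1_card.
by rewrite sum_nat_const.
Qed.

Section GenusDescentPower.
Variables (RR : realType) (A : form_data) (hA : is_form_ring A).
Variables (rho : rep_data A) (hrho : is_rep rho).
Local Notation CC := (RR[i]).
Implicit Types (r s : A) (w x t : rho) (C D B E : {set rho}).
Local Notation pw := (pw rho).
Local Notation type_code := (@type_code A rho).
Local Notation code_span := (@code_span RR A rho).

Let hh := rep_hermitian hA hrho.

Lemma pin0 m C : is_code C -> @pin _ m C 0.
Proof. by elim: m => [|m IH] hC; rewrite /= code0 ?IH. Qed.

Lemma pinD m C (v d : pw m) : is_code C -> pin C d -> pin C (v + d) = pin C v.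
Proof.
elim: m v d => [|m IH] /= v d hC; first by move=> dC; rewrite (codeDr hh).
by case/andP => d1 d2; rewrite (codeDr hh) // IH.
Qed.

Lemma pinI m C D (v : pw m) : pin (C :&: D)%SET v = pin C v && pin D v.
Proof.
elim: m v => [|m IH] v /=; first by rewrite finset.in_setI.
by rewrite IH finset.in_setI andbACA.
Qed.

Lemma pin_sub m C D (v : pw m) : C \subset D -> pin C v -> pin D v.
Proof.
move=> /fintype.subsetP CD; elim: m v => [|m IH] v /=; first exact: CD.
by case/andP => /CD -> /IH.
Qed.

(** Recursive so that fixing the first coordinate stays within the class. The last clause demands
    orthogonality to all of R w, which is what the off-diagonal quadratic operators enforce. *)
Fixpoint slicewise (m : nat) : (pw m -> CC) -> Prop :=
  match m return (pw m -> CC) -> Prop with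
  | 0%N => fun y => U1 y
  | m'.+1 => fun y =>
      [/\ forall v, U1 (fun w => y (w, v)),
          forall w, slicewise (fun v => y (w, v))
        & forall w v, y (w, v) != 0 -> pin (dual_code (cyc w)) v]
  end.

Lemma slicewise_sum m (I : Type) (s : seq I) (P : pred I) (a : I -> CC)
    (f : I -> pw m -> CC) :
  (forall i, P i -> slicewise (f i)) ->
  slicewise (fun v => \sum_(i <- s | P i) a i * f i v).
Proof.
elim: m f => [|m IH] f h; first exact: code_span_sum.
split.
- by move=> v; apply: code_span_sum => i /h [h1 _ _]; apply: h1.
- by move=> w; apply: (IH (fun i v => f i (w, v))) => i /h [_ h2 _]; apply: h2.
- move=> w v nz; apply: contrapT => hp; move/negP: nz; apply; apply/eqP.
  apply: big1 => i Pi; have [_ _ h3] := h i Pi.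
  have [->|/h3] := eqVneq (f i (w, v)) 0; first by rewrite mulr0.
  by move/hp.
Qed.

Lemma slicewise_lin m (a : CC) (f g : pw m -> CC) : slicewise f -> slicewise g ->
  slicewise (fun v => f v + a * g v).
Proof.
move=> hf hg.
have := @slicewise_sum m bool [:: true; false] xpredT
  (fun b => if b then 1 else a) (fun b => if b then f else g).
have <- : (fun v => \sum_(i <- [:: true; false])
   (if i then 1 else a) * (if i then f else g) v) = (fun v => f v + a * g v).
  by apply/funext => v; rewrite !big_cons big_nil mul1r addr0.
by apply=> -[].
Qed.

Lemma slicewise_type m C : type_code C -> slicewise (fun v : pw m => (pin C v)%:R).
Proof.
move=> tC; have hC := type_is_code tC.
have U1C : U1 (fun w => (w \in C)%:R : CC) by exact: code_span_type.
elim: m => [|m IH] //=; split.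
- move=> v; have := @code_span_sum RR A rho _ _ [:: tt] xpredT (fun=> (pin C v)%:R) _ _ (fun _ _ => U1C).
  by apply: eq_code_span => w; rewrite big_cons big_nil addr0 -natrM mulnb andbC.
- move=> w; have := @slicewise_sum m _ [:: tt] xpredT (fun=> (w \in C)%:R) _ (fun _ _ => IH).
  congr slicewise; apply/funext => v.
  by rewrite big_cons big_nil addr0 -natrM mulnb.
- move=> w v; rewrite pnatr_eq0 eqb0 negbK => /andP[wC]; apply: pin_sub.
  by rewrite -{1}(type_dual tC); apply: dualS; rewrite (cyc_sub hrho).
Qed.

Lemma slicewise_span m (y : pw m -> CC) :
  code_span (fun C v => pin C v) y -> slicewise y.
Proof.
move=> [c hc]; have -> : y = fun v => \sum_(C | is_type C) c C * (pin C v)%:R.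
  by apply/funext => v; rewrite hc; apply: eq_bigr => C _; rewrite mulr_natr.
by apply: slicewise_sum => C /is_typeP; apply: slicewise_type.
Qed.

Definition supported m D (y : pw m -> CC) := forall v, y v != 0 -> pin (dual_code D) v.

Lemma slicewise_translate m B (y : pw m -> CC) : slicewise y -> supported B y ->
  forall v b, pin B b -> y (v + b) = y v.
Proof.
elim: m y => [|m IH] y; first by move=> Uy sy v b; apply: (U1_translate hA hrho Uy).
move=> [h1 h2 h3] sy [w v] [b1 b2] /= /andP[bB1 bB2].
have s2 w' : supported B (fun v => y (w', v)).
  by move=> v' /sy /= /andP[].
transitivity (y (w + b1, v)); first exact: (IH _ (h2 _) (s2 _)).
apply: (U1_translate hA hrho (h1 v)) bB1 => w' /sy /=; by case/andP.
Qed.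

(** In one coordinate, with D isotropic, the indicator of a code C of Type is sent to |C ∩ D| times
    that of [ext_code C D]. The result is supported on D⊥, as the induction on D requires. *)
Definition proj_code m D (y : pw m -> CC) (v : pw m) : CC :=
  (\sum_(d | pin D d) y (v + d)) *+ pin (dual_code D) v.

Lemma proj_codeS m D (y : pw m.+1 -> CC) w v :
  proj_code D y (w, v) =
  \sum_(d in D) (w \in dual_code D)%:R * proj_code D (fun v => y (w + d, v)) v.
Proof.
rewrite /proj_code sum_pw /=; case: (w \in _); case: (pin _ v);
  rewrite ?mulr1n ?mulr0n; try by under [RHS]eq_bigr do rewrite ?mulr0n ?mul0r ?mulr0; rewrite big1.
by under [RHS]eq_bigr do rewrite mulr1n mul1r.
Qed.

Lemma proj_code_supp m D (y : pw m -> CC) v : proj_code D y v != 0 ->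
  pin (dual_code D) v /\ exists2 d, pin D d & y (v + d) != 0.
Proof.
rewrite /proj_code; case: (pin (dual_code D) v); rewrite ?mulr0n ?eqxx // mulr1n.
move=> nz; split=> //; apply: contrapT => h; move/negP: nz; apply; apply/eqP.
  apply: big1 => d dD; apply/eqP; apply: contrapT => /negP nz; apply: h.
by exists d.
Qed.

(** The admissible d form a coset of C ∩ D once there is one; then v + d lies in C ∩ D⊥ because D ⊆
    D⊥. *)
Lemma count_shift C D v : is_code C -> iso_code D -> v \in dual_code D ->
  (\sum_(d in D) ((v + d)%R \in C) = #|C :&: D|%SET * (v \in ext_code C D))%N.
Proof.
move=> hC [hD [DD _]] vD; have hd := dual_is_code hh hD.
case: (boolP (v \in _)) => [/add_codeP[c [d0 [+ d0D vE]]]|vE].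
  rewrite finset.in_setI => /andP[cC _].
  rewrite muln1 (reindex_inj (addrI (- d0))) /= -sum1_card big_mkcond [RHS]big_mkcond /=.
  apply: eq_bigr => d _; rewrite (codeDl hh) ?codeN //.
  rewrite vE -addrA addNKr (codeDl hh) // finset.in_setI.
  by case: (d \in C); case: (d \in D).
rewrite muln0 big1 // => d dD; apply/eqP; rewrite eqb0; apply: contraNN vE => vdC.
apply/add_codeP; exists (v + d), (- d); rewrite codeN // addrK; split=> //.
by rewrite finset.in_setI vdC codeD // (fintype.subsetP DD).
Qed.

Lemma ext_sub_dual C D : iso_code D -> ext_code C D \subset dual_code D.
Proof.
move=> [hD [DD _]]; apply: add_subset => //; first exact: dual_is_code.
exact: finset.subsetIr.
Qed.

Lemma U1_proj D (f : rho -> CC) : iso_code D -> U1 f -> U1 (@proj_code 0 D f).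
Proof.
move=> iD [c hc]; have hD := iD.1; have hd := dual_is_code hh hD.
pose F C v := @proj_code 0 D (fun w => (w \in C)%:R) v.
have FE C : type_code C -> U1 (F C).
  move=> tC; have hC := type_is_code tC; have tE := ext_type hA hrho RR tC iD.
  exists (fun E => (#|C :&: D|%SET)%:R *+ (E == ext_code C D)) => v.
  rewrite (bigD1 (ext_code C D)) /=; last exact/is_typeP.
  rewrite eqxx mulr1n big1 ?addr0; last first.
    by move=> E /andP[_ /negPf ->]; rewrite mulr0n mul0rn.
  rewrite /F /proj_code /in_code /= -natr_sum.
  case: (boolP (v \in dual_code D)) => vD.
    by rewrite mulr1n count_shift // natrM mulr_natr.
  rewrite mulr0n (_ : v \in ext_code C D = false) ?mulr0n //.
  by apply: contraNF vD; apply/fintype.subsetP/ext_sub_dual.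
apply: (@eq_code_span _ _ _ _ _ _ (fun v => \sum_(C | is_type C) c C * F C v)).
  move=> v; rewrite /F /proj_code /=; case: (v \in dual_code D); last first.
    by rewrite mulr0n big1 // => C _; rewrite mulr0n mulr0.
  under eq_bigr do rewrite hc.
  rewrite mulr1n exchange_big /=; apply: eq_bigr => C _.
  by rewrite mulr1n mulr_sumr; apply: eq_bigr => d _; rewrite mulr_natr.
by apply: code_span_sum => C /is_typeP; apply: FE.
Qed.

(** In beta(x + e, r (w + d)) every term involving e or d vanishes: x and w lie in D⊥, and D is
    contained in its dual. *)
Lemma pin_perp_shift m D w d (v d' : pw m) : iso_code D ->
  w \in dual_code D -> d \in D -> pin (dual_code D) v -> pin D d' ->
  pin (dual_code (cyc (w + d))) (v + d') -> pin (dual_code (cyc w)) v.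
Proof.
move=> [hD [DD _]] wD dD.
have one x e : x \in dual_code D -> e \in D ->
    x + e \in dual_code (cyc (w + d)) -> x \in dual_code (cyc w).
  move=> xD eD /dualP h; apply/dualP => c /cycP[r ->].
  have := h (rscale r (w + d)).
  rewrite (scaleDr hh) (betaDl hh) !(betaDr hh).
  have -> : rbeta x (rscale r d) = 0 by move/dualP: xD; apply; apply: codeZ.
  have -> : rbeta e (rscale r w) = 0.
    by apply: (dual_sym hA hrho hD eD); apply: codeZ => //; apply: dual_is_code.
  have -> : rbeta e (rscale r d) = 0.
    by have /dualP := fintype.subsetP DD _ eD; apply; apply: codeZ.
  rewrite !addr0; apply; apply/cycP; exists r.
  by rewrite (scaleDr hh).
elim: m v d' => [|m IH] /= v d' ; first exact: one.
move=> /andP[v1 v2] /andP[d1 d2] /andP[vd1 vd2].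
by rewrite (one _ _ v1 d1 vd1) (IH _ _ v2 d2 vd2).
Qed.

Lemma slicewise_proj m D (y : pw m -> CC) : iso_code D -> slicewise y ->
  slicewise (proj_code D y).
Proof.
move=> iD; elim: m y => [|m IH] y; first exact: U1_proj.
move=> [h1 h2 h3]; split.
- move=> v.
  apply: (@eq_code_span _ _ _ _ _ _
    (@proj_code 0 D (fun w => proj_code D (fun v => y (w, v)) v))).
    move=> w; rewrite proj_codeS -mulr_sumr mulrC mulr_natr.
    by rewrite /(@proj_code 0 _ _ _) /=.
  apply: U1_proj => //.
  apply: (@eq_code_span _ _ _ _ _ _
    (fun w => \sum_(d | pin D d) (pin (dual_code D) v)%:R * y (w, v + d))).
    by move=> w; rewrite /proj_code -mulr_sumr mulrC mulr_natr.
  by apply: code_span_sum => d _; apply: h1.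
- move=> w; have := @slicewise_sum m _ (index_enum rho) (fun d => d \in D)
    (fun=> (w \in dual_code D)%:R) (fun d => proj_code D (fun v => y (w + d, v)))
    (fun d _ => IH _ (h2 _)).
  by congr slicewise; apply/funext => v; rewrite proj_codeS.
- move=> w v /proj_code_supp [/= /andP[wD vD] [[d d'] /= /andP[dD d'D] /h3]].
  exact: (pin_perp_shift iD wD dD vD d'D).
Qed.

(** Each element of C + B has |C ∩ B| decompositions a + b. *)
Lemma sum_add_code (g : rho -> CC) C B : is_code C -> is_code B ->
  \sum_(a in C) \sum_(b in B) g (a + b) =
  (#|C :&: B|%SET)%:R * \sum_(u in add_code C B) g u.
Proof.
move=> hC hB.
rewrite (eq_bigr (fun a => \sum_u (u - a \in B)%:R * g u)); last first.
  move=> a _; rewrite big_mkcond [RHS](reindex_inj (addrI a)) /=.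
  apply: eq_bigr => b _; rewrite [a + b]addrC addrK.
  by case: (b \in B); rewrite !(mul1r, mul0r).
rewrite exchange_big mulr_sumr [RHS]big_mkcond /=; apply: eq_bigr => u _.
rewrite -mulr_suml -natr_sum.
case: (boolP (u \in _)) => [/add_codeP[a [b [aC bB ->]]]|uE].
  congr (_%:R * _); rewrite (reindex_inj (addrI a)) /= -sum1_card.
  rewrite big_mkcond [RHS]big_mkcond /=; apply: eq_bigr => x _.
  rewrite (codeDl hh) // finset.in_setI opprD addrACA subrr add0r.
  rewrite (codeDl hh) //; case: (x \in C) => //=.
  rewrite -[RHS]/(nat_of_bool (x \in B)); congr nat_of_bool.
  by apply/idP/idP => /(codeN hh hB); rewrite ?opprK.
rewrite big1 ?mul0r // => a aC; apply/eqP; rewrite eqb0; apply: contraNN uE => ub.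
by apply/add_codeP; exists a, (u - a); rewrite [a + _]addrC subrK.
Qed.

Lemma sum_pin_add m C B (f : pw m -> CC) : is_code C -> is_code B ->
  (forall v b, pin B b -> f (v + b) = f v) ->
  (#|B| ^ m.+1)%:R * (\sum_(v | pin C v) f v) =
  (#|C :&: B|%SET ^ m.+1)%:R * (\sum_(v | pin (add_code C B) v) f v).
Proof.
move=> hC hB; elim: m f => [|m IH] f fB.
  rewrite !expn1 -sum_add_code // mulr_sumr; apply: eq_bigr => a _.
  rewrite (eq_bigr (fun=> f a)) ?sumr_const ?mulr_natl // => b bB.
  exact: fB.
have B0 : @pin _ m B 0 by apply: pin0.
rewrite !sum_pw expnS [in RHS]expnS !natrM -!mulrA.
rewrite (mulr_sumr _ _ _ ((#|B| ^ m.+1)%:R)) (mulr_sumr _ _ _ ((#|_| ^ m.+1)%:R)).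
under [in LHS]eq_bigr => w _.
  rewrite IH; last by move=> v b bB; have := fB (w, v) (0, b); rewrite /= code0 // bB => /(_ isT) <-; congr (f (_, _)); rewrite addr0.
  over.
rewrite -sum_add_code // mulr_sumr; apply: eq_bigr => a _.
rewrite [RHS](eq_bigr (fun=> (#|C :&: B|%SET ^ m.+1)%:R *
    \sum_(v | pin (add_code C B) v) f (a, v))).
  by rewrite sumr_const mulr_natl.
move=> b bB; congr (_ * _); apply: eq_bigr => v _.
by have := fB (a, v) (b, 0); rewrite /= bB B0 => /(_ isT) <-; congr (f (_, _)); rewrite addr0.
Qed.

Lemma sum_pin_shift m C (F : pw m -> CC) d : is_code C -> pin C d ->
  \sum_(v | pin C v) F (v + d) = \sum_(v | pin C v) F v.
Proof.
move=> hC dC; rewrite [RHS](reindex_inj (addIr d)) /=.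
by apply: eq_bigl => v; rewrite pinD.
Qed.

End GenusDescentPower.

(** * Genus descent *)

Section GenusDescentMain.
Variables (RR : realType) (A : form_data) (hA : is_form_ring A).
Variables (rho : rep_data A) (hrho : is_rep rho).
Local Notation CC := (RR[i]).
Implicit Types (r s : A) (w x t : rho) (C D B E : {set rho}).
Local Notation pw := (pw rho).
Local Notation type_code := (@type_code A rho).
Local Notation code_span := (@code_span RR A rho).

Let hh := rep_hermitian hA hrho.

(* The induction runs downwards on the isotropic code D, from the maximal ones,
   the codes of Type rho, to 0: averaging y over a larger D' gives a function
   covered by the induction hypothesis, hence 0 ([cusp]). *)
Lemma slicewise_orth0 m (IHm : forall f : pw m -> CC, slicewise f ->
      code_span (fun C v => pin C v) f) n D :
    iso_code D -> (#|rho| - #|D| < n)%N ->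
  forall y : pw m.+1 -> CC, slicewise y -> supported D y ->
    (forall C, type_code C -> D \subset C -> \sum_(v | pin C v) y v = 0) ->
  forall v, y v = 0.
Proof.
elim: n D => [|n IH] D iD ltn y sy suy oy; first by rewrite ltn0 in ltn.
have [h1 h2 h3] := sy.
have hD := iD.1.
have y_inv := slicewise_translate hA hrho sy suy.
have subd C : type_code C -> D \subset C -> C \subset dual_code D.
  by move=> tC DC; rewrite -{1}(type_dual tC); exact: dualS.
(* If D = D⊥, then y is constant on D^(m+2) and zero elsewhere, so the vanishing of its sum over D
   decides. *)
case: (pselect (type_code D)) => [tD|ntD].
  have y0 : y 0 = 0.
    have := oy D tD (fintype.subxx D); rewrite (eq_bigr (fun=> y 0)); last first.
      by move=> v vD; rewrite -[v in LHS]add0r y_inv.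
    rewrite sumr_const => /eqP; rewrite -mulr_natr mulf_eq0 => /orP[/eqP //|].
    rewrite pnatr_eq0 => /eqP /card0_eq /(_ 0); rewrite !inE.
    by rewrite [_ \in _](pin0 m.+1 hD).
  move=> v; have [//|/suy] := eqVneq (y v) 0; rewrite (type_dual tD) => vD.
  by rewrite -[v]add0r y_inv.
pose S C w := \sum_(v : pw m | pin C v) y (w, v).
have US C : U1 (S C).
  apply: (@eq_code_span _ _ _ _ _ _ (fun w => \sum_(v : pw m | pin C v) 1 * y (w, v))).
    by move=> w; apply: eq_bigr => v _; rewrite mul1r.
  by apply: code_span_sum => v _; apply: h1.
have cusp D' : iso_code D' -> D \proper D' -> forall v, proj_code D' y v = 0.
  move=> iD' DD'; apply: (IH D' iD').
  - have c1 := proper_card DD'; have c2 : (#|D'| <= #|rho|)%N by apply: max_card.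
    move: c1 c2 ltn; lia.
  - exact: slicewise_proj.
  - by move=> v /proj_code_supp [].
  move=> C tC D'C; have hC := type_is_code tC.
  rewrite (eq_bigr (fun v => \sum_(d | pin D' d) y (v + d))); last first.
    move=> v vC; rewrite /proj_code (_ : pin _ v) //; apply: pin_sub vC.
    by rewrite -(type_dual tC); apply: dualS.
  rewrite exchange_big big1 // => d dD.
  rewrite (sum_pin_shift hA hrho) //; last exact: pin_sub dD.
  exact: oy tC (fintype.subset_trans (proper_sub DD') D'C).
(* For t in D⊥ the character of t is trivial on D' = C ∩ (R t)⊥, so only averages of S C over D'
   matter; they vanish by [cusp] if D' exceeds D. For t outside D⊥, Poisson summation meets only
   points outside the support of y. *)
have trans0 C t : type_code C -> D \subset C ->
    (C :&: dual_code (cyc t))%SET != D ->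
    \sum_(w in C) S C w * expQZ RR (- rbeta t w) = 0.
  move=> tC DC neD; have hC := type_is_code tC.
  have [tD|tD] := boolP (t \in dual_code D); last first.
    rewrite (U1_poisson hA hrho t (US C) tC) big1 // => x xC; apply: big1 => v _.
    have [//|/suy /= /andP[]] := eqVneq (y (t + x, v)) 0.
    rewrite (codeDr hh) ?(negPf tD) //; first exact: dual_is_code.
    exact: (fintype.subsetP (subd C tC DC)).
  set D' := (C :&: dual_code (cyc t))%SET.
  have hct := cyc_code hA hrho t; have hdt := dual_is_code hh hct.
  have hD' : is_code D' by apply: scode.
  have iD' : iso_code D'.
    by apply: iso_sub (type_iso tC) hD' _; apply: finset.subsetIl.
  have DD' : D \subset D'.
    rewrite finset.subsetI DC /=; apply/fintype.subsetP => d dD; apply/dualP => c.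
    case/cycP => r ->; apply: (dual_sym hA hrho hD dD).
    by apply: codeZ => //; exact: dual_is_code.
  have pD' : D \proper D'.
    by rewrite finset.properEneq DD' andbT eq_sym.
  have SD' w : w \in C -> \sum_(d in D') S C (w + d) = 0.
    move=> wC; have wD' : w \in dual_code D'.
      rewrite -(type_dual tC) in wC; apply: fintype.subsetP wC; apply: dualS.
      exact: finset.subsetIl.
    have D'C : D' \subset C by apply: finset.subsetIl.
    have N0 : #|[pred d | @pin _ m D' d]|%:R != 0 :> CC.
      by rewrite card_pin pnatr_eq0 -lt0n expn_gt0; apply/orP; left; apply/card_gt0P; exists 0; apply: code0.
    apply: (mulIf N0); rewrite mul0r.
    have : \sum_(v : pw m | pin C v) proj_code D' y (w, v) = 0.
      by apply: big1 => v _; apply: cusp.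
    rewrite (eq_bigr (fun v => \sum_(d in D') \sum_(d' | pin D' d') y (w + d, v + d'))).
      rewrite exchange_big /= => e0; rewrite -[RHS]e0 mulr_suml; apply: eq_bigr => d dD'.
      rewrite exchange_big /= mulr_natr -sumr_const; apply: eq_bigr => d' d'D'.
      have d'C : pin C d' by apply: pin_sub d'D'.
      by rewrite (sum_pin_shift hA hrho (fun v => y (w + d, v)) hC d'C).
    move=> v vC; rewrite /proj_code /= wD' (_ : pin _ v) ?mulr1n ?sum_pw //.
    by apply: pin_sub vC; rewrite -(type_dual tC); apply: dualS.
  have N0 : #|D'|%:R != 0 :> CC.
    by rewrite pnatr_eq0 -lt0n; apply/card_gt0P; exists 0; apply: code0.
  apply: (mulIf N0); rewrite mul0r mulr_natr -sumr_const.
  rewrite (eq_bigr (fun d => \sum_(w in C) S C (w + d) * expQZ RR (- rbeta t w))); last first.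
    move=> d dD'; rewrite [LHS](reindex_inj (addIr d)) /=; apply: eq_big => w.
      by rewrite (codeDr hh) //; move: dD'; rewrite finset.in_setI => /andP[].
    move=> _; rewrite (betaDr hh) (_ : rbeta t d = 0) ?addr0 //.
    apply: (dual_sym hA hrho hct (cyc_id hrho t)).
    by move: dD'; rewrite finset.in_setI => /andP[].
  by rewrite exchange_big big1 // => w wC; rewrite -mulr_suml SD' // mul0r.
have capE C t x : is_code C -> x \in C -> type_code C ->
    (C :&: dual_code (cyc (t + x)) = C :&: dual_code (cyc t))%SET.
  move=> hC xC tC; apply/finset.setP => c; rewrite !finset.in_setI.
  case: (boolP (c \in C)) => //= cC.
  have cx r : rbeta c (rscale r x) = 0.
    by move: cC; rewrite -{1}(type_dual tC) => /dualP; apply; apply: codeZ.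
  apply/dualP/dualP => h e /cycP[r ->].
    have := h (rscale r (t + x)); rewrite (scaleDr hh) (betaDr hh) cx addr0.
    by apply; apply/cycP; exists r; rewrite (scaleDr hh).
  rewrite (scaleDr hh) (betaDr hh) cx addr0; apply: h.
  by apply/cycP; exists r.
(* For the remaining t the coordinates v in the support lie in C ∩ (R(t + x))⊥ = D, where y does not
   depend on v. *)
have transD C t x : type_code C -> D \subset C ->
    (C :&: dual_code (cyc t))%SET = D -> x \in C ->
    S C (t + x) = y (t + x, 0) *+ (#|D| ^ m.+1).
  move=> tC DC tD xC; have hC := type_is_code tC.
  rewrite -card_pin -sumr_const /S big_mkcond [RHS]big_mkcond /=.
  apply: eq_bigr => v _.
  have yE : pin D v -> y (t + x, v) = y (t + x, 0).
    move=> vD; have := y_inv (t + x, 0) (0, v); rewrite /= code0 // vD => /(_ isT) <-.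
    by congr (y (_, _)); rewrite ?addr0 ?add0r.
  rewrite !inE; case: (boolP (pin D v)) => vD.
    by rewrite (pin_sub DC vD) yE.
  case: (boolP (pin C v)) => // vC; have [//|/h3 vt] := eqVneq (y (t + x, v)) 0.
  by case/negP: vD; rewrite -tD -(capE C t x) // pinI vC vt.
have iso_w w v : y (w, v) != 0 -> iso_code (cyc w) /\ cyc w \subset dual_code D.
  move=> nz; have [C tC wC] := U1_supp (h1 v) nz; split.
    apply: iso_sub (type_iso tC) (cyc_code hA hrho w) _.
    by rewrite (cyc_sub hrho) //; apply: type_is_code.
  rewrite (cyc_sub hrho); last exact: dual_is_code.
  by case/andP: (suy _ nz).
(* [type_max] with E = R(t + x) + D, whose dual meets C exactly in D. So the values y(u, 0) that
   survive have R u + D of Type. *)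
have type_w C t x : type_code C -> D \subset C ->
    (C :&: dual_code (cyc t))%SET = D -> x \in C ->
    y (t + x, 0) != 0 -> type_code (add_code (cyc (t + x)) D).
  move=> tC DC tD xC nz; have hC := type_is_code tC.
  have [iw wD] := iso_w _ _ nz.
  have hw := cyc_code hA hrho (t + x).
  apply: (type_max hA hrho RR tC iD); first exact: iso_add.
    exact: sub_addr.
  rewrite (dual_add hA hrho) // finset.setIA (capE C t x) // tD.
  by apply/finset.setIidPl; apply: iD.2.1.
pose tw w := is_type (add_code (cyc w) D).
(* At u' with |y(u', 0)| maximal and C = R u' + D, Fourier inversion on C bounds
   |C|^(m+1) |y(u', 0)| by a strictly smaller multiple of |y(u', 0)|. *)
have Z0 u : tw u -> y (u, 0) = 0.
  move=> tu0; apply/eqP; apply: contrapT => /negP nz0.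
  have realF : {in tw, forall i, `|y (i, 0)| \is Num.real} by move=> i _; apply: normr_real.
  case: (real_arg_maxP tu0 realF) => u' tu maxu.
  set Z := `|y (u', 0)| in maxu.
  have Z_gt0 : 0 < Z.
    by apply: lt_le_trans (maxu _ tu0); rewrite normr_gt0.
  set C := add_code (cyc u') D.
  have tC : type_code C by apply/is_typeP.
  have hC := type_is_code tC.
  have hcu := cyc_code hA hrho u'.
  have DC : D \subset C by apply: sub_addr.
  have uC : u' \in C.
    by apply: (fintype.subsetP (sub_addl _ hD)); apply: cyc_id.
  have SCu : S C u' = y (u', 0) *+ (#|C| ^ m.+1).
    have suC : supported C (fun v => y (u', v)).
      move=> v nz; rewrite /C (dual_add hA hrho) // pinI (h3 _ _ nz) /=.
      by have /andP[] := suy _ nz.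
    have inv := slicewise_translate hA hrho (h2 u') suC.
    rewrite -card_pin -sumr_const; apply: eq_bigr => v vC.
    by rewrite -[v]add0r inv.
  pose N := (#|D| ^ m.+1)%N.
  pose T := [set t : rho | (C :&: dual_code (cyc t))%SET == D]%SET.
  have bound : `|S C u' * #|rho|%:R| <= (#|T| * (#|C| * N))%:R * Z.
    rewrite (fourier_inversion hA hrho (S C) uC).
    apply: le_trans (ler_norm_sum _ _ _) _.
    rewrite natrM mulrAC -mulrA mulr_natl -sumr_const [leRHS]big_mkcond /=.
    apply: ler_sum => t _; rewrite normrM normr_expQZ mul1r inE.
    case: ifPn => tD; last by rewrite trans0 // normr0.
    rewrite (U1_poisson hA hrho t (US C) tC).
    apply: le_trans (ler_norm_sum _ _ _) _.
    rewrite natrM mulrCA mulr_natl -sumr_const; apply: ler_sum => x xC.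
    rewrite (transD C t x) ?(eqP tD) // normrMn mulr_natr; apply: ler_wMn2r.
    have [->|nz] := eqVneq (y (t + x, 0)) 0; first by rewrite normr0 ltW.
    by apply: maxu; apply/is_typeP/(type_w C) => //; apply/eqP.
  move: bound; rewrite normrM normr_nat SCu normrMn -/Z -[Z *+ _]mulr_natr.
  rewrite -mulrA -natrM mulrC ler_pM2r // ler_nat => bound.
  have D0 : (0 < #|D|)%N by apply/card_gt0P; exists 0; apply: code0.
  have C0 : (0 < #|C|)%N by apply/card_gt0P; exists 0; apply: code0.
  (* The element 0 lies in D⊥ but not in T: otherwise D would equal C and be of Type. This one
     missing element makes the estimate strict. *)
  have T_lt : (#|T| < #|dual_code D|)%N.
    apply: proper_card; apply/fintype.properP; split.
      apply/fintype.subsetP => t; rewrite inE => /eqP tD.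
      apply/dualP => d; rewrite -tD finset.in_setI => /andP[_].
      by apply: (dual_sym hA hrho (cyc_code hA hrho t)); apply: cyc_id.
    exists 0; first by apply: code0; exact: dual_is_code.
    rewrite inE; apply/negP => /eqP CD; apply: ntD.
    rewrite -CD (_ : (_ :&: _)%SET = C) //; apply/finset.setIidPl.
    apply/fintype.subsetP => c _; apply/dualP => e /cycP[r ->].
    by rewrite (scale0r hh) (beta0r hh).
  have DC_le : (#|D| <= #|C|)%N by apply: subset_leq_card.
  have e1 : (#|D| * #|dual_code D|)%N = #|rho| by apply: (card_dual hh RR hD).
  have e2 : (#|D| ^ m <= #|C| ^ m)%N by case: (m) => // k; rewrite leq_exp2r.
  suff : (#|T| * (#|C| * N) < #|C| ^ m.+1 * #|rho|)%N by rewrite ltnNge bound.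
  rewrite /N -e1 !expnS; apply: (@leq_trans (#|dual_code D| * (#|C| * (#|D| * #|D| ^ m)))).
    by rewrite ltn_pmul2r // !muln_gt0 C0 D0 expn_gt0 D0.
  rewrite [leqLHS](_ : _ = (#|C| * #|D| ^ m) * (#|D| * #|dual_code D|))%N; last by lia.
  by rewrite leq_mul2r leq_mul2l e2 !orbT.
have S0 C w : type_code C -> D \subset C -> w \in C -> S C w = 0.
  move=> tC DC wC; have V0 : #|rho|%:R != 0 :> CC.
    by rewrite pnatr_eq0 -lt0n; apply/card_gt0P; exists 0.
  apply: (mulIf V0); rewrite mul0r (fourier_inversion hA hrho (S C) wC).
  apply: big1 => t _; have [tD|tD] := eqVneq (C :&: dual_code (cyc t))%SET D; last first.
    by rewrite trans0 // mulr0.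
  rewrite (U1_poisson hA hrho t (US C) tC) big1 ?mulr0 // => x xC.
  rewrite (transD C t x) // ; have [->|nz] := eqVneq (y (t + x, 0)) 0.
    by rewrite mul0rn.
  by rewrite Z0 ?mul0rn //; apply/is_typeP; apply: (type_w C t x).
(* The slice f = y(w, .) is a combination of indicators by the case of one coordinate less; it is
   shown to be orthogonal to all of them, hence to itself. *)
case=> w v; apply/eqP; apply: contrapT => /negP nz.
pose f v' := y (w, v').
have [iw wD] := iso_w w v nz.
have [c fc] := IHm f (h2 w).
have hw := iw.1.
set B := add_code (cyc w) D.
have iB : iso_code B by apply: iso_add.
have hB := iB.1.
have sf : supported B f.
  move=> v' nz'; rewrite /B (dual_add hA hrho) // pinI (h3 _ _ nz') /=.
  by have /andP[] := suy _ nz'.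
have finv := slicewise_translate hA hrho (h2 w) sf.
(* Since f is B-periodic and supported on B⊥, its sum over C is a multiple of its sum over
   [ext_code C B]. That code contains both D and w, so [S0] applies. *)
have f0 C : type_code C -> \sum_(v' | pin C v') f v' = 0.
  move=> tC; have hC := type_is_code tC; have hdB := dual_is_code hh hB.
  transitivity (\sum_(v' | pin (C :&: dual_code B)%SET v') f v').
    rewrite big_mkcond [RHS]big_mkcond /=; apply: eq_bigr => v' _.
    rewrite pinI; case: (pin C v') => //=; case: ifPn => // nb.
    by have [//|/sf h] := eqVneq (f v') 0; rewrite h in nb.
  have N0 : (#|B| ^ m.+1)%:R != 0 :> CC.
    rewrite pnatr_eq0 -lt0n expn_gt0; apply/orP; left; apply/card_gt0P.
    by exists 0; apply: code0.
  apply: (mulfI N0); rewrite (sum_pin_add hA hrho) //; last exact: scode.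
  have BE : B \subset ext_code C B by apply: sub_ext.
  have tE := ext_type hA hrho RR tC iB.
  rewrite -/(S (ext_code C B) w) S0 ?mulr0 //.
    by apply: fintype.subset_trans BE; apply: sub_addr.
  by apply: (fintype.subsetP BE); apply: (fintype.subsetP (sub_addl _ hD)); apply: cyc_id.
have H : \sum_v' f v' * (f v')^* = 0.
  under eq_bigr do rewrite {2}fc rmorph_sum mulr_sumr.
  rewrite exchange_big big1 //= => C /is_typeP tC.
  rewrite (eq_bigr (fun v' => (c C)^* * (if pin C v' then f v' else 0))).
    by rewrite -mulr_sumr -big_mkcond f0 // mulr0.
  move=> v' _; case: (pin C v'); first by rewrite mulr1n mulrC.
  by rewrite mulr0n rmorph0 !mulr0.
have : f v * (f v)^* = 0.
  by apply: (psumr_eq0P _ H) => // v' _; exact: mul_conjC_ge0.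
by move/eqP; rewrite mul_conjC_eq0 (negPf nz).
Qed.

(** After subtracting the orthogonal projection onto the indicators, [slicewise_orth0] applies with
    D = 0, whose support condition is void. *)
Theorem genus_descent m (y : pw m -> CC) :
  slicewise y -> code_span (fun C v => pin C v) y.
Proof.
elim: m y => [|m IH] y sy; first exact: sy.
pose s := [seq (fun v : pw m.+1 => (pin C v)%:R : CC) | C <- enum (@is_type A rho)].
have [u [Pu ou]] := orthogonal_decomposition s y.
have Su : code_span (fun C v => pin C v) u.
  apply: Pu; [exact: code_span0|by move=> *; apply: code_span_lin|].
  move=> g /List.in_map_iff [C [<- hC]].
  have tC : is_type C.
    move: hC; rewrite -[is_type C]/(C \in @is_type A rho) -mem_enum.
    elim: (enum _) => //= C' l IHl [->|/IHl]; rewrite in_cons ?eqxx // => ->.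
    by rewrite orbT.
  exact/code_span_type/is_typeP.
suff yu v : y v = u v by apply: eq_code_span Su.
have iso0 : iso_code ([set 0]%SET : {set rho}).
  split.
    split; first by rewrite inE.
      by move=> x x' /finset.set1P -> /finset.set1P ->; rewrite addr0 inE.
    by move=> r x /finset.set1P ->; rewrite (scale0r hh) inE.
  split.
    apply/fintype.subsetP => x /finset.set1P ->; apply/dualP => c _.
    exact: (beta0l hh).
  by move=> phi x /finset.set1P ->; case: (rquad_quad hrho phi).
have sy' : slicewise (fun v => y v + (- 1) * u v).
  by apply: slicewise_lin sy _; apply: (slicewise_span hrho).
have := slicewise_orth0 IH iso0 (ltnSn _) sy' _ _ v; rewrite mulN1r.
move=> H; apply/eqP; rewrite -subr_eq0; apply/eqP; apply: H.
  move=> v' _; have full (x : rho) : x \in dual_code ([set 0]%SET : {set rho}).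
    by apply/dualP => c /finset.set1P ->; exact: (beta0r hh).
  by elim: (m.+1) v' => [|k IHk] v' //=; rewrite full IHk.
move=> C tC _; rewrite -[RHS](ou (fun v => (pin C v)%:R)).
  rewrite big_mkcond /=; apply: eq_bigr => v' _; rewrite mulN1r conjC_nat.
  by case: ifP; rewrite ?mulr1 ?mulr0.
apply: (List.in_map (fun C (v : pw m.+1) => (pin C v)%:R : CC)).
have : C \in enum (@is_type A rho) by rewrite mem_enum; apply/is_typeP.
by elim: (enum _) => //= C' l IHl; rewrite in_cons => /orP[/eqP ->|/IHl]; [left|right].
Qed.

End GenusDescentMain.

(** Translation by q permutes s, and comparing the sums of the elements gives the claim. *)
Lemma translate_mulrn0 (X : zmodType) (s : seq X) (q : X) :
  uniq s -> (forall x, x \in s -> x + q \in s) -> q *+ size s = 0.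
Proof.
move=> us sq; have us' : uniq (map (fun x => x + q) s) by rewrite map_inj_uniq //; apply: addIr.
have e : perm_eq (map (fun x => x + q) s) s.
  apply: uniq_perm => //; apply: (uniq_min_size _ _ _).2 => //; last by rewrite size_map.
  by move=> y /mapP[x xs ->]; apply: sq.
have : \sum_(y <- [seq x + q | x <- s]) y = \sum_(y <- s) y by apply: perm_big.
rewrite big_map big_split /= big_const_seq count_predT.
by rewrite -[RHS]addr0 => /addrI; rewrite iter_addr addr0.
Qed.

Lemma mulrn_card (V : finZmodType) (x : V) : x *+ #|V| = 0.
Proof.
by rewrite cardE; apply: translate_mulrn0; [exact: enum_uniq|move=> y _; rewrite mem_enum].
Qed.

(** * Conductors and sums *)

Section Conductor.
Variables (RR : realType) (A : form_data) (rho : rep_data A).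
Variables (hrho : is_rep rho).
Implicit Types (x y : rho) (q : QmodZ).

Let values : set QmodZ := [set z | exists x y : rho, z = rbeta x y] `|`
         [set z | exists phi (x : rho), z = rquad phi x].

Definition value_group : set QmodZ := smallest is_subgroup values.

Lemma value_groupE : conductor rho = #|` fset_set value_group|%fset.
Proof. by []. Qed.

Lemma torsion_subgroup n : is_subgroup [set q : QmodZ | q *+ n = 0].
Proof.
split; first exact: mul0rn.
by move=> x y /= xn yn; rewrite mulrnBl xn yn subr0.
Qed.

Lemma torsion_finite n : (0 < n)%N -> finite_set [set q : QmodZ | q *+ n = 0].
Proof.
move=> n0; pose g (k : 'I_n) := \pi_(QmodZ)%qT ((k : nat)%:R / n%:R : rat).
apply: (@sub_finite_set _ _ (g @` setT)); last exact/finite_image/finite_finset.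
move=> q /= qn; have [k hk] := expQZ_zeta RR n0 qn; exists k => //.
apply: (@expQZ_inj RR); rewrite hk /g expQZ_pi /zeta -exp2piMn.
by rewrite rmorphM /= ratr_nat mulr_natl fmorphV /= ratr_nat.
Qed.

(** The quadratic values satisfy q(n x) = n q(x) + C(n, 2) b(x, x). With n = |V|, the factor 2 turns
    C(n, 2) into n (n - 1), which kills b(x, x). *)
Lemma values_torsion q : values q -> q *+ (2 * #|rho|) = 0.
Proof.
have kb m x y : rbil m x y *+ #|rho| = 0.
  have h := (rbil_biadd hrho m).1 y.
  have e n : rbil m x y *+ n = rbil m (x *+ n) y.
    elim: n => [|n IH]; first by rewrite !mulr0n (morph_add0 h).
    by rewrite !mulrS IH h.
  by rewrite e mulrn_card (morph_add0 h).
case=> [[x [y ->]]|[phi [x ->]]].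
  by rewrite mulrnA mulrnAC kb mul0rn.
have [q0 [h1 h2]] := rquad_quad hrho phi.
pose b x y := rquad phi (x + y) - rquad phi x - rquad phi y.
have bD : {morph b x : y y' / y + y'} := h2 x.
have bE : b x x = rbil (flam phi) x x by rewrite (rbil_lam hrho).
have e n : rquad phi (x *+ n) = rquad phi x *+ n + b x x *+ 'C(n, 2).
  elim: n => [|n IH]; first by rewrite !mulr0n q0 addr0.
  have -> : rquad phi (x *+ n.+1) = b x (x *+ n) + rquad phi x + rquad phi (x *+ n).
    by rewrite /b mulrS addrAC subrK subrK.
  have -> : b x (x *+ n) = b x x *+ n.
    elim: (n) => [|k IHk]; first by rewrite !mulr0n (morph_add0 bD).
    by rewrite !mulrS bD IHk.
  rewrite IH binS bin1 mulrnDr mulrS.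
  by rewrite [b x x *+ n + _]addrC -!addrA; congr (_ + _); rewrite addrC -addrA.
have := e #|rho|; rewrite mulrn_card q0 => /(congr1 (fun z => z *+ 2)).
rewrite mul0rn mulrnDl -!mulrnA => /esym.
rewrite [('C(_, 2) * 2)%N](_ : _ = #|rho| * #|rho|.-1)%N.
  by rewrite [(b x x) *+ _]mulrnA bE kb mul0rn addr0 mulnC.
by have := bin_ffact #|rho| 2; rewrite !ffactnS ffactn0 muln1.
Qed.

Lemma value_group_finite : finite_set value_group.
Proof.
apply: (@sub_finite_set _ _ [set q | q *+ (2 * #|rho|) = 0]).
  by apply: smallest_sub; [exact: torsion_subgroup|exact: values_torsion].
by apply: torsion_finite; rewrite muln_gt0 /=; apply/card_gt0P; exists 0.
Qed.

Lemma value_subgroup : is_subgroup value_group.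
Proof.
split; first by move=> G [[]].
by move=> x y hx hy G hG; have [[_ GB] _] := hG; apply: GB; [apply: hx|apply: hy].
Qed.

(** Finiteness of the value group is essential: [fset_set] of an infinite set is empty by
    convention, which would make the conductor 0. *)
Lemma conductor_gt0 : (0 < conductor rho)%N.
Proof.
rewrite value_groupE cardfs_gt0; apply/fset0Pn; exists 0.
by rewrite (in_fset_set value_group_finite) inE; case: value_subgroup.
Qed.

Lemma conductor_kill q : value_group q -> q *+ conductor rho = 0.
Proof.
move=> qG.
rewrite value_groupE -[#|` _|%fset]/(size (enum_fset (fset_set value_group))).
apply: translate_mulrn0; first exact: fset_uniq.
move=> x; rewrite -/(_ \in fset_set _) -/(_ \in fset_set _).
rewrite !(in_fset_set value_group_finite) => /set_mem xG; apply: mem_set; rewrite -[q]opprK.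
by apply: value_subgroup.2 => //; rewrite -sub0r; apply: value_subgroup.2 => //; case: value_subgroup.
Qed.

Lemma value_beta x y : value_group (rbeta x y).
Proof. by move=> G [_ sG]; apply: sG; left; exists x, y. Qed.

Lemma value_quad phi x : value_group (rquad phi x).
Proof. by move=> G [_ sG]; apply: sG; right; exists phi, x. Qed.

Lemma conductor_beta x y : rbeta x y *+ conductor rho = 0.
Proof. by apply: conductor_kill; exact: value_beta. Qed.

Lemma conductor_quad phi x : rquad phi x *+ conductor rho = 0.
Proof. by apply: conductor_kill; exact: value_quad. Qed.

End Conductor.

Lemma nonsingular_sum (I : finType) (V : finZmodType) (b : I -> V -> V -> QmodZ) :
  (forall i, biadditive (b i)) -> (forall i, nonsingular (b i)) ->
  nonsingular (fun x y : {ffun I -> V} => \sum_i b i (x i) (y i)).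
Proof.
move=> bb bns h hD; pose del i (v : V) : {ffun I -> V} := [ffun j => if j == i then v else 0].
have delD i : {morph del i : v w / v + w}.
  by move=> v w; apply/ffunP => j; rewrite !ffunE; case: eqP; rewrite ?addr0.
have bdel (x : {ffun I -> V}) i v : \sum_j b j (x j) (del i v j) = b i (x i) v.
  rewrite (bigD1 i) //= ffunE eqxx big1 ?addr0 // => j ji.
  by rewrite ffunE (negPf ji) (morph_add0 ((bb j).2 _)).
have coord i : exists x, forall v, b i x v = h (del i v).
  have [|x [hx _]] := bns i (fun v => h (del i v)); last by exists x.
  by move=> v w; rewrite delD hD.
have [x hx] := boolp.choice coord; exists [ffun i => x i]; split.
  move=> y; have {2}-> : y = \sum_i del i (y i).
    apply/ffunP => j; rewrite sum_ffunE (bigD1 j) //= ffunE eqxx big1 ?addr0 //.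
    by move=> i ij; rewrite ffunE eq_sym (negPf ij).
  by rewrite (morph_sum _ _ _ hD); apply: eq_bigr => i _; rewrite -hx ffunE.
move=> x' hx'; apply/ffunP => i; rewrite ffunE.
have [|z [_ zu]] := bns i (fun v => h (del i v)); first by move=> v w; rewrite delD hD.
by rewrite -(zu _ (hx i)) -(zu (x' i)) // => v; rewrite -hx' bdel.
Qed.

Section SumRep.
Variables (RR : realType) (A : form_data) (hA : is_form_ring A).
Variables (rho : rep_data A) (hrho : is_rep rho).
Variables (N : nat) (a : 'I_N -> int).
Hypothesis ha : forall i, coprimez (a i) (conductor rho)%:Z.

(** Multiplication by a_i is invertible on the values of the form, which keeps the form of rho^a
    non-singular. *)
Lemma mulrz_inv (c : int) : coprimez c (conductor rho)%:Z ->
  exists b : int, forall q : QmodZ, q *+ conductor rho = 0 -> q *~ b *~ c = q.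
Proof.
move=> /coprimezP [[b v] /= bv]; exists b => q qf.
rewrite -mulrzA; have -> : b * c = 1 - v * (conductor rho)%:Z by rewrite -bv addrK.
by rewrite mulrzBr mulr1z mulrC mulrzA -pmulrn qf mul0rz subr0.
Qed.

Lemma sum_rep_is_rep : is_rep (sum_rep rho a).
Proof.
have hh := rep_hermitian hA hrho.
have bil_bi m : biadditive (@rbil A (sum_rep rho a) m).
  split=> [y x x'|x y y']; rewrite -big_split /=; apply: eq_bigr => i _;
    rewrite ffunE ?((rbil_biadd hrho m).1) ?((rbil_biadd hrho m).2) mulrzDl //.
split.
- split=> [x r s|r x y]; apply/ffunP => i; rewrite !ffunE; first exact: (scaleDl hh).
  exact: (scaleDr hh).
- by move=> x; apply/ffunP => i; rewrite !ffunE (rscale_one hrho).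
- by move=> r s x; apply/ffunP => i; rewrite !ffunE (rscale_mul hrho).
- exact: bil_bi.
- move=> m m' x y; rewrite -big_split /=; apply: eq_bigr => i _.
  by rewrite (rbil_add hrho) mulrzDl.
- by move=> m r s x y; apply: eq_bigr => i _; rewrite !ffunE (rbil_act hrho).
- by move=> m x y; apply: eq_bigr => i _; rewrite (rbil_tau hrho).
- apply: (@nonsingular_sum _ rho (fun i x y => rbil (fpsi 1) x y *~ a i)) => i.
    by split=> [y x x'|x y y']; rewrite ?((rbil_biadd hrho _).1) ?((rbil_biadd hrho _).2) mulrzDl.
  move=> h hD; have [b hb] := mulrz_inv (ha i).
  have [|x [hx xu]] := @rbeta_nonsingular _ _ hrho (fun v => h v *~ b).
    by move=> v w; rewrite hD mulrzDl.
  have hf y : h y *+ conductor rho = 0.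
    have [|z [hz _]] := @rbeta_nonsingular _ _ hrho h; first by [].
    by rewrite -hz; apply: (conductor_beta RR hrho).
  exists x; split=> [y|x' hx'].
    by rewrite -[rbil _ _ _]/(rbeta x y) hx hb.
  apply: xu => y; rewrite -hx' -[rbil _ _ _]/(rbeta x' y) mulrzAC.
  by rewrite hb // (conductor_beta RR hrho).
- move=> phi; split.
    by apply: big1 => i _; rewrite ffunE (rquad_quad hrho phi).1 mul0rz.
  have [_ [h1 h2]] := rquad_quad hrho phi.
  split=> [y x x'|x y y']; rewrite -!sumrB -big_split /=; apply: eq_bigr => i _;
    rewrite !ffunE -!mulrzBl -mulrzDl; congr (_ *~ _); [exact: h1|exact: h2].
- move=> phi chi x; rewrite -big_split /=; apply: eq_bigr => i _.
  by rewrite (rquad_add hrho) mulrzDl.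
- by move=> phi r x; apply: eq_bigr => i _; rewrite !ffunE (rquad_act hrho).
- by move=> m x; apply: eq_bigr => i _; rewrite (rquad_dbl hrho).
- move=> phi x y; rewrite -!sumrB; apply: eq_bigr => i _.
  by rewrite ffunE (rbil_lam hrho) !mulrzBl.
Qed.

End SumRep.

(** * Galois conjugation *)

(** As z^n = 1, z is a root of Phi_d for some d dividing n; then z^d = 1, and primitivity forces d =
    n. *)
Lemma root_map_Cyclotomic (E : fieldType) (h : {rmorphism rat -> E}) n (z : E) :
  n.-primitive_root z -> root (map_poly h (map_poly intr 'Phi_n)) z.
Proof.
move=> pz; have n0 := prim_order_gt0 pz.
have hE (p : {poly int}) : map_poly h (map_poly intr p) = map_poly intr p :> {poly E}.
  by rewrite -map_poly_comp; apply: eq_map_poly => x /=; rewrite rmorph_int.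
have Xn d : (0 < d)%N ->
    \prod_(e <- divisors d) (map_poly intr 'Phi_e : {poly E}).[z] = z ^+ d - 1.
  move=> d0; rewrite -horner_prod -rmorph_prod prod_Cyclotomic //.
  by rewrite rmorphB /= map_polyXn rmorph1 !hornerE.
have /eqP := Xn n n0; rewrite (prim_expr_order pz) subrr prodf_seq_eq0.
case/hasP => d dn /= /eqP ry.
have d0 : (0 < d)%N by move: dn; rewrite -dvdn_divisors // => /(dvdn_gt0 n0).
rewrite hE rootE; suff <- : d = n by apply/eqP.
apply/eqP; rewrite eqn_dvd [(d %| n)%N]dvdn_divisors // dn /= (prim_order_dvd pz).
rewrite -subr_eq0 -Xn // prodf_seq_eq0; apply/hasP; exists d; last by rewrite /= ry.
by rewrite -dvdn_divisors.
Qed.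

(** Phi_n is the minimal polynomial of a primitive root in [algC]. Being rational, it can be
    compared with p over Q: it divides p, and z^k is a root of it in E. *)
Lemma prim_root_conjugate (E : fieldType) (h : {rmorphism rat -> E}) n (z : E) k
    (p : {poly rat}) :
  n.-primitive_root z -> coprime k n ->
  root (map_poly h p) z -> root (map_poly h p) (z ^+ k).
Proof.
move=> pz kn pz0; have n0 := prim_order_gt0 pz.
have [w pw] := C_prim_root_exists n0.
have [q [qw qm qd]] := minCpolyP w.
have qE : q = map_poly intr 'Phi_n.
  apply: (@map_inj_poly _ _ (ratr : rat -> algC)); [exact: fmorph_inj|exact: rmorph0|].
  rewrite -qw (minCpoly_cyclotomic pw) -(Cintr_Cyclotomic pw) -map_poly_comp.
  by apply: eq_map_poly => x /=; rewrite ratr_int.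
have rq y : n.-primitive_root y -> root (map_poly h q) y.
  by rewrite qE; exact: root_map_Cyclotomic.
suff qp : q %| p.
  have := rq (z ^+ k); rewrite prim_root_exp_coprime // => /(_ kn).
  by rewrite -!dvdp_XsubCl => /dvdp_trans; apply; rewrite dvdp_map.
set d := gcdp q p; have dq : d %| q by apply: dvdp_gcdl.
have q0 : q != 0 by apply: monic_neq0.
have /dvdpP [e eE] := dq.
have e0 : e != 0 by apply: contra_neq q0 => e0; rewrite eE e0 mul0r.
have d0 : d != 0 by apply: contra_neq q0 => d0; rewrite eE d0 mulr0.
have : root (map_poly (ratr : rat -> algC) q) w by rewrite qd.
(* Were w a root of the cofactor e, then q would divide e and the gcd would be constant, although q
   and p have the common root z in E. *)
rewrite {1}eE rmorphM rootM => /orP[]; rewrite qd => dv.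
  have sz := dvdp_leq e0 dv.
  have sq : size q = (size e + size d).-1 by rewrite {1}eE size_mul.
  have d1 : (0 < size d)%N by rewrite size_poly_gt0.
  have e1 : (0 < size e)%N by rewrite size_poly_gt0.
  have szd : size d == 1%N.
    move: sz; rewrite sq; move: d1 e1; case: (size d) => [|[|x]] //.
    by case: (size e) => [|y] // _ _; rewrite addSn /= addnS; lia.
  have cop : coprimep (map_poly h q) (map_poly h p) by rewrite coprimep_map /coprimep.
  by have := coprimep_root cop (rq _ pz); rewrite -rootE pz0.
exact: dvdp_trans dv (dvdp_gcdr _ _).
Qed.

Section FieldGen.
Variable K : fieldType.
Implicit Types (E S : set K).

Lemma field_gen_subfield S : is_subfield (field_gen S).
Proof.
split; first by move=> E [[]].
  by move=> x y hx hy E hE; have [[_ h _] _] := hE; apply: h; [apply: hx|apply: hy].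
by move=> x y hx hy E hE; have [[_ _ h] _] := hE; apply: h; [apply: hx|apply: hy].
Qed.

Lemma sub_field_gen S : S `<=` field_gen S.
Proof. by move=> x Sx E [_ sE]; apply: sE. Qed.

Lemma subfield0 E : is_subfield E -> E 0.
Proof. by case=> h1 h2 _; rewrite -(subrr 1); apply: h2. Qed.
Lemma subfieldN E x : is_subfield E -> E x -> E (- x).
Proof. by move=> hE Ex; rewrite -sub0r; case: (hE) => _ h _; apply: h => //; exact: subfield0. Qed.
Lemma subfieldD E x y : is_subfield E -> E x -> E y -> E (x + y).
Proof.
by move=> hE Ex Ey; rewrite -[y]opprK; case: (hE) => _ h _; apply: h => //; exact: subfieldN.
Qed.
Lemma subfieldV E x : is_subfield E -> E x -> E x^-1.
Proof. by move=> hE Ex; rewrite -div1r; case: (hE) => h1 _ h; apply: h. Qed.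
Lemma subfieldM E x y : is_subfield E -> E x -> E y -> E (x * y).
Proof.
by move=> hE Ex Ey; rewrite -[y]invrK; case: (hE) => _ _ h; apply: h => //; exact: subfieldV.
Qed.
Lemma subfieldX E x n : is_subfield E -> E x -> E (x ^+ n).
Proof.
move=> hE Ex; elim: n => [|n IH]; first by rewrite expr0; case: hE.
by rewrite exprS; apply: subfieldM.
Qed.
Lemma subfield_int E (n : int) : is_subfield E -> E n%:~R.
Proof.
move=> hE; have hn k : E k%:R.
  elim: k => [|k IH]; first exact: subfield0.
  by rewrite -addn1 natrD; apply: subfieldD => //; case: hE.
by case: n => k; rewrite ?NegzE ?mulrNz; [exact: hn|apply: subfieldN => //; exact: hn].
Qed.
Lemma subfield_sum E (I : Type) (s : seq I) (P : pred I) (F : I -> K) :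
  is_subfield E -> (forall i, E (F i)) -> E (\sum_(i <- s | P i) F i).
Proof.
move=> hE hF; elim/big_rec: _ => [|i x _ Ex]; first exact: subfield0.
exact: subfieldD.
Qed.

Lemma subfield_ratr E (q : rat) : is_subfield E -> E (ratr q).
Proof. by move=> hE; case: (hE) => _ _ h; apply: h; exact: subfield_int. Qed.

End FieldGen.

Section Galois.
Variables (RR : realType) (A : form_data) (rho : rep_data A) (hrho : is_rep rho).
Variables (L : splittingFieldType rat) (iota : {rmorphism L -> RR[i]}).
Variable F : {subfield L}.
Hypothesis hK : range iota = K_field RR rho.
Hypothesis hF : is_complement (cyclotomic_field RR (conductor rho))
            (sqrt_field RR rho) [set iota z | z in [set` F]].

Local Notation f := (conductor rho).
Local Notation CC := (RR[i]).

Let f0 : (0 < f)%N := conductor_gt0 RR hrho.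

Lemma cyclotomic_sub_K : cyclotomic_field RR f `<=` range iota.
Proof. by rewrite hK => x hx; apply: sub_field_gen; left. Qed.

Lemma sqrt_sub_K : sqrt_field RR rho `<=` range iota.
Proof. by rewrite hK => x hx; apply: sub_field_gen; right. Qed.

Lemma zeta_cyclotomic : cyclotomic_field RR f (zeta RR f).
Proof. exact: sub_field_gen. Qed.

Lemma zetaL_exists : exists z : L, iota z = zeta RR f.
Proof. by have [z _ hz] := cyclotomic_sub_K zeta_cyclotomic; exists z. Qed.

Lemma zetaL_prim (z : L) : iota z = zeta RR f -> f.-primitive_root z.
Proof. by move=> hz; rewrite -(fmorph_primitive_root iota) hz; apply: zeta_prim. Qed.

Lemma iota_rat (q : rat) : iota q%:A = ratr q.
Proof.
have -> : iota q%:A = (iota \o in_alg L) q by [].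
exact: fmorph_eq_rat.
Qed.

(** The minimal polynomial of zeta_f over F divides X^f - 1, which splits in Q(zeta_f); its
    coefficients thus lie in F ∩ Q(zeta_f) = Q. So zeta_f^a is another root of it, and normality of
    L over F gives the automorphism. *)
Lemma galois_exists (a : int) : coprimez a f%:Z ->
  exists2 g : gal_of {:L}, g \in 'Gal({:L} / F)%g &
    forall z : L, iota z = zeta RR f -> iota (g z) = zeta RR f ^ a.
Proof.
move=> caf; have [z hz] := zetaL_exists; have pz := zetaL_prim hz.
set k := `|(a %% f)%Z|%N.
have fz : f%:Z != 0 by rewrite eqz_nat -lt0n.
have kE : (k : int) = (a %% f)%Z by rewrite /k gez0_abs // modz_ge0.
have ka : zeta RR f ^ a = zeta RR f ^+ k.
  have zn0 : zeta RR f != 0.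
    by apply/eqP => z0; have := zeta_exp RR f0; rewrite z0 expr0n -[f == 0%N]negbK -lt0n f0 => /eqP; rewrite eq_sym oner_eq0.
  rewrite [in LHS](divz_eq a f) expfzDr // [((a %/ f)%Z * _)]mulrC -exprz_exp.
  by rewrite -exprnP zeta_exp // exp1rz mul1r -kE.
have ck : coprime k f.
  by move: caf; rewrite /coprimez -gcdz_modl -kE /gcdz /= /coprime.
have rk : root (minPoly F z) (z ^+ k).
  have P1 : minPoly F z \is a polyOver 1%VS.
    have PF := minPolyOver F z.
    have : minPoly F z %| \prod_(0 <= i < f) ('X - (z ^+ i)%:P).
      rewrite (factor_Xn_sub_1 pz); apply: minPoly_dvdp.
        by rewrite rpredB ?rpredX ?polyOverX ?rpred1.
      by rewrite rootE !hornerE (prim_expr_order pz) subrr.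
    move/dvdp_prod_XsubC => [ms]; rewrite eqp_monic ?monic_minPoly ?monic_prod_XsubC //.
    move=> /eqP PE.
    have Pz : minPoly F z \is a polyOver <<1; z>>%VS.
      rewrite PE; apply: rpred_prod => i _; rewrite polyOverXsubC.
      by apply: rpredX; exact: memv_adjoin.
    apply/polyOverP => i; have := polyOverP Pz i; have := polyOverP PF i.
    set c := (_)`_i => cF /Fadjoin1_polyP [p cE].
    have [_ _ hFE] := hF.
    have : range (@ratr CC) (iota c).
      rewrite -hFE; split; first by exists c.
      have hE := field_gen_subfield [set zeta RR f].
      rewrite {1}cE horner_coef rmorph_sum; apply: (@subfield_sum _ (cyclotomic_field RR f) _ _ _ _ hE) => j.
      rewrite rmorphM rmorphXn /= hz coef_map /= iota_rat.
      apply: (@subfieldM _ (cyclotomic_field RR f) _ _ hE).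
        exact: (@subfield_ratr _ (cyclotomic_field RR f) _ hE).
      apply: (@subfieldX _ (cyclotomic_field RR f) _ _ hE).
      exact: zeta_cyclotomic.
    by case=> q _; rewrite -iota_rat => /fmorph_inj <-; rewrite rpredZ // mem1v.
  have /polyOver1P [p pE] := P1; have := root_minPoly F z.
  by rewrite pE => /(prim_root_conjugate pz ck).
have [g gG gz] := normalField_root_minPoly (subvf F) (normalFieldf F) (memvf z) rk.
exists g => // z'; rewrite -hz => /fmorph_inj ->.
by rewrite gz rmorphXn /= hz ka.
Qed.

Lemma gammaP (a : int) : coprimez a f%:Z ->
  gamma rho iota F a \in 'Gal({:L} / F)%g /\
    forall z : L, iota z = zeta RR f -> iota (gamma rho iota F a z) = zeta RR f ^ a.
Proof.
move=> caf; have [g gG gz] := galois_exists caf.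
rewrite /gamma; case: pickP => [g' /andP[g'G /asboolP g'z]//|/(_ g)].
by rewrite gG /=; move/asboolPn; case.
Qed.

Lemma gamma_expQZ (a : int) (q : QmodZ) (x : L) : coprimez a f%:Z ->
  q *+ f = 0 -> iota x = expQZ RR q -> iota (gamma rho iota F a x) = expQZ RR (q *~ a).
Proof.
move=> caf qf xq; have [_ gz] := gammaP caf.
have [k hk] := expQZ_zeta RR f0 qf; have [z hz] := zetaL_exists.
have -> : x = z ^+ k by apply: (fmorph_inj iota); rewrite xq hk rmorphXn /= hz.
rewrite rmorphXn rmorphXn /= (gz z hz) expQZMz hk.
by rewrite !exprnP exprzAC.
Qed.

Lemma expQZ_range (q : QmodZ) : q *+ f = 0 -> exists x : L, iota x = expQZ RR q.
Proof.
move=> qf; have [k hk] := expQZ_zeta RR f0 qf; have [z hz] := zetaL_exists.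
by exists (z ^+ k); rewrite rmorphXn /= hz hk.
Qed.

Lemma sqrt_range (e : A) : symmetric_idempotent e ->
  exists s : L, iota s = sqrtC #|idem_image rho e|%:R.
Proof.
move=> he; have [|s _ hs] := @sqrt_sub_K (sqrtC #|idem_image rho e|%:R).
  by apply: sub_field_gen; exists e.
by exists s.
Qed.

(** The square of s is an integer, so s can only change by a sign, and [epsilon] records which. *)
Lemma gamma_sqrt (e : A) (a : int) (s : L) : iota s = sqrtC #|idem_image rho e|%:R ->
  gamma rho iota F a s = (epsilon rho iota F e a)%:~R * s.
Proof.
move=> hs; rewrite /epsilon; case: asboolP => [h|h]; first by rewrite h // mul1r.
have s2 : s ^+ 2 = #|idem_image rho e|%:R.
  by apply: (fmorph_inj iota); rewrite rmorphXn /= hs sqrtCK rmorph_nat.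
have : (gamma rho iota F a s) ^+ 2 = s ^+ 2 by rewrite -rmorphXn /= s2 rmorph_nat.
move/eqP; rewrite eqf_sqr => /orP[/eqP gs|/eqP ->]; last by rewrite mulrN1z mulN1r.
case: h => s' hs'; have -> : s' = s by apply: (fmorph_inj iota); rewrite hs hs'.
exact: gs.
Qed.

End Galois.

(** * Matrix form rings *)

Section FormRing.
Variables (A : form_data) (hA : is_form_ring A).
Implicit Types r s : A.

Lemma fpsi_fconj r : fpsi (fconj r) = fmact (fpsi 1) r 1.
Proof. by rewrite /fconj (fpsiVK hA). Qed.

Lemma fconjD : {morph @fconj A : r s / r + s}.
Proof.
move=> r s; apply: (can_inj (fpsiK hA)).
by rewrite (fpsi_add hA) !fpsi_fconj ((fmact_biadd hA _).1).
Qed.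

Lemma fconjM r s : fconj (r * s) = fconj s * fconj r.
Proof.
apply: (can_inj (fpsiK hA)); rewrite fpsi_fconj (fpsi_mul hA) fpsi_fconj.
have -> : fmact (fpsi 1) (r * s) 1 = fmact (fmact (fpsi 1) r 1) s (1 : A).
  by rewrite -(fmact_mul hA) mulr1.
rewrite -fpsi_fconj -{1}[fconj r]mul1r (fpsi_mul hA).
by rewrite -!(fmact_mul hA) !mulr1 !mul1r.
Qed.

Lemma fconj1 : fconj (1 : A) = 1.
Proof. by apply: (can_inj (fpsiK hA)); rewrite fpsi_fconj (fmact_one hA). Qed.

Lemma fconj0 : fconj (0 : A) = 0.
Proof. exact: morph_add0 fconjD. Qed.

Lemma fmact0l r s : fmact (0 : fmod A) r s = 0.
Proof. exact: morph_add0 (fmact_add hA r s). Qed.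

Lemma fmact0r (x : fmod A) r : fmact x r 0 = 0.
Proof. exact: morph_add0 ((fmact_biadd hA x).2 r). Qed.

Lemma fpsi0 : fpsi (0 : A) = 0.
Proof. exact: morph_add0 (fpsi_add hA). Qed.

Variable m : nat.

Lemma mat_fconjE (r : mat_form A m) :
  fconj r = \matrix_(k, l) fconj ((r : 'M[A]_m) l k) :> 'M[A]_m.
Proof.
apply/matrixP => k l; rewrite /fconj /= !mxE; congr fpsiV.
rewrite (bigD1 l) //= [X in _ + X]big1 ?addr0; last first.
  move=> i il; rewrite (bigD1 i) //= !mxE eqxx (negPf il) fmact0r add0r.
  by apply: big1 => j ji; rewrite !mxE eq_sym (negPf ji) fpsi0 fmact0l.
rewrite (bigD1 l) //= !mxE !eqxx [X in _ + X]big1 ?addr0 // => j jl.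
by rewrite !mxE eq_sym (negPf jl) fpsi0 fmact0l.
Qed.

Lemma mat_fconjM (r s : mat_form A m) : fconj (r * s) = fconj s * fconj r.
Proof.
rewrite mat_fconjE; apply/matrixP => k l; rewrite !mxE.
rewrite (morph_sum _ _ _ fconjD); apply: eq_bigr => j _.
by rewrite fconjM !mat_fconjE !mxE.
Qed.

Lemma mat_fconj1 : fconj (1 : mat_form A m) = 1.
Proof.
rewrite mat_fconjE; apply/matrixP => k l; rewrite !mxE eq_sym.
by case: eqP; rewrite ?fconj1 ?fconj0.
Qed.

End FormRing.

Lemma quadratic_sum (X Y : zmodType) (I : Type) (s : seq I) (q : I -> X -> Y) :
  (forall i, pointed_quadratic (q i)) ->
  pointed_quadratic (fun x => \sum_(i <- s) q i x).
Proof.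
move=> hq; split; first by apply: big1 => i _; case: (hq i).
by split=> [y x x'|x y y']; rewrite -!sumrB -big_split /=; apply: eq_bigr => i _;
   have [_ [h1 h2]] := hq i; [exact: h1|exact: h2].
Qed.

Lemma quadratic_add (X Y : zmodType) (q q' : X -> Y) :
  pointed_quadratic q -> pointed_quadratic q' ->
  pointed_quadratic (fun x => q x + q' x).
Proof.
move=> hq hq'; have := @quadratic_sum X Y bool [:: true; false] (fun b => if b then q else q').
have -> : (fun x => \sum_(i <- [:: true; false]) (if i then q else q') x) =
          (fun x => q x + q' x).
  by apply/funext => x; rewrite !big_cons big_nil addr0.
by apply; case.
Qed.

Lemma quadratic_intro (X Y : zmodType) (q : X -> Y) (b : X -> X -> Y) :
  q 0 = 0 -> (forall x y, q (x + y) = q x + q y + b x y) -> biadditive b ->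
  pointed_quadratic q.
Proof.
move=> q0 qD [h1 h2]; have E x y : q (x + y) - q x - q y = b x y.
  by rewrite qD -addrA -opprD addrC addKr.
by split=> //; split=> [y x x'|x y y']; rewrite !E ?h1 ?h2.
Qed.

Lemma quadratic_bil (X Y : zmodType) (b : X -> X -> Y) :
  biadditive b -> pointed_quadratic (fun x => b x x).
Proof.
move=> [h1 h2]; apply: (@quadratic_intro _ _ _ (fun x y => b x y + b y x)).
- exact: morph_add0 (h2 0).
- move=> x y; rewrite h2 !h1 -!addrA; congr (_ + _).
  by rewrite addrA addrC; congr (_ + _); rewrite addrC.
- by split=> [y x x'|x y y']; rewrite !h1 !h2 addrACA.
Qed.

Lemma quadratic_comp (X Y Z : zmodType) (q : Y -> Z) (g : X -> Y) :
  {morph g : x y / x + y} -> pointed_quadratic q -> pointed_quadratic (fun x => q (g x)).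
Proof.
move=> hg [q0 [h1 h2]]; split; first by rewrite (morph_add0 hg).
by split=> [y x x'|x y y']; rewrite !hg; [exact: h1|exact: h2].
Qed.

Lemma biadditive_comp (X Y Z : zmodType) (b : Y -> Y -> Z) (g h : X -> Y) :
  {morph g : x y / x + y} -> {morph h : x y / x + y} -> biadditive b ->
  biadditive (fun x y => b (g x) (h y)).
Proof. by move=> hg hh [h1 h2]; split=> [y x x'|x y y']; rewrite ?hg ?hh ?h1 ?h2. Qed.

Section SumHermitian.
Variables (A : form_data) (rho : rep_data A) (hh : is_hermitian rho).

Lemma beta_sum_biadditive (I : finType) :
  biadditive (fun x y : {ffun I -> rho} => \sum_i rbeta (x i) (y i)).
Proof.
by split=> [y x x'|x y y']; rewrite -big_split /=; apply: eq_bigr => i _;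
  rewrite ffunE ?(betaDl hh) ?(betaDr hh).
Qed.

Lemma beta_sum_nonsingular (I : finType) :
  nonsingular (fun x y : {ffun I -> rho} => \sum_i rbeta (x i) (y i)).
Proof.
apply: (@nonsingular_sum _ rho (fun=> @rbeta A rho)) => i; first exact: hbeta_biadd hh.
exact: hbeta_nonsingular hh.
Qed.

Lemma beta_sum_nondegr (I : finType) (y : {ffun I -> rho}) :
  (forall x : {ffun I -> rho}, \sum_i rbeta (x i) (y i) = 0) -> y = 0.
Proof.
move=> h; apply/ffunP => i; rewrite ffunE; apply: (hbeta_nondegr hh) => v.
rewrite -[RHS](h [ffun j => if j == i then v else 0]).
rewrite (bigD1 i) //= ffunE eqxx big1 ?addr0 // => j ji.
by rewrite ffunE (negPf ji) (beta0l hh).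
Qed.

Variable N : nat.
Local Notation ones := (fun _ : 'I_N => 1 : int).

Lemma sum1_betaE (x y : sum_rep rho ones) :
  rbeta x y = \sum_i rbeta ((x : {ffun _ -> rho}) i) ((y : {ffun _ -> rho}) i).
Proof. by apply: eq_bigr => i _; rewrite mulr1z. Qed.

Lemma sum1_hermitian : is_hermitian (sum_rep rho ones).
Proof.
have bE : @rbeta _ (sum_rep rho ones) =
   fun x y : {ffun 'I_N -> rho} => \sum_i rbeta (x i) (y i).
  by apply/funext => x; apply/funext => y; rewrite -sum1_betaE.
split.
- split=> [x r s|r x y]; apply/ffunP => i; rewrite !ffunE; first exact: (scaleDl hh).
  exact: (scaleDr hh).
- by move=> x; apply/ffunP => i; rewrite !ffunE (hscale_one hh).
- by move=> r s x; apply/ffunP => i; rewrite !ffunE (hscale_mul hh).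
- by rewrite bE; exact: beta_sum_biadditive.
- by rewrite bE; exact: beta_sum_nonsingular.
- by rewrite bE; exact: beta_sum_nondegr.
- by move=> r x y; rewrite !sum1_betaE; apply: eq_bigr => i _; rewrite !ffunE (hbeta_adj hh).
Qed.

End SumHermitian.

Section GenusRep.
Variables (A : form_data) (hA : is_form_ring A) (rho : rep_data A) (hrho : is_rep rho).
Variable m : nat.
Local Notation Vm := (genus_rep rho m).
Let hh := rep_hermitian hA hrho.

Lemma rbil0 (x y : rho) : rbil 0 x y = 0.
Proof. by apply: (addrI (rbil 0 x y)); rewrite -(rbil_add hrho) !addr0. Qed.

Lemma rquad0 (x : rho) : rquad 0 x = 0.
Proof. by apply: (addrI (rquad 0 x)); rewrite -(rquad_add hrho) !addr0. Qed.

Lemma genus_betaE (x y : Vm) :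
  rbeta x y = \sum_i rbeta ((x : {ffun _ -> rho}) i) ((y : {ffun _ -> rho}) i).
Proof.
rewrite /rbeta /=; apply: eq_bigr => i _; rewrite (bigD1 i) //= !mxE eqxx.
rewrite big1 ?addr0 // => j ji; rewrite !mxE eq_sym (negPf ji).
by rewrite (fpsi0 hA) rbil0.
Qed.

(** The form is an orthogonal sum of m copies of beta; adjointness holds because the
    anti-automorphism of Mat_m(R) transposes. *)
Lemma genus_hermitian : is_hermitian Vm.
Proof.
have bE : @rbeta _ Vm = fun x y : {ffun 'I_m -> rho} => \sum_i rbeta (x i) (y i).
  by apply/funext => x; apply/funext => y; rewrite -genus_betaE.
split.
- split=> [x r s|r x y]; apply/ffunP => i; rewrite !ffunE -big_split /=;
    apply: eq_bigr => j _; rewrite ?mxE ?ffunE; first exact: (scaleDl hh).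
  exact: (scaleDr hh).
- move=> x; apply/ffunP => i; rewrite ffunE (bigD1 i) //= !mxE eqxx (hscale_one hh).
  by rewrite big1 ?addr0 // => j ji; rewrite !mxE eq_sym (negPf ji) (scale0l hh).
- move=> r s x; apply/ffunP => i; rewrite !ffunE.
  under eq_bigr do rewrite !mxE (morph_sum _ _ _ (scaleDl hh _)).
  rewrite exchange_big /=; apply: eq_bigr => k _.
  rewrite ffunE (morph_sum _ _ _ (scaleDr hh _)); apply: eq_bigr => j _.
  by rewrite (hscale_mul hh).
- by rewrite bE; exact: beta_sum_biadditive.
- by rewrite bE; exact: beta_sum_nonsingular.
- by rewrite bE; exact: beta_sum_nondegr.
- move=> r x y; rewrite !genus_betaE.
  have fE j i : (fconj r : 'M[A]_m) j i = fconj ((r : 'M[A]_m) i j).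
    by rewrite (mat_fconjE hA) mxE.
  move: (fconj r) fE => r' fE.
  under eq_bigr do rewrite ffunE (morph_sum _ _ _ (betaDl hh _)).
  rewrite exchange_big /=; apply: eq_bigr => j _.
  rewrite ffunE (morph_sum _ _ _ (betaDr hh _)); apply: eq_bigr => i _.
  by rewrite fE (hbeta_adj hh).
Qed.

Lemma genus_quadratic q : pointed_quadratic (@rquad _ Vm q).
Proof.
have evD i : {morph (fun x : {ffun 'I_m -> rho} => x i) : x y / x + y}.
  by move=> x y; rewrite ffunE.
apply: quadratic_add; apply: quadratic_sum => i.
  by apply: quadratic_comp; [exact: evD|exact: rquad_quad].
apply: (@quadratic_bil _ _ (fun x y : {ffun 'I_m -> rho} =>
   rbil (q.2 i) (x (val i).1) (y (val i).2))).
by apply: biadditive_comp; [exact: evD|exact: evD|exact: rbil_biadd].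
Qed.

Lemma genus_beta_torsion (RR : realType) (x y : Vm) : rbeta x y *+ conductor rho = 0.
Proof.
rewrite genus_betaE -sumrMnl big1 // => i _; exact: (conductor_beta RR hrho).
Qed.

Lemma rbil_torsion (RR : realType) mm (x y : rho) : rbil mm x y *+ conductor rho = 0.
Proof. by rewrite (rbilE hA hrho); apply: (conductor_beta RR hrho). Qed.

Lemma genus_quad_torsion (RR : realType) q (x : Vm) : rquad q x *+ conductor rho = 0.
Proof.
rewrite /= mulrnDl -!sumrMnl !big1 ?addr0 // => i _.
  exact: (rbil_torsion RR).
exact: (conductor_quad RR hrho).
Qed.

End GenusRep.

(** * Clifford-Weil operators *)

Section Kernels.
Variables (K : pzRingType) (V : finType).

Lemma op_mxE (k : V -> V -> K) u w : op_mx k (enum_rank u) (enum_rank w) = k u w.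
Proof. by rewrite mxE !enum_rankK. Qed.

Lemma eq_op_mx (k k' : V -> V -> K) : (forall u w, k u w = k' u w) -> op_mx k = op_mx k'.
Proof. by move=> h; apply/matrixP => i j; rewrite !mxE. Qed.

Lemma sum_enum_rank (F : 'I_#|V| -> K) : \sum_i F i = \sum_x F (enum_rank x).
Proof. by rewrite (reindex (@enum_rank V)) //; apply: onW_bij; exact: enum_rank_bij. Qed.

Lemma matrix_enumP (g h : 'M[K]_#|V|) :
  (forall u w, g (enum_rank u) (enum_rank w) = h (enum_rank u) (enum_rank w)) -> g = h.
Proof.
by move=> e; apply/matrixP => i j; rewrite -(enum_valK i) -(enum_valK j).
Qed.

Lemma mulmx_enumE (g h : 'M[K]_#|V|) u w :
  (g *m h) (enum_rank u) (enum_rank w) =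
  \sum_x g (enum_rank u) (enum_rank x) * h (enum_rank x) (enum_rank w).
Proof. by rewrite mxE sum_enum_rank. Qed.

End Kernels.

Section IdempotentData.
Variable A : form_data.
Implicit Types e u v : A.

(** What is kept of the corner conditions on u_e and v_e. These identities are all the operator
    calculations use, and they pass to matrices with a single non-zero entry. *)
Definition idem_data e u v :=
  [/\ e * e = e, u * v = e, v * u = fconj e, v * e = v & e * u = u].

Lemma idem_fconjl e u v : idem_data e u v -> fconj e * v = v.
Proof. by move=> [ee uv vu ve eu]; rewrite -vu -mulrA uv. Qed.

Lemma idem_ur e u v : idem_data e u v -> u * fconj e = u.
Proof. by move=> [ee uv vu ve eu]; rewrite -vu mulrA uv. Qed.

Lemma idem_fconj e u v : idem_data e u v -> fconj e * fconj e = fconj e.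
Proof. by move=> h; have [ee uv vu ve eu] := h; rewrite -{2}vu mulrA (idem_fconjl h). Qed.

End IdempotentData.

Section HermitianOperators.
Variables (RR : realType) (A : form_data) (rho : rep_data A).
Local Notation CC := (RR[i]).
Local Notation E := (expQZ RR).
Implicit Types (e u v r s : A) (c w x y z : rho) (b : int).

Definition kern_m r x w : CC := (x == rscale r w)%:R.
Definition kern_d b phi x w : CC := E (rquad phi w *~ b) *+ (x == w).
Definition idem_sqrt e : CC := sqrtC #|idem_image rho e|%:R.
(** Only the exponents carry b; the root stays the positive one. Products over the coordinates of
    rho^a are therefore operators of rho^a, whereas the conjugate under gamma_b differs from this
    kernel by the sign [epsilon]. *)
Definition kern_h b e v x w : CC :=
  (idem_sqrt e)^-1 *
  \sum_(t in idem_image rho e)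
     E (rbeta t (rscale v w) *~ b) *+ (x == t + rscale (1 - e) w).

Lemma cw_mE r : cw_m RR rho r = op_mx (kern_m r).
Proof. by []. Qed.

Lemma cw_dE phi : cw_d RR rho phi = op_mx (kern_d 1 phi).
Proof. by apply: eq_op_mx => x w; rewrite /kern_d mulr1z. Qed.

Lemma cw_hE e v : cw_h RR rho e v = op_mx (kern_h 1 e v).
Proof.
by apply: eq_op_mx => x w; congr (_ * _); apply: eq_bigr => t _; rewrite mulr1z.
Qed.

Hypothesis hh : is_hermitian rho.

Lemma scaleA r s x : rscale (r * s) x = rscale r (rscale s x).
Proof. exact: hscale_mul hh _ _ _. Qed.

Lemma scale_idem_imageP e t : e * e = e ->
  (t \in idem_image rho e) = (rscale e t == t).
Proof.
move=> ee; apply/imsetP/eqP => [[x _ ->]|<-]; first by rewrite -scaleA ee.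
by exists t; rewrite ?inE.
Qed.

Lemma scale1B e x : rscale (1 - e) x = x - rscale e x.
Proof. by rewrite (scaleBl hh) (hscale_one hh). Qed.

Lemma scale1BK e x : rscale e x + rscale (1 - e) x = x.
Proof. by rewrite scale1B addrC subrK. Qed.

Lemma kern_h_simpl b e v x w : e * e = e ->
  kern_h b e v x w = (idem_sqrt e)^-1 *
   (E (rbeta (rscale e x) (rscale v w) *~ b) *+ (rscale (1 - e) x == rscale (1 - e) w)).
Proof.
move=> ee; congr (_ * _).
have t1 t : t \in idem_image rho e -> (x == t + rscale (1 - e) w) =
    (t == rscale e x) && (rscale (1 - e) x == rscale (1 - e) w).
  rewrite scale_idem_imageP // => /eqP et; apply/eqP/andP => [->|[/eqP -> /eqP <-]].
    have h : rscale e (t + rscale (1 - e) w) = t.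
      by rewrite (scaleDr hh) et -scaleA mulrBr mulr1 ee subrr (scale0l hh) addr0.
    by rewrite h eqxx scale1B h addrC addKr eqxx.
  by rewrite scale1BK.
rewrite (bigD1 (rscale e x)) /=; last by rewrite scale_idem_imageP // -scaleA ee.
rewrite t1 ?scale_idem_imageP -?scaleA ?ee // eqxx /= big1 ?addr0 // => t /andP[tI te].
by rewrite t1 // (negPf te) mulr0n.
Qed.

Lemma idem_sqrt_gt0 e : 0 < idem_sqrt e.
Proof.
rewrite sqrtC_gt0 ltr0n; apply/card_gt0P; exists (rscale e 0); apply/imsetP.
by exists 0; rewrite ?inE.
Qed.

Lemma idem_sqrt_neq0 e : idem_sqrt e != 0.
Proof. by rewrite gt_eqF // idem_sqrt_gt0. Qed.

Lemma beta_idem e x y : e * e = e ->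
  rbeta (rscale e x) y = rbeta (rscale e x) (rscale (fconj e) y).
Proof. by move=> ee; rewrite -(hbeta_adj hh) -scaleA ee. Qed.

Section SelfDual.
Variable S : {set rho}.
Hypotheses (hS : is_code S) (dS : dual_code S = S).

(** No unit exchanging the arguments of beta is at hand here. Instead the right orthogonal contains
    S and has, by the usual double sum, the same order. *)
Lemma self_dual_right y : (forall c, c \in S -> rbeta c y = 0) -> y \in S.
Proof.
pose R := [set y | [forall c in S, rbeta c y == 0]]%SET.
have cR : (#|S| * #|R|)%N = #|rho|.
  apply/eqP; rewrite -(eqr_nat CC).
  pose T : CC := \sum_x \sum_(c in S) E (rbeta c x).
  have T1 : T = (#|S| * #|R|)%N%:R.
    rewrite natrM mulr_natr -sumr_const big_mkcond /= /T.
    apply: eq_bigr => x _; rewrite sum_char ?code0 //; first by rewrite inE; case: ifP.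
      by move=> c d cC dC; apply: (codeB hh).
    exact: (betaDl hh).
  rewrite -T1 /T exchange_big /= (bigD1 0) ?code0 //= [X in _ + X]big1 ?addr0.
    rewrite (eq_bigr (fun _ => 1)) => [|x _]; last by rewrite (beta0l hh) expQZ0.
    by rewrite sumr_const.
  move=> c /andP[_ c0]; rewrite sum_charT; last exact: (betaDr hh).
  rewrite (_ : [forall x, _] = false) ?mulr0n //.
  apply: contraNF c0 => /forallP h; apply/eqP; apply: (beta_nondegl hh) => x.
  exact/eqP/h.
have SR : S \subset R.
  apply/fintype.subsetP => z zS; rewrite inE; apply/forall_inP => c.
  by rewrite -{1}dS => /dualP h; apply/eqP/h.
have : S == R.
  rewrite eqEcard SR /=; move/eqP: cR; rewrite -(card_dual hh RR hS) dS.
  rewrite eqn_pmul2l; first by move/eqP ->.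
  by apply/card_gt0P; exists 0; apply: code0.
move/eqP => {2}-> h; rewrite inE; apply/forall_inP => c cS; exact/eqP/h.
Qed.

Variables e u v : A.
Hypothesis huv : idem_data e u v.

Let eS := [set c in S | rscale e c == c]%SET.

(** Pair eS with J = e^J V. The annihilator of eS in J is S ∩ J, which multiplication by v
    identifies with eS; the same map identifies eV with J. Summing the characters of the pairing in
    both orders gives the count. *)
Lemma card_idem_self_dual : (#|eS| * #|eS|)%N = #|idem_image rho e|.
Proof.
have [ee uv vu ve eu] := huv.
pose J := [set y : rho | rscale (fconj e) y == y]%SET.
have fJ := idem_fconj huv; have fv := idem_fconjl huv; have uf := idem_ur huv.
have bij (P : {set rho}) : (forall r x, x \in P -> rscale r x \in P) ->
    #|[set c in P | rscale e c == c]%SET| = #|P :&: J|%SET.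
  move=> PZ; rewrite -(card_in_imset (f := rscale v)).
    apply: eq_card => y; rewrite finset.in_setI inE; apply/imsetP/andP.
      move=> [c]; rewrite inE => /andP[cP ec] ->; split; first exact: PZ.
      by rewrite -scaleA fv.
    move=> [yP /eqP fy]; exists (rscale u y).
      by rewrite inE PZ // -scaleA eu eqxx.
    by rewrite -scaleA vu fy.
  move=> c d; rewrite !inE => /andP[_ /eqP ec] /andP[_ /eqP ed] /(congr1 (rscale u)).
  by rewrite -!scaleA uv ec ed.
have cJ : #|idem_image rho e| = #|J|.
  have := bij [set: rho]%SET (fun _ _ _ => finset.in_setT _).
  rewrite finset.setTI => <-; apply: eq_card => t.
  by rewrite scale_idem_imageP // !inE.
have cS : #|eS| = #|S :&: J|%SET by apply: bij => r x xS; apply: codeZ.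
apply/eqP; rewrite {2}cS cJ -(eqr_nat CC); apply/eqP.
have JB : {in J &, forall x y, x - y \in J}.
  by move=> x y; rewrite !inE (scaleBr hh) => /eqP -> /eqP ->.
have eSB : {in eS &, forall x y, x - y \in eS}.
  move=> x y; rewrite !inE (scaleBr hh) => /andP[xS /eqP ->] /andP[yS /eqP ->].
  by rewrite eqxx andbT; apply: (codeB hh).
have J0 : 0 \in J by rewrite inE (scale0r hh).
have eS0 : 0 \in eS by rewrite inE (scale0r hh) eqxx code0.
transitivity (\sum_(y in J) \sum_(c in eS) E (rbeta c y)).
  rewrite natrM mulr_natr -sumr_const big_mkcond [RHS]big_mkcond /=.
  apply: eq_bigr => y _; rewrite finset.in_setI andbC.
  case: (boolP (y \in J)) => //= yJ; rewrite sum_char //; last exact: (betaDl hh).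
  rewrite (_ : [forall c in eS, _] = (y \in S)); first by case: (y \in S).
  apply/forall_inP/idP => [h|yS c].
    apply: self_dual_right => c cS'; have /eqP <- : rscale (fconj e) y == y by move: yJ; rewrite inE.
    rewrite -(hbeta_adj hh); apply/eqP/h.
    by rewrite inE codeZ // -scaleA ee eqxx.
  by rewrite inE => /andP[cS' _]; move: cS'; rewrite -{1}dS => /dualP h; apply/eqP/h.
rewrite exchange_big /= (bigD1 0) //= [X in _ + X]big1 ?addr0.
  rewrite (eq_bigr (fun _ => 1)) => [|x _]; last by rewrite (beta0l hh) expQZ0.
  by rewrite sumr_const.
move=> c /andP[ceS c0]; rewrite sum_char //; last exact: (betaDr hh).
rewrite (_ : [forall x in J, _] = false) ?mulr0n //.
apply: contraNF c0 => /forall_inP h; apply/eqP; apply: (beta_nondegl hh) => x.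
have /eqP <- : rscale e c == c by move: ceS; rewrite inE => /andP[].
rewrite beta_idem //; have -> : rscale e c = c by apply/eqP; move: ceS; rewrite inE => /andP[].
by apply/eqP/h; rewrite inE -scaleA fJ.
Qed.

(** The w in S with (1 - e) w = (1 - e) x form a coset of eS, so the sum is a character sum equal to
    |eS| or 0, and |eS| is the normalising root. This serves V^m, for which the conjecture is not
    assumed. *)
Lemma kern_h_fix x : \sum_w kern_h 1 e v x w * (w \in S)%:R = (x \in S)%:R.
Proof.
have [ee uv vu ve eu] := huv.
have fv := idem_fconjl huv.
under eq_bigr do rewrite kern_h_simpl // mulr1z -mulrA.
rewrite -mulr_sumr; apply: (mulfI (idem_sqrt_neq0 e)); rewrite mulVKf ?idem_sqrt_neq0 //.
have e1e : e * (1 - e) = 0 by rewrite mulrBr mulr1 ee subrr.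
have v1e : v * (1 - e) = 0 by rewrite mulrBr mulr1 ve subrr.
have e11 : (1 - e) * (1 - e) = 1 - e by rewrite mulrBl mul1r e1e subr0.
case: (boolP (rscale (1 - e) x \in S)) => xS; last first.
  rewrite (_ : x \in S = false) ?mulr0; last by apply: contraNF xS => /codeZ ->.
  apply: big1 => w _; case: eqP => [xw|_]; last by rewrite mulr0n mul0r.
  by rewrite (_ : w \in S = false) ?mulr0 //; apply: contraNF xS; rewrite xw => /codeZ ->.
have xE : (x \in S) = (rscale e x \in S) by rewrite -{1}(scale1BK e x) (codeDr hh).
rewrite (reindex_inj (addIr (rscale (1 - e) x))) /=.
have sq : #|eS|%:R = idem_sqrt e.
  rewrite /idem_sqrt -card_idem_self_dual natrM -expr2 sqrCK ?ler0n //.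
rewrite (eq_bigr (fun c => if c \in eS then E (rbeta (rscale e x) (rscale v c)) else 0)).
  rewrite -big_mkcond sum_char; first last.
  - by move=> c d; rewrite (scaleDr hh) (betaDr hh).
  - move=> c d; rewrite !inE (scaleBr hh) => /andP[cS /eqP ->] /andP[dS' /eqP ->].
    by rewrite eqxx andbT; apply: (codeB hh).
  - by rewrite inE code0 // (scale0r hh) eqxx.
  rewrite sq (_ : [forall c in eS, _] = (x \in S)); first by rewrite mulr_natr.
  rewrite xE; apply/forall_inP/idP => [h|exS c].
    rewrite -dS; apply/dualP => c cS; rewrite beta_idem // -vu scaleA; apply/eqP/h.
    by rewrite inE codeZ // -scaleA eu eqxx.
  rewrite inE => /andP[cS _]; apply/eqP; move: exS; rewrite -{1}dS => /dualP; apply.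
  exact: codeZ.
move=> c _; rewrite inE (codeDr hh) // (scaleDr hh (1 - e)) -scaleA e11.
have -> : (rscale (1 - e) x == rscale (1 - e) c + rscale (1 - e) x) = (rscale e c == c).
  by rewrite -{1}[rscale (1 - e) x]add0r (inj_eq (addIr _)) eq_sym scale1B subr_eq0 eq_sym.
rewrite (scaleDr hh v) -scaleA v1e (scale0l hh) addr0.
by case: (c \in S); case: (_ == c); rewrite ?mulr1n ?mulr0n ?mulr0 ?mulr1 ?mul0r.
Qed.

End SelfDual.

End HermitianOperators.

Section Heisenberg.
Variables (RR : realType) (A : form_data) (rho : rep_data A).
Hypothesis hh : is_hermitian rho.
Local Notation CC := (RR[i]).
Local Notation E := (expQZ RR).
Implicit Types (e u v r s : A) (w x y z : rho).

Definition heis x y z w : CC := E (rbeta y w) *+ (z == w + x).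

(* Entrywise form of k X_(x,y) = e(q) X_(x',y') k for the Heisenberg operators
   X_(x,y) : b_w |-> e(beta(y, w)) b_(w+x). *)
Definition heis_normal (n : nat) (k : rho -> rho -> CC) := forall x y,
  exists x' y' q, q *+ n = 0 /\ forall z w,
    k z (w + x) * E (rbeta y w) = E q * (E (rbeta y' (z - x')) * k (z - x') w).

Lemma beta_represent (h : rho -> QmodZ) : {morph h : x y / x + y} ->
  exists y, forall z, rbeta y z = h z.
Proof. by move=> hD; have [y [hy _]] := hbeta_nonsingular hh hD; exists y. Qed.

Variable n : nat.

Lemma heis_kern_m r s : r * s = 1 -> s * r = 1 -> heis_normal n (kern_m RR r).
Proof.
move=> rs sr x y.
have [|y' hy'] := @beta_represent (fun z => rbeta y (rscale s z)).
  by move=> a b; rewrite (scaleDr hh) (betaDr hh).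
exists (rscale r x), y', 0; split; first exact: mul0rn.
move=> z w; rewrite expQZ0 mul1r hy' /kern_m (scaleDr hh) subr_eq mulrC.
have [->|] := eqVneq z (rscale r w + rscale r x); rewrite ?mulr0 //.
by rewrite addrK -(scaleA hh) sr (hscale_one hh).
Qed.

Hypothesis beta_torsion : forall x y, rbeta x y *+ n = 0.

Lemma heis_kern_d phi : pointed_quadratic (@rquad A rho phi) ->
  (forall x, rquad phi x *+ n = 0) -> heis_normal n (kern_d RR 1 phi).
Proof.
move=> [q0 [h1 h2]] qn x y.
have [|y' hy'] := @beta_represent (fun z => rbeta y z +
    (rquad phi (z + x) - rquad phi z - rquad phi x)).
  by move=> a b; rewrite (betaDr hh) h1 addrACA.
exists x, y', (rquad phi x); split; first exact: qn.
move=> z w; rewrite /kern_d !mulr1z subr_eq hy'.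
have [->|] := eqVneq z (w + x); last by rewrite !mulr0n !(mul0r, mulr0).
rewrite addrK !mulr1n -!expQZD; congr E.
rewrite -(addrA (rbeta y w)) [_ - rquad phi x + _]addrAC subrK.
by rewrite [RHS]addrCA [rquad phi x + _]addrC subrK addrC.
Qed.

(** The operator is a Fourier transform on eV and trivial on (1 - e)V. So x' takes its e-part from
    the character y through u, and y' its e-part from the translation x through v; the other parts
    are unchanged. *)
Lemma heis_kern_h e u v : idem_data e u v -> heis_normal n (kern_h RR 1 e v).
Proof.
move=> huv x y; have [ee uv vu ve eu] := huv.
have fv := idem_fconjl huv.
have e1e : e * (1 - e) = 0 by rewrite mulrBr mulr1 ee subrr.
have e1e' : (1 - e) * e = 0 by rewrite mulrBl mul1r ee subrr.
have e11 : (1 - e) * (1 - e) = 1 - e by rewrite mulrBl mul1r e1e subr0.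
have [|z0 hz] := @beta_represent (fun z => - rbeta y (rscale u z)).
  by move=> a b; rewrite (scaleDr hh) (betaDr hh) opprD.
have [x' [ex' e1x']] : exists x', rscale e x' = rscale e z0 /\
    rscale (1 - e) x' = rscale (1 - e) x.
  exists (rscale e z0 + rscale (1 - e) x).
  by rewrite !(scaleDr hh) -!(scaleA hh) ee e1e e11 e1e' !(scale0l hh) addr0 add0r.
have [|y' hy'] := @beta_represent (fun z =>
    rbeta (rscale e z) (rscale v x) + rbeta y (rscale (1 - e) z)).
  by move=> a b; rewrite !(scaleDr hh) (betaDl hh) (betaDr hh) addrACA.
exists x', y', (rbeta y' x' - rbeta y (rscale (1 - e) x)); split.
  by rewrite mulrnBl !beta_torsion subr0.
move=> z w; rewrite !(kern_h_simpl RR hh) // !mulr1z !(scaleBr hh) !(scaleDr hh).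
rewrite e1x' ex' subr_eq.
have [zE|] := eqVneq (rscale (1 - e) z) _; last by rewrite !mulr0n !(mulr0, mul0r).
rewrite !mulr1n -[LHS]mulrA [X in _ = _ * X]mulrCA [RHS]mulrCA; congr (_ * _).
rewrite -!expQZD; congr E.
rewrite (betaBl hh) (betaBr hh) (hy' z) zE (betaDr hh y).
rewrite (betaDr hh (rscale e z)).
have -> : rbeta (rscale e z0) (rscale v w) = - rbeta y (rscale e w).
  by rewrite (hbeta_adj hh) -(scaleA hh) fv hz -(scaleA hh) uv.
have -> : rbeta y w = rbeta y (rscale e w) + rbeta y (rscale (1 - e) w).
  by rewrite -(betaDr hh) (scale1BK hh).
set a1 := rbeta (rscale e z) (rscale v w); set a2 := rbeta _ (rscale v x).
set a3 := rbeta y (rscale e w); set a4 := rbeta y (rscale (1 - e) w).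
set a5 := rbeta y (rscale (1 - e) x); set a6 := rbeta y' x'.
rewrite opprK [RHS]addrA [a6 - a5 + _]addrC [_ - a6 + _]addrA subrK.
by rewrite [a2 + (a4 + a5)]addrA addrK [RHS]addrACA [a2 + a1]addrC [a4 + a3]addrC.
Qed.

End Heisenberg.

Section ChangeOfIdempotent.
Variables (RR : realType) (A : form_data) (rho : rep_data A).
Hypothesis hh : is_hermitian rho.
Hypothesis fconj_mul : forall r s : A, fconj (r * s) = fconj s * fconj r.
Hypothesis fconj_one : fconj (1 : A) = 1.
Local Notation CC := (RR[i]).
Implicit Types (e u v r s : A) (w x y z : rho).

Lemma idem_sqrt_conj e e' r s : e * e = e -> r * s = 1 -> s * r = 1 -> e' = r * e * s ->
  idem_sqrt RR rho e = idem_sqrt RR rho e'.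
Proof.
move=> ee rs sr e'E; have e'e' : e' * e' = e'.
  by rewrite e'E -!mulrA (mulrA s r) sr mul1r (mulrA e e) ee.
rewrite /idem_sqrt; congr (sqrtC _%:R).
rewrite -(card_imset (idem_image rho e) (f := rscale r)); last first.
  by apply: (can_inj (g := rscale s)) => x; rewrite -(scaleA hh) sr (hscale_one hh).
apply: eq_card => x; rewrite (scale_idem_imageP hh) //; apply/imsetP/eqP.
  move=> [t]; rewrite (scale_idem_imageP hh) // => /eqP et ->.
  by rewrite -(scaleA hh) e'E -!mulrA sr mulr1 (scaleA hh) et.
move=> ex; exists (rscale s x); last by rewrite -(scaleA hh) rs (hscale_one hh).
rewrite (scale_idem_imageP hh) //; apply/eqP; rewrite -{2}ex -!(scaleA hh) e'E.
by rewrite !mulrA sr mul1r.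
Qed.

Lemma mulmx_cw_m (g : 'M[CC]_#|rho|) r s p q : r * s = 1 -> s * r = 1 ->
  forall x w, (cw_m RR rho s *m g *m cw_m RR rho (p * q)) (enum_rank x) (enum_rank w) =
    g (enum_rank (rscale r x)) (enum_rank (rscale (p * q) w)).
Proof.
move=> rs sr x w; rewrite mulmx_enumE (bigD1 (rscale (p * q) w)) //=.
rewrite op_mxE eqxx mulr1 [X in _ + X]big1 ?addr0; last first.
  by move=> y /negPf yw; rewrite op_mxE yw mulr0.
rewrite mulmx_enumE (bigD1 (rscale r x)) //= op_mxE -(scaleA hh) sr (hscale_one hh).
rewrite eqxx mul1r big1 ?addr0 // => y yx; rewrite op_mxE; case: eqP => [xE|]; last by rewrite mul0r.
by rewrite xE -(scaleA hh) rs (hscale_one hh) eqxx in yx.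
Qed.

(** Up to operators m_q, h depends neither on the idempotent within its conjugacy class nor on the
    choice of u and v. *)
Lemma cw_h_conj e u v e' u' v' r s :
    idem_data e u v -> idem_data e' u' v' ->
    r * s = 1 -> s * r = 1 -> e' = r * e * s ->
  exists2 q : A, is_unit q &
    cw_h RR rho e v = cw_m RR rho s *m cw_h RR rho e' v' *m cw_m RR rho q.
Proof.
move=> he he' rs sr e'E.
have [ee uv vu ve eu] := he; have [ee' uv' vu' ve' eu'] := he'.
have fv := idem_fconjl he; have fv' := idem_fconjl he'.
have er : e' * r = r * e by rewrite e'E -!mulrA sr mulr1.
have se : s * e' = e * s by rewrite e'E !mulrA sr mul1r.
have rsJ : fconj s * fconj r = 1 by rewrite -fconj_mul rs.
have srJ : fconj r * fconj s = 1 by rewrite -fconj_mul sr.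
have feE : fconj e' = fconj s * fconj e * fconj r by rewrite e'E !fconj_mul !mulrA.
(* The discrepancy of the two choices of (u, v), a unit of the corner eRe with inverse [x2]. Adding
   1 - e makes it a unit of R. *)
pose x := s * u' * fconj s * v.
pose x2 := u * fconj r * v' * r.
have ex : e * x = x by rewrite /x !mulrA -se -(mulrA s) eu'.
have xe : x * e = x by rewrite /x -!mulrA ve.
have ex2 : e * x2 = x2 by rewrite /x2 !mulrA eu.
have x2e : x2 * e = x2 by rewrite /x2 -!mulrA -er (mulrA v') ve'.
have vru : v * u * fconj r = fconj r * fconj e'.
  by rewrite vu feE !mulrA srJ mul1r.
have xx2 : x * x2 = e.
  rewrite /x /x2 !mulrA -(mulrA _ v u) -(mulrA _ (v * u)) vru -!mulrA (mulrA (fconj s)) rsJ mul1r.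
  by rewrite (mulrA (fconj e')) fv' (mulrA u') uv' er mulrA sr mul1r.
have x2x : x2 * x = e.
  rewrite /x /x2 -!mulrA (mulrA r s) rs mul1r (mulrA v' u') vu' feE -!mulrA.
  by rewrite (mulrA (fconj r) (fconj s)) srJ mul1r (mulrA (fconj r) (fconj s)) srJ mul1r fv.
pose q0 := x + (1 - e).
have rvx : fconj r * v' * r * x = v.
  rewrite /x -!mulrA (mulrA r s) rs mul1r (mulrA v' u') vu' feE -!mulrA.
  by rewrite (mulrA (fconj r) (fconj s)) srJ mul1r (mulrA (fconj r) (fconj s)) srJ mul1r fv.
have e1e : e * (1 - e) = 0 by rewrite mulrBr mulr1 ee subrr.
have e1e' : (1 - e) * e = 0 by rewrite mulrBl mul1r ee subrr.
have e11 : (1 - e) * (1 - e) = 1 - e by rewrite mulrBl mul1r e1e subr0.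
have key (g t t2 : A) : e * g = 0 -> g * e = 0 -> g * g = g -> e + g = 1 ->
    t * e = t -> e * t2 = t2 -> t * t2 = e -> (t + g) * (t2 + g) = 1.
  move=> eg ge gg eg1 te et2 tt2; rewrite mulrDl !mulrDr tt2 gg -{1}te -mulrA eg.
  by rewrite mulr0 addr0 -{1}et2 mulrA ge mul0r add0r.
have e1 : e + (1 - e) = 1 by rewrite addrC subrK.
have q0u : q0 * (x2 + (1 - e)) = 1 by apply: key.
have uq0 : (x2 + (1 - e)) * q0 = 1 by apply: key.
exists (r * q0).
  exists ((x2 + (1 - e)) * s); split.
    by rewrite mulrA -(mulrA r) q0u mulr1.
  by rewrite mulrA -(mulrA _ s) sr mulr1.
rewrite !cw_hE; apply: matrix_enumP => y w.
rewrite (mulmx_cw_m _ _ _ rs sr) !op_mxE !(kern_h_simpl RR hh) // !mulr1z.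
rewrite -(idem_sqrt_conj ee rs sr e'E); congr (_ * (expQZ RR _ *+ _)).
  rewrite -!(scaleA hh) er (scaleA hh r) (hbeta_adj hh r) -(scaleA hh).
  rewrite (_ : fconj r * (v' * (r * q0)) = v) // /q0 !mulrA mulrDr rvx.
  by rewrite -[_ * r * (1 - e)]mulrA mulrBr mulr1 -er -mulrA mulrBr (mulrA v') ve' subrr mulr0 addr0.
have r1 : (1 - e') * r = r * (1 - e) by rewrite mulrBl mulrBr mul1r mulr1 er.
have q1 : (1 - e') * (r * q0) = r * (1 - e).
  rewrite mulrA r1 -mulrA /q0 mulrDr e11 -{1}ex mulrA e1e' mul0r add0r //.
rewrite -!(scaleA hh) r1 q1 !(scaleA hh r); congr nat_of_bool; apply/idP/idP => [/eqP -> //|/eqP].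
move/(congr1 (rscale s)); by rewrite -!(scaleA hh) ?mulrA sr !mul1r => ->.
Qed.

End ChangeOfIdempotent.

Lemma prod_mulrb (K : comNzRingType) (I : finType) (F : I -> K) (b : I -> bool) :
  \prod_i (F i *+ b i) = (\prod_i F i) *+ [forall i, b i].
Proof.
case: (boolP [forall i, b i]) => [/forallP h|].
  by rewrite mulr1n; apply: eq_bigr => i _; rewrite h mulr1n.
rewrite negb_forall => /existsP [i /negPf bi].
by rewrite mulr0n (bigD1 i) //= bi mulr0n mul0r.
Qed.

Lemma eq_ffun_forall (I : finType) (V : eqType) (x y : {ffun I -> V}) :
  (x == y) = [forall i, x i == y i].
Proof.
apply/eqP/forallP => [-> //|h]; apply/ffunP => i; exact/eqP.
Qed.

Section SumKernels.
Variables (RR : realType) (A : form_data) (rho : rep_data A).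
Hypothesis hh : is_hermitian rho.
Variables (N : nat) (a : 'I_N -> int).
Local Notation E := (expQZ RR).
Local Notation rhoa := (sum_rep rho a).
Implicit Types (x w : {ffun 'I_N -> rho}).

Lemma prod_kern_m r x w :
  \prod_i kern_m RR r (x i) (w i) = kern_m RR r (x : rhoa) (w : rhoa).
Proof.
rewrite /kern_m eq_ffun_forall (eq_bigr (fun i => 1 *+ (x i == rscale r (w i)))) //.
rewrite prod_mulrb big1 //; congr (1 *+ nat_of_bool _).
by apply: eq_forallb => i; rewrite ffunE.
Qed.

Lemma prod_kern_d phi x w :
  \prod_i kern_d RR (a i) phi (x i) (w i) = kern_d RR 1 phi (x : rhoa) (w : rhoa).
Proof. by rewrite /kern_d prod_mulrb -expQZ_sum mulr1z -eq_ffun_forall. Qed.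

Hypothesis hha : is_hermitian rhoa.

Lemma idem_sqrt_sum (e : A) : e * e = e -> idem_sqrt RR rhoa e = idem_sqrt RR rho e ^+ N.
Proof.
move=> ee; rewrite /idem_sqrt -rootCX ?ler0n // -natrX; congr (sqrtC _%:R).
have := @card_ffun_on 'I_N rho (mem (idem_image rho e)); rewrite card_ord => <-.
apply: eq_card => x.
rewrite (scale_idem_imageP hha) // (eq_ffun_forall (rscale e x : {ffun _ -> rho})).
apply/forallP/ffun_onP => h i; have := h i; rewrite ffunE.
  by rewrite (scale_idem_imageP hh).
by rewrite (scale_idem_imageP hh).
Qed.

Lemma prod_kern_h (e v : A) x w : e * e = e ->
  \prod_i kern_h RR (a i) e v (x i) (w i) = kern_h RR 1 e v (x : rhoa) (w : rhoa).
Proof.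
move=> ee; rewrite (kern_h_simpl RR hha) // idem_sqrt_sum // mulr1z.
under eq_bigr do rewrite (kern_h_simpl RR hh) //.
rewrite big_split /= prod_mulrb -expQZ_sum prodr_const card_ord exprVn.
congr (_ * (E _ *+ nat_of_bool _)); first by apply: eq_bigr => i _; rewrite !ffunE.
by rewrite eq_ffun_forall; apply: eq_forallb => i; rewrite !ffunE.
Qed.

End SumKernels.

Section SymmChoice.
Variables (A : form_data) (T : symm_choice A) (hT : is_symm_choice T).

Lemma sreps_idem_data e : sreps T e -> idem_data e (s_u T e) (s_v T e).
Proof.
move=> he; have [ee _] := sreps_symm hT he.
have [r vE] := s_v_corner hT he; have [s uE] := s_u_corner hT he.
split=> //; first exact: (s_uv hT he).
- exact: (s_vu hT he).
- by rewrite vE -!mulrA ee.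
- by rewrite uE !mulrA ee.
Qed.

End SymmChoice.

(** Left multiplication by v maps eR isomorphically onto e^J R, with inverse u. Idempotents built in
    the matrix ring come with such u and v. *)
Lemma idem_data_symmetric (A : form_data) (e u v : A) :
  idem_data e u v -> symmetric_idempotent e.
Proof.
move=> h; have [ee uv vu ve eu] := h; split=> //; exists ( *%R v); split.
- split.
  + move=> _ [x _ <-]; exists (v * x) => //.
    by rewrite mulrA (idem_fconjl h) mulrA ve.
  + move=> x y /set_mem [x' _ <-] /set_mem [y' _ <-] /(congr1 ( *%R u)).
    by rewrite !mulrA !uv !ee.
  + move=> _ [x _ <-]; exists (e * (u * x)); first by exists (u * x).
    by rewrite !mulrA ve vu.
- by move=> x y _ _; rewrite mulrDr.
- by move=> x r _; rewrite mulrA.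
Qed.

Section Lift.
Variables (RR : realType) (A : form_data) (hA : is_form_ring A).
Variables (rho : rep_data A) (hrho : is_rep rho) (m : nat).
Local Notation CC := (RR[i]).
Local Notation E := (expQZ RR).
Local Notation B := (mat_form A m).
Local Notation Vm := (genus_rep rho m).
Implicit Types (r : 'I_m) (c e u v : A) (x w : {ffun 'I_m -> rho}).

Let hh := rep_hermitian hA hrho.
Let hg := genus_hermitian hA hrho m.

Definition lift_kern r (k : rho -> rho -> CC) x w : CC :=
  k (x r) (w r) *+ [forall s, (s != r) ==> (x s == w s)].

(** [emb1] is meant for units, filled up with 1; [emb0] for idempotents with their u and v, filled
    up with 0. Both make an operator act in coordinate r only. *)
Definition emb1 r c : B := (\matrix_(i, j) (if i == j then if i == r then c else 1 else 0) : 'M[A]_m).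
Definition emb0 r c : B := (\matrix_(i, j) (if (i == r) && (j == r) then c else 0) : 'M[A]_m).

Lemma emb1E r c (x : Vm) s :
  (rscale (emb1 r c) x : {ffun _ -> rho}) s =
  if s == r then rscale c ((x : {ffun _ -> rho}) s) else (x : {ffun _ -> rho}) s.
Proof.
rewrite ffunE (bigD1 s) //= mxE eqxx big1 ?addr0.
  by case: ifP => // _; rewrite (hscale_one hh).
by move=> j js; rewrite mxE eq_sym (negPf js) (scale0l hh).
Qed.

Lemma emb0E r c (x : Vm) s :
  (rscale (emb0 r c) x : {ffun _ -> rho}) s =
  if s == r then rscale c ((x : {ffun _ -> rho}) r) else 0.
Proof.
rewrite ffunE; case: eqP => [->|/eqP sr].
  rewrite (bigD1 r) //= mxE !eqxx big1 ?addr0 // => j /negPf jr.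
  by rewrite mxE jr andbF (scale0l hh).
by apply: big1 => j _; rewrite mxE (negPf sr) (scale0l hh).
Qed.

Lemma emb1M r c c' : emb1 r c * emb1 r c' = emb1 r (c * c').
Proof.
apply/matrixP => i j; rewrite !mxE (bigD1 i) //= !mxE eqxx big1 ?addr0.
  by case: (i == j); case: (i == r); rewrite ?mulr1 ?mulr0.
by move=> k ki; rewrite !mxE eq_sym (negPf ki) mul0r.
Qed.

Lemma emb11 r : emb1 r 1 = 1.
Proof. by apply/matrixP => i j; rewrite !mxE if_same; case: (i == j). Qed.

Lemma emb0M r c c' : emb0 r c * emb0 r c' = emb0 r (c * c').
Proof.
apply/matrixP => i j; rewrite !mxE (bigD1 r) //= !mxE eqxx big1 ?addr0.
  by case: (i == r); case: (j == r); rewrite /= ?mulr0 ?mul0r.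
by move=> k /negPf ki; rewrite !mxE ki andbF mul0r.
Qed.

Lemma fconj_emb0 r c : fconj (emb0 r c) = emb0 r (fconj c).
Proof.
rewrite (mat_fconjE hA); apply/matrixP => i j; rewrite !mxE andbC.
by case: ifP => //; rewrite (fconj0 hA).
Qed.

Lemma emb0_idem_data r e u v : idem_data e u v ->
  idem_data (emb0 r e) (emb0 r u) (emb0 r v).
Proof. by case=> ee uv vu ve eu; split; rewrite !(emb0M, fconj_emb0) ?ee ?uv ?vu ?ve ?eu. Qed.

Lemma emb1_unit r c : is_unit c -> is_unit (emb1 r c).
Proof. by case=> s [cs sc]; exists (emb1 r s); rewrite !emb1M cs sc emb11. Qed.

Lemma eq_forall_but r (P : pred 'I_m) :
  [forall s, P s] = P r && [forall s, (s != r) ==> P s].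
Proof.
apply/forallP/andP => [h|[h /forallP h'] s]; first by split=> //; apply/forallP => s; rewrite h implybT.
by case: (eqVneq s r) (h' s) => [->|].
Qed.

Lemma lift_kern_m r c (x w : Vm) :
  lift_kern r (kern_m RR c) x w = kern_m RR (emb1 r c) x w.
Proof.
rewrite /lift_kern /kern_m (eq_ffun_forall (x : {ffun _ -> rho})).
rewrite [in RHS](eq_forall_but r) /= emb1E eqxx -mulrnA mulnb; congr (1 *+ nat_of_bool (_ && _)).
by apply: eq_forallb => s; rewrite emb1E; case: (s == r).
Qed.

Definition diag_quad r (phi : fquad A) : fquad B :=
  ([ffun i => if i == r then phi else 0], [ffun=> 0]).

Lemma lift_kern_d r phi (x w : Vm) :
  lift_kern r (kern_d RR 1 phi) x w = kern_d RR 1 (diag_quad r phi) x w.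
Proof.
rewrite /lift_kern /kern_d (eq_ffun_forall (x : {ffun _ -> rho})).
rewrite [in RHS](eq_forall_but r) /= -mulrnA mulnb !mulr1z.
case: (boolP (_ && _)) => [_|]; last by rewrite !mulr0n.
rewrite !mulr1n; congr E; rewrite [X in _ = _ + X]big1 ?addr0; last first.
  by move=> p _; rewrite ffunE (rbil0 hrho).
rewrite (bigD1 r) //= ffunE eqxx big1 ?addr0 // => i ir.
by rewrite ffunE (negPf ir) (rquad0 hrho).
Qed.

Definition off_quad (p : upper_idx m) (mm : fmod A) : fquad B :=
  ([ffun=> 0], [ffun p' => if p' == p then mm else 0]).

Definition kern_q (b : int) (p : upper_idx m) (mm : fmod A) (x w : Vm) : CC :=
  E (rbil mm ((w : {ffun _ -> rho}) (val p).1) ((w : {ffun _ -> rho}) (val p).2) *~ b)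
    *+ (x == w).

Lemma kern_qE p mm (x w : Vm) : kern_q 1 p mm x w = kern_d RR 1 (off_quad p mm) x w.
Proof.
rewrite /kern_q /kern_d !mulr1z; congr (E _ *+ _).
rewrite /= big1 ?add0r; last by move=> i _; rewrite ffunE (rquad0 hrho).
rewrite (bigD1 p) //= ffunE eqxx big1 ?addr0 // => i ir.
by rewrite ffunE (negPf ir) (rbil0 hrho).
Qed.

Lemma idem_sqrt_emb0 r e : e * e = e -> idem_sqrt RR Vm (emb0 r e) = idem_sqrt RR rho e.
Proof.
move=> ee; rewrite /idem_sqrt; congr (sqrtC _%:R).
pose f (t : rho) : {ffun 'I_m -> rho} := [ffun s => if s == r then t else 0].
rewrite -(card_imset (idem_image rho e) (f := f)); last first.
  by move=> x y /(congr1 (fun g : {ffun _ -> rho} => g r)); rewrite !ffunE eqxx.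
apply: eq_card => x; rewrite (scale_idem_imageP hg) ?emb0M ?ee //.
rewrite (eq_ffun_forall (rscale _ x : {ffun _ -> rho})); apply/forallP/imsetP.
  move=> h; exists ((x : {ffun _ -> rho}) r).
    by rewrite (scale_idem_imageP hh) //; have := h r; rewrite emb0E eqxx.
  apply/ffunP => s; rewrite ffunE; have := h s; rewrite emb0E.
  by case: (eqVneq s r) => [-> //|_ /eqP <-].
move=> [t]; rewrite (scale_idem_imageP hh) // => /eqP et -> s.
by rewrite emb0E !ffunE eqxx et.
Qed.

Lemma lift_kern_h r e v (x w : Vm) : e * e = e ->
  lift_kern r (kern_h RR 1 e v) x w = kern_h RR 1 (emb0 r e) (emb0 r v) x w.
Proof.
move=> ee; rewrite /lift_kern (kern_h_simpl RR hg) ?emb0M ?ee // idem_sqrt_emb0 //.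
rewrite (kern_h_simpl RR hh) // -mulrnAr -mulrnA mulnb !mulr1z.
congr (_ * (E _ *+ nat_of_bool _)).
  rewrite (genus_betaE hA hrho) (bigD1 r) //= !emb0E eqxx big1 ?addr0 // => s sr.
  by rewrite emb0E (negPf sr) (beta0l hh).
have subE (y z : {ffun 'I_m -> rho}) s : (y - z) s = y s - z s by rewrite !ffunE.
have cE (z : Vm) s : (rscale (1 - emb0 r e) z : {ffun _ -> rho}) s =
    if s == r then rscale (1 - e) ((z : {ffun _ -> rho}) r) else (z : {ffun _ -> rho}) s.
  rewrite (scale1B hg) subE emb0E; case: eqP => [->|_]; last by rewrite subr0.
  by rewrite (scale1B hh).
rewrite (eq_ffun_forall (rscale _ x : {ffun _ -> rho})) [in RHS](eq_forall_but r).
cbv beta; rewrite !cE eqxx; congr (_ && _).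
by apply: eq_forallb => s; rewrite !cE; case: (s == r).
Qed.

Variables (T : symm_choice A).

(* The matrices at b = 1 turn out to generate C_m(rho) even as a monoid.  The
   argument b raises the roots of unity occurring in them to the b-th power;
   up to the sign epsilon this is the action of gamma_b. *)
Inductive descent_generator : (int -> Vm -> Vm -> CC) -> Prop :=
| DescentM r c of is_unit c : descent_generator (fun b => lift_kern r (kern_m RR c))
| DescentD r phi : descent_generator (fun b => lift_kern r (kern_d RR b phi))
| DescentH r e of sreps T e :
    descent_generator (fun b => lift_kern r (kern_h RR b e (s_v T e)))
| DescentQ p mm : descent_generator (fun b => kern_q b p mm).

Variable (Tm : symm_choice B).
Hypotheses (hT : is_symm_choice T) (hTm : is_symm_choice Tm).

Lemma descent_generator_cw k : descent_generator k ->
  clifford_weil RR Tm Vm (op_mx (k 1)).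
Proof.
case=> [r c uc|r phi|r e he|p mm].
- apply: GenIn; left; left; exists (emb1 r c); first exact: emb1_unit.
  by rewrite cw_mE; apply: eq_op_mx => x w; exact: lift_kern_m.
- apply: GenIn; left; right; exists (diag_quad r phi).
  by rewrite cw_dE; apply: eq_op_mx => x w; exact: lift_kern_d.
- have hi := sreps_idem_data hT he; have [ee _ _ _ _] := hi.
  have hi0 := emb0_idem_data r hi.
  (* The embedded idempotent is merely conjugate to a representative chosen in [Tm]; [cw_h_conj]
     absorbs the difference into units. *)
  have [e' [[he' [s [t [st ts e'E]]]] _]] := sreps_transversal hTm (idem_data_symmetric hi0).
  have hi' := sreps_idem_data hTm he'.
  have [q uq hq] := cw_h_conj RR hg (mat_fconjM hA (m := m)) (mat_fconj1 hA m) hi0 hi' st ts e'E.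
  rewrite (_ : op_mx _ = cw_h RR Vm (emb0 r e) (emb0 r (s_v T e))); last first.
    by rewrite cw_hE; apply: eq_op_mx => x w; apply: lift_kern_h.
  rewrite hq; apply: GenMul; last by apply: GenIn; left; left; exists q.
  apply: GenMul; last by apply: GenIn; right; exists e'.
  by apply: GenIn; left; left; exists t => //; exists s.
- apply: GenIn; left; right; exists (off_quad p mm).
  by rewrite cw_dE; apply: eq_op_mx => x w; exact: kern_qE.
Qed.

Lemma descent_generator_heis k : descent_generator k ->
  heis_normal (conductor rho) (k 1).
Proof.
have ext (k1 k2 : Vm -> Vm -> CC) : (forall x w, k1 x w = k2 x w) -> heis_normal (conductor rho) k2 ->
    @heis_normal RR _ Vm (conductor rho) k1.
  by move=> e12; have -> // : k1 = k2; apply/funext => x; apply/funext => w.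
have bt := @genus_beta_torsion _ hA _ hrho m RR.
case=> [r c [s [cs sc]]|r phi|r e he|p mm].
- apply: (ext _ _ (lift_kern_m r c)); apply: (@heis_kern_m _ _ _ hg _ (emb1 r c) (emb1 r s)).
    by rewrite emb1M cs emb11.
  by rewrite emb1M sc emb11.
- apply: (ext _ _ (lift_kern_d r phi)).
  apply: (@heis_kern_d RR _ Vm hg (conductor rho) (diag_quad r phi)).
    exact: genus_quadratic.
  exact: genus_quad_torsion.
- have hi := sreps_idem_data hT he; have [ee _ _ _ _] := hi.
  apply: (ext _ _ (fun x w => lift_kern_h r (s_v T e) x w ee)).
  exact: (@heis_kern_h RR _ Vm hg _ bt _ _ _ (emb0_idem_data r hi)).
- apply: (ext _ _ (kern_qE p mm)).
  apply: (@heis_kern_d RR _ Vm hg (conductor rho) (off_quad p mm)).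
    exact: genus_quadratic.
  exact: genus_quad_torsion.
Qed.

End Lift.

(** * Invariant tensors *)

Section TensorAction.
Variables (K : comPzRingType) (V : finType) (N : nat).
Local Notation X := {ffun 'I_N -> V}.

Definition tact (g : 'I_N -> 'M[K]_#|V|) (t : X -> K) (u : X) : K :=
  \sum_(w : X) (\prod_i g i (enum_rank (u i)) (enum_rank (w i))) * t w.

Lemma tact_mul (g h : 'I_N -> 'M[K]_#|V|) (t : X -> K) u :
  tact (fun i => g i *m h i) t u = tact g (tact h t) u.
Proof.
rewrite /tact; under [RHS]eq_bigr do rewrite mulr_sumr.
rewrite exchange_big /=; apply: eq_bigr => w _.
under [RHS]eq_bigr do rewrite mulrA -big_split /=.
rewrite -mulr_suml; congr (_ * _).
under eq_bigr do rewrite mulmx_enumE.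
by rewrite bigA_distr_bigA.
Qed.

Lemma tact1 (t : X -> K) u : tact (fun=> 1%:M) t u = t u.
Proof.
rewrite /tact (bigD1 u) //= big1 ?mul1r => [|i _]; last by rewrite mxE eqxx.
rewrite big1 ?addr0 // => w /eqP wu.
suff [i ui] : exists i, u i != w i.
  by rewrite (bigD1 i) //= mxE (inj_eq enum_rank_inj) (negPf ui) !mul0r.
apply/existsP; apply: contra_notT wu; rewrite negb_exists => /forallP h.
by apply/ffunP => i; apply/eqP; rewrite eq_sym -[_ == _]negbK.
Qed.

Lemma eq_tact (g : 'I_N -> 'M[K]_#|V|) (t t' : X -> K) u :
  t =1 t' -> tact g t u = tact g t' u.
Proof. by move=> e; apply: eq_bigr => w _; rewrite e. Qed.

Lemma tact_opmx (k : 'I_N -> V -> V -> K) (t : X -> K) u :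
  tact (fun i => op_mx (k i)) t u = \sum_(w : X) (\prod_i k i (u i) (w i)) * t w.
Proof. by apply: eq_bigr => w _; congr (_ * _); apply: eq_bigr => i _; rewrite op_mxE. Qed.

End TensorAction.

Section PowerCoordinates.
Variable V : finZmodType.

Fixpoint pw_nth (m : nat) : pw V m -> nat -> V :=
  match m return pw V m -> nat -> V with
  | 0%N => fun v k => if k is _.+1 then 0 else v
  | m'.+1 => fun v k => if k is k'.+1 then pw_nth v.2 k' else v.1
  end.

Fixpoint pw_of (m : nat) (g : nat -> V) : pw V m :=
  match m return pw V m with
  | 0%N => g 0%N
  | m'.+1 => (g 0%N, pw_of m' (fun k => g k.+1))
  end.

Lemma pw_nth_of m g k : (k <= m)%N -> pw_nth (pw_of m g) k = g k.
Proof. by elim: m g k => [|m IH] g [|k] //= km; rewrite IH. Qed.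

Lemma pinP m (C : {set V}) (v : pw V m) :
  reflect (forall k, (k <= m)%N -> pw_nth v k \in C) (pin C v).
Proof.
elim: m v => [|m IH] v /=.
  by apply: (iffP idP) => [vC [|k] //|/(_ 0%N isT)].
apply: (iffP andP) => [[v1 /IH v2] [|k] //|h]; first exact: v2.
by split; [exact: (h 0%N)|apply/IH => k km; exact: (h k.+1)].
Qed.

Definition upd (g : nat -> V) (k : nat) (w : V) : nat -> V :=
  fun j => if j == k then w else g j.

End PowerCoordinates.

Section SlicewiseIntro.
Variables (RR : realType) (A : form_data) (rho : rep_data A).
Local Notation CC := (RR[i]).

(** With Y defined on infinite sequences, fixing the first coordinate is a shift of the argument,
    and the induction needs no change of index type. *)
Lemma slicewise_intro m (Y : (nat -> rho) -> CC) :
  (forall k g, (k <= m)%N -> U1 (fun w => Y (upd g k w))) ->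
  (forall k l g, (k <= m)%N -> (l <= m)%N -> k != l -> Y g != 0 ->
     g l \in dual_code (cyc (g k))) ->
  slicewise (fun v : pw rho m => Y (pw_nth v)).
Proof.
elim: m Y => [|m IH] Y h1 h2.
  apply: eq_code_span (h1 0%N (fun=> 0) isT) => w; congr Y.
  by apply/funext; case.
pose cons (w : rho) (g : nat -> rho) k := if k is k'.+1 then g k' else w.
split.
- move=> v; apply: eq_code_span (h1 0%N (cons 0 (pw_nth v)) isT) => w; congr Y.
  by apply/funext; case.
- move=> w; have -> : (fun v : pw rho m => Y (pw_nth ((w, v) : pw rho m.+1))) =
      (fun v => Y (cons w (pw_nth v))).
    by apply/funext => v; congr Y; apply/funext; case.
  apply: (IH (fun g => Y (cons w g))) => [k g km|k l g km lm kl nz].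
    apply: eq_code_span (h1 k.+1 (cons w g) km) => w'; congr Y.
    by apply/funext; case.
  exact: (h2 k.+1 l.+1 (cons w g)).
- move=> w v nz; apply/pinP => k km.
  have := h2 0%N k.+1 (pw_nth ((w, v) : pw rho m.+1)) isT km isT; exact.
Qed.

End SlicewiseIntro.

Section DescentInvariants.
Variables (RR : realType) (A : form_data) (hA : is_form_ring A).
Variables (T : symm_choice A) (hT : is_symm_choice T).
Hypothesis hwecA : weight_enumerator_conjecture RR T.
Variables (rho : rep_data A) (hrho : is_rep rho).
Variables (N : nat) (a : 'I_N -> int).
Hypothesis ha : forall i, coprimez (a i) (conductor rho)%:Z.
Variable m : nat.
Local Notation CC := (RR[i]).
Local Notation E := (expQZ RR).
Local Notation rhoa := (sum_rep rho a).
Local Notation Vm := (genus_rep rho m.+1).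
Local Notation X := {ffun 'I_N -> Vm}.
Implicit Types (x y : X) (r s : 'I_m.+1).

Let hh := rep_hermitian hA hrho.
Let hrhoa : is_rep rhoa := sum_rep_is_rep RR hA hrho ha.
Let hha := rep_hermitian hA hrhoa.

Definition row_of r x : rhoa := [ffun i => (x i : {ffun _ -> rho}) r].
Definition set_row r x (w : rhoa) : X :=
  [ffun i => [ffun s => if s == r then (w : {ffun _ -> rho}) i else (x i : {ffun _ -> rho}) s]].
Definition all_rows (C : {set rhoa}) x := [forall r, row_of r x \in C].

Lemma row_set_row r s x w : row_of s (set_row r x w) = if s == r then w else row_of s x.
Proof. by apply/ffunP => i; rewrite !ffunE; case: (s == r); rewrite ?ffunE. Qed.

Lemma set_row_id r x : set_row r x (row_of r x) = x.
Proof. by apply/ffunP => i; apply/ffunP => s; rewrite !ffunE; case: eqP => [->|]. Qed.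

Lemma tact_lift r (k : 'I_N -> rho -> rho -> CC) (y : X -> CC) x (w0 : rhoa) :
  tact (fun i => op_mx (lift_kern r (k i))) y (set_row r x w0) =
  \sum_(w : rhoa) (\prod_i k i ((w0 : {ffun _ -> rho}) i) ((w : {ffun _ -> rho}) i)) *
     y (set_row r x w).
Proof.
rewrite tact_opmx; pose P (w : X) := set_row r x (row_of r w) == w.
transitivity (\sum_(w | P w) (\prod_i k i ((w0 : {ffun _ -> rho}) i) ((w i : {ffun _ -> rho}) r)) * y w).
  rewrite [RHS]big_mkcond /=; apply: eq_bigr => w _.
  rewrite prod_mulrb; have -> : [forall i, [forall s, (s != r) ==>
      ((set_row r x w0 i : {ffun _ -> rho}) s == (w i : {ffun _ -> rho}) s)]] = P w.
    apply/forallP/eqP => [h|<- i].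
      apply/ffunP => i; apply/ffunP => s; rewrite !ffunE.
      have /forallP/(_ s) := h i; rewrite !ffunE; case: eqP => [-> //|_] /= /eqP -> //.
    by apply/forallP => s; apply/implyP => sr; rewrite !ffunE (negPf sr).
  case: (P w); rewrite ?mulr1n ?mulr0n ?mul0r //; congr (_ * _).
  by apply: eq_bigr => i _; rewrite !ffunE eqxx.
rewrite (reindex_onto (set_row r x) (row_of r)) /=; last by move=> w /eqP.
apply: eq_big => [w|w _]; first by rewrite /P row_set_row eqxx !eqxx.
by congr (_ * _); apply: eq_bigr => i _; rewrite !ffunE eqxx.
Qed.

Lemma gen_group_fix (S : set 'M[CC]_#|rhoa|) (c : 'cV[CC]_#|rhoa|) g :
  (forall g, S g -> g *m c = c) -> gen_group S g -> g *m c = c.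
Proof.
move=> hS; elim=> [h /hS //||h h' _ e _ e'|h _ e]; first by rewrite mul1mx.
  by rewrite -mulmxA e'.
have [uh|uh] := boolP (h \in unitmx); first by rewrite -{1}e mulKmx.
(* By convention [invmx] returns a singular matrix unchanged. *)
by rewrite /invmx (negPf uh).
Qed.

Lemma op_mx_col (k : rhoa -> rhoa -> CC) (f : rhoa -> CC) :
  (forall u, \sum_w k u w * f w = f u) ->
  op_mx k *m (\col_i f (enum_val i)) = \col_i f (enum_val i).
Proof.
move=> h; apply/matrixP => i j; rewrite !mxE -h sum_enum_rank.
by apply: eq_bigr => w _; rewrite !mxE enum_rankK.
Qed.

(** The conjecture enters here, applied to rho^a, which is a representation of the same form ring;
    it turns invariance under the generators into membership in the span. *)
Lemma fixed_U1 (f : rhoa -> CC) :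
  (forall c : A, is_unit c -> forall u, \sum_w kern_m RR c u w * f w = f u) ->
  (forall phi, forall u, \sum_w kern_d RR 1 phi u w * f w = f u) ->
  (forall e, sreps T e -> forall u, \sum_w kern_h RR 1 e (s_v T e) u w * f w = f u) ->
  U1 f.
Proof.
move=> hm hd hhh; pose c : 'cV[CC]_#|rhoa| := \col_i f (enum_val i).
have : [set x : 'cV[RR[i]]_#|rhoa| |
     forall g, clifford_weil RR T rhoa g -> g *m x = x] c.
  move=> g; apply: gen_group_fix => _ [[[s us ->]|[phi ->]]|[e he ->]].
  - by rewrite cw_mE; apply: op_mx_col; apply: hm.
  - by rewrite cw_dE; apply: op_mx_col; apply: hd.
  - by rewrite cw_hE; apply: op_mx_col; apply: hhh.
rewrite (hwecA hrhoa) => -[n [d [z [hz cE]]]].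
apply: (@eq_code_span _ _ _ _ _ _ (fun w => \sum_i d i * (z i (enum_rank w) 0))).
  move=> w; have := congr1 (fun M : 'cV_#|rhoa| => M (enum_rank w) 0) cE.
  by rewrite mxE enum_rankK => ->; rewrite summxE; apply: eq_bigr => i _; rewrite mxE.
apply: code_span_sum => i _; have [C tC ->] := hz i.
apply: eq_code_span (code_span_type RR (@in_code _ _) tC) => w.
rewrite /fwe summxE (eq_bigr (fun v => (v == w)%:R)); last first.
  by move=> v _; rewrite mxE andbT (inj_eq enum_rank_inj) eq_sym.
rewrite /in_code; case: (boolP (w \in C)) => wC.
  by rewrite (bigD1 w) //= eqxx big1 ?addr0 // => v /andP[_ /negPf ->].
by apply: big1 => v vC; case: eqP => // vw; rewrite -vw vC in wC.
Qed.

Lemma U1_fixed C : type_code C ->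
  [/\ forall c : A, is_unit c -> forall u : rhoa,
        \sum_w kern_m RR c u w * (w \in C)%:R = (u \in C)%:R,
      forall phi (u : rhoa), \sum_w kern_d RR 1 phi u w * (w \in C)%:R = (u \in C)%:R
    & forall e, sreps T e -> forall u : rhoa,
        \sum_w kern_h RR 1 e (s_v T e) u w * (w \in C)%:R = (u \in C)%:R].
Proof.
move=> tC; have fwE (w : rhoa) j : fwe RR C (enum_rank w) j = (w \in C)%:R.
  rewrite /fwe summxE (eq_bigr (fun v => (v == w)%:R)); last first.
    by move=> v _; rewrite mxE ord1 andbT (inj_eq enum_rank_inj) eq_sym.
  case: (boolP (w \in C)) => wC.
    by rewrite (bigD1 w) //= eqxx big1 ?addr0 // => v /andP[_ /negPf ->].
  by apply: big1 => v vC; case: eqP => // vw; rewrite -vw vC in wC.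
have fixed : forall g, clifford_weil RR T rhoa g -> g *m fwe RR C = fwe RR C.
  suff : [set x : 'cV[RR[i]]_#|rhoa| |
     forall g, clifford_weil RR T rhoa g -> g *m x = x] (fwe RR C) by [].
  rewrite (hwecA hrhoa); exists 1%N, (fun=> 1), (fun=> fwe RR C); split.
    by move=> _; exists C.
  by rewrite big_ord1 scale1r.
have key k (u : rhoa) : clifford_weil RR T rhoa (op_mx k) ->
    \sum_w k u w * (w \in C)%:R = (u \in C)%:R.
  move=> /fixed /(congr1 (fun M : 'cV_#|rhoa| => M (enum_rank u) 0)).
  rewrite fwE => <-; rewrite mxE sum_enum_rank; apply: eq_bigr => w _.
  by rewrite op_mxE fwE.
split.
- by move=> c uc u; apply: key; rewrite -cw_mE; apply: GenIn; left; left; exists c.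
- by move=> phi u; apply: key; rewrite -cw_dE; apply: GenIn; left; right; exists phi.
- by move=> e he u; apply: key; rewrite -cw_hE; apply: GenIn; right; exists e.
Qed.

Definition descent_fixed (y : X -> CC) := forall k,
  @descent_generator RR A rho m.+1 T k ->
  forall u, tact (fun i => op_mx (k (a i))) y u = y u.

Lemma tact_kern_q (y : X -> CC) (p : upper_idx m.+1) mm u :
  tact (fun i => op_mx (kern_q RR (a i) p mm)) y u =
  E (rbil mm (row_of (val p).1 u) (row_of (val p).2 u)) * y u.
Proof.
rewrite tact_opmx (bigD1 u) //= [X in _ + X]big1 ?addr0.
  congr (_ * _); rewrite /kern_q prod_mulrb -expQZ_sum.
  have -> : [forall i, u i == u i] by apply/forallP => i.
  by rewrite mulr1n; congr E; apply: eq_bigr => i _; rewrite !ffunE.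
move=> w wu; rewrite /kern_q prod_mulrb -eq_ffun_forall eq_sym (negPf wu).
by rewrite mulr0n mul0r.
Qed.

Lemma descent_fixed_span (y : X -> CC) : descent_fixed y -> code_span all_rows y.
Proof.
move=> hy.
have slice r x : U1 (fun w => y (set_row r x w)).
  have lifted (k : int -> rho -> rho -> CC) (ka : rhoa -> rhoa -> CC) :
      @descent_generator RR A rho m.+1 T (fun b => lift_kern r (k b)) ->
      (forall u w : rhoa, \prod_i k (a i) ((u : {ffun _ -> rho}) i) ((w : {ffun _ -> rho}) i) = ka u w) ->
      forall u, \sum_w ka u w * y (set_row r x w) = y (set_row r x u).
    move=> hk kE u; rewrite -[RHS](hy _ hk) tact_lift.
    by apply: eq_bigr => w _; rewrite kE.
  apply: fixed_U1 => [c uc|phi|e he].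
  - apply: (lifted (fun=> kern_m RR c)); first exact: DescentM.
    by move=> u w; apply: prod_kern_m.
  - apply: (lifted (fun b => kern_d RR b phi)); first exact: DescentD.
    by move=> u w; apply: prod_kern_d.
  - apply: (lifted (fun b => kern_h RR b e (s_v T e))); first exact: DescentH.
    have [ee _ _ _ _] := sreps_idem_data hT he.
    by move=> u w; apply: prod_kern_h.
have supp0 (p : upper_idx m.+1) mm x : y x != 0 -> rbil mm (row_of (val p).1 x) (row_of (val p).2 x) = 0.
  move=> nz; apply: (@expQZ_eq1 RR); apply: (mulIf nz).
  by rewrite mul1r -[RHS](hy _ (@DescentQ RR A rho m.+1 T p mm)) tact_kern_q.
have supp r s x : r != s -> y x != 0 -> row_of s x \in dual_code (cyc (row_of r x)).
  move=> rs nz; apply/dualP => _ /cycP [c ->]; rewrite -(rbil_psi hA hrhoa).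
  case: (ltngtP r s) => [lt|lt|eq]; last by case/eqP: rs; apply: val_inj.
    (* Only entries above the diagonal are available, so for r < s the form is read with its
       arguments exchanged, by means of tau. *)
    have h : rbil (ftau (fpsi c)) (row_of r x) (row_of s x) = 0.
      exact: (supp0 (exist _ (r, s) lt) (ftau (fpsi c)) x nz).
    by rewrite -(rbil_tau hrhoa).
  exact: (supp0 (exist _ (s, r) lt) (fpsi c) x nz).
pose toX (g : nat -> rhoa) : X := [ffun i => [ffun s : 'I_m.+1 => (g s : {ffun _ -> rho}) i]].
have row_toX g s : row_of s (toX g) = g s by apply/ffunP => i; rewrite !ffunE.
have sl : slicewise (fun v : pw rhoa m => y (toX (pw_nth v))).
  apply: (@slicewise_intro _ _ _ m (fun g => y (toX g))).
    move=> k g km; apply: eq_code_span (slice (inord k) (toX g)) => w; congr y.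
    apply/ffunP => i; apply/ffunP => s; rewrite !ffunE /upd.
    by rewrite -val_eqE /= inordK //; case: eqP.
  move=> k l g km lm kl nz.
  have := @supp (inord k) (inord l) (toX g); rewrite !row_toX !inordK //; apply => //.
  by rewrite -val_eqE /= !inordK.
have [c hc] := genus_descent hA hrhoa sl.
exists c => x; pose g k := row_of (inord k) x.
have xE : toX (pw_nth (pw_of m g)) = x.
  apply/ffunP => i; apply/ffunP => s; rewrite !ffunE pw_nth_of; last by rewrite -ltnS.
  by rewrite ffunE inord_val.
rewrite -{1}xE hc; apply: eq_bigr => C _; congr (_ *+ nat_of_bool _).
apply/pinP/forallP => [h s|h k km]; last by rewrite pw_nth_of // /g; apply: h.
by have := h s; rewrite pw_nth_of -1?ltnS // /g inord_val; apply.
Qed.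

Lemma type_descent_fixed C : type_code C -> descent_fixed (fun x => (all_rows C x)%:R).
Proof.
move=> tC; have [fm fd fh] := U1_fixed tC.
have lifted r (k : int -> rho -> rho -> CC) (ka : rhoa -> rhoa -> CC) u :
    (forall u w : rhoa, \prod_i k (a i) ((u : {ffun _ -> rho}) i) ((w : {ffun _ -> rho}) i) = ka u w) ->
    (forall u, \sum_w ka u w * (w \in C)%:R = (u \in C)%:R) ->
    tact (fun i => op_mx (lift_kern r (k (a i)))) (fun x => (all_rows C x)%:R) u =
    (all_rows C u)%:R.
  move=> kE kC; rewrite -{1}(set_row_id r u) tact_lift.
  have rE w : all_rows C (set_row r u w) =
      (w \in C) && [forall s, (s != r) ==> (row_of s u \in C)].
    rewrite /all_rows (eq_forall_but r) row_set_row eqxx; congr (_ && _).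
    by apply: eq_forallb => s; rewrite row_set_row; case: (s == r).
  under eq_bigr do rewrite kE rE -mulnb natrM mulrA.
  rewrite -mulr_suml kC -natrM mulnb; congr (nat_of_bool _)%:R.
  by rewrite /all_rows [in RHS](eq_forall_but r).
move=> k [r c uc|r phi|r e he|p mm] u.
- apply: (lifted r (fun=> kern_m RR c) _ u); last exact: (fm c uc).
  by move=> u' w; apply: prod_kern_m.
- apply: (lifted r (fun b => kern_d RR b phi) _ u); last exact: (fd phi).
  by move=> u' w; apply: prod_kern_d.
- have [ee _ _ _ _] := sreps_idem_data hT he.
  apply: (lifted r (fun b => kern_h RR b e (s_v T e)) _ u); last exact: (fh e he).
  by move=> u' w; apply: prod_kern_h.
rewrite tact_kern_q; case: (boolP (all_rows C u)) => [/forallP uC|_]; last by rewrite mulr0.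
rewrite mulr1 (rbilE hA hrhoa) (_ : rbeta _ _ = 0) ?expQZ0 //.
have := uC (val p).1; rewrite -{1}(type_dual tC) => /dualP; apply.
by apply: codeZ; [exact: type_is_code|exact: uC].
Qed.

End DescentInvariants.

(** * Generation of the Clifford-Weil group *)

Section UnitOperators.
Variables (RR : realType) (A : form_data) (rho : rep_data A).
Hypothesis hh : is_hermitian rho.
Local Notation CC := (RR[i]).
Local Notation E := (expQZ RR).
Implicit Types (e u v r s : A) (w x y z : rho).

Lemma mulmx_op_mx (k k' : rho -> rho -> CC) :
  (forall z w, \sum_x k z x * k' x w = (z == w)%:R) -> op_mx k' \in unitmx.
Proof.
move=> h; suff e : op_mx k *m op_mx k' = 1%:M by case/mulmx1_unit: e.
apply: matrix_enumP => z w; rewrite mulmx_enumE mxE (inj_eq enum_rank_inj) -h.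
by apply: eq_bigr => x _; rewrite !op_mxE.
Qed.

Lemma cw_m_unit r : is_unit r -> cw_m RR rho r \in unitmx.
Proof.
case=> s [rs sr]; apply: (mulmx_op_mx (k := fun z x => (z == rscale s x)%:R)) => z w.
rewrite (bigD1 (rscale r w)) //= eqxx mulr1 big1 ?addr0; last first.
  by move=> x /negPf ->; rewrite mulr0.
by rewrite -(scaleA hh) sr (hscale_one hh).
Qed.

Lemma cw_d_unit phi : cw_d RR rho phi \in unitmx.
Proof.
apply: (mulmx_op_mx (k := fun z x => (E (rquad phi z))^-1 *+ (z == x))) => z w.
rewrite (bigD1 w) //= eqxx mulr1n big1 ?addr0; last first.
  by move=> x /negPf ->; rewrite mulr0n mulr0.
have [->|_] := eqVneq z w; last by rewrite mulr0n mul0r.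
by rewrite mulr1n mulVf // expQZ_neq0.
Qed.

Lemma cw_h_unit e u v : idem_data e u v -> cw_h RR rho e v \in unitmx.
Proof.
move=> huv; have [ee uv vu ve eu] := huv; rewrite cw_hE.
have fv := idem_fconjl huv.
have e11 : (1 - e) * (1 - e) = 1 - e by rewrite mulrBl mul1r mulrBr mulr1 ee subrr subr0.
have e1e : e * (1 - e) = 0 by rewrite mulrBr mulr1 ee subrr.
pose g := rscale (1 - e) : rho -> rho.
(* The inverse is the conjugate transpose. *)
apply: (mulmx_op_mx (k := fun z x => (idem_sqrt RR rho e)^-1 *
  (E (- rbeta (rscale e x) (rscale v z)) *+ (g x == g z)))) => z w.
have [gzw|zw] := eqVneq (g z) (g w); last first.
  rewrite big1; first by case: eqP => // zw'; rewrite zw' eqxx in zw.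
  move=> x _; rewrite (kern_h_simpl RR hh) // -/(g x) -/(g w).
  have [->|] := eqVneq (g x) (g z); last by rewrite mulr0n mulr0 mul0r.
  by rewrite (negPf zw) mulr0n !mulr0.
rewrite (_ : \sum_x _ = (idem_sqrt RR rho e)^-1 ^+ 2 *
    \sum_(t in idem_image rho e) E (rbeta t (rscale v (w - z)))); last first.
  rewrite mulr_sumr (reindex_inj (addIr (g z))) /= [RHS]big_mkcond /=.
  apply: eq_bigr => t _; rewrite (kern_h_simpl RR hh) // -/(g _) -/(g w) -gzw !mulr1z.
  have gt : (g (t + g z) == g z) = (t \in idem_image rho e).
    rewrite /g (scaleDr hh) -(scaleA hh) e11 -{2}[rscale (1 - e) z]add0r.
    by rewrite (inj_eq (addIr _)) (scale1B hh) subr_eq0 (scale_idem_imageP hh) // eq_sym.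
  rewrite gt; case: ifP => tI; last by rewrite mulr0n mulr0 mul0r.
  have et : rscale e (t + g z) = t.
    rewrite (scaleDr hh) -(scaleA hh) e1e (scale0l hh) addr0.
    by apply/eqP; rewrite -(scale_idem_imageP hh).
  rewrite !mulr1n et mulrACA -expr2 -expQZD; congr (_ * E _).
  by rewrite (scaleBr hh) (betaBr hh) addrC.
rewrite sum_char; first last.
- by move=> x y; rewrite (betaDl hh).
- move=> x y; rewrite !(scale_idem_imageP hh) // (scaleBr hh) => /eqP -> /eqP ->.
  exact: eqxx.
- by rewrite (scale_idem_imageP hh) // (scale0r hh).
have s2 : (idem_sqrt RR rho e)^-1 ^+ 2 * #|idem_image rho e|%:R = 1.
  by rewrite exprVn /idem_sqrt sqrtCK mulVf // -sqrtC_eq0 idem_sqrt_neq0.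
rewrite -mulr_natr mulrA s2 mul1r; congr (nat_of_bool _)%:R.
apply/forall_inP/eqP => [h|-> t _]; last by rewrite subrr (scale0r hh) (beta0r hh).
have v0 : rscale v (w - z) = 0.
  apply: (hbeta_nondegr hh) => x; rewrite -fv (scaleA hh) -(hbeta_adj hh).
  by apply/eqP/h; apply/imsetP; exists x; rewrite ?inE.
have e0 : rscale e (w - z) = 0 by rewrite -uv (scaleA hh) v0 (scale0r hh).
apply/eqP; rewrite eq_sym -subr_eq0 -(scale1BK hh e (w - z)) e0 add0r.
by rewrite (scaleBr hh) -/(g w) -/(g z) gzw subrr.
Qed.

End UnitOperators.

Section HeisenbergMatrices.
Variables (RR : realType) (A : form_data) (rho : rep_data A).
Hypothesis hh : is_hermitian rho.
Local Notation CC := (RR[i]).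
Local Notation E := (expQZ RR).
Implicit Types (w x y z : rho) (g : 'M[CC]_#|rho|).

Definition heis_mx x y : 'M[CC]_#|rho| := op_mx (heis RR x y).

Variable n : nat.
Hypothesis n0 : (0 < n)%N.
Local Notation label := {ffun rho * rho -> rho * rho * 'I_n}.

(** A label is the conjugation action of g on the Heisenberg operators, phases included; only
    finitely many labels exist. *)
Definition heis_label (g : 'M[CC]_#|rho|) (d : label) :=
  forall x y, g *m heis_mx x y =
    zeta RR n ^+ (d (x, y)).2 *: (heis_mx (d (x, y)).1.1 (d (x, y)).1.2 *m g).

Lemma heis_mxr g x y z w : (g *m heis_mx x y) (enum_rank z) (enum_rank w) =
  g (enum_rank z) (enum_rank (w + x)) * E (rbeta y w).
Proof.
rewrite mulmx_enumE (bigD1 (w + x)) //= op_mxE /heis eqxx mulr1n big1 ?addr0 //.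
by move=> t /negPf tw; rewrite op_mxE /heis tw mulr0n mulr0.
Qed.

Lemma heis_mxl g x y z w : (heis_mx x y *m g) (enum_rank z) (enum_rank w) =
  E (rbeta y (z - x)) * g (enum_rank (z - x)) (enum_rank w).
Proof.
rewrite mulmx_enumE (bigD1 (z - x)) //= op_mxE /heis subrK eqxx mulr1n big1 ?addr0 //.
by move=> t /negPf tw; rewrite op_mxE /heis -subr_eq eq_sym tw mulr0n mul0r.
Qed.

Definition heis_normal_mx g := heis_normal n
  (fun z w => g (enum_rank z) (enum_rank w)).

Lemma heis_normal_mx1 : heis_normal_mx 1%:M.
Proof.
move=> x y; exists x, y, 0; split; first exact: mul0rn.
move=> z w; rewrite expQZ0 mul1r !mxE !(inj_eq enum_rank_inj) subr_eq.
by have [->|_] := eqVneq z (w + x); rewrite ?mul0r ?mulr0 // addrK mulrC.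
Qed.

Lemma heis_normal_mxM g h : heis_normal_mx g -> heis_normal_mx h ->
  heis_normal_mx (g *m h).
Proof.
move=> hg hgh x y; have [x1 [y1 [q1 [q1n h1]]]] := hgh x y.
have [x2 [y2 [q2 [q2n h2]]]] := hg x1 y1.
cbv beta in h1, h2.
exists x2, y2, (q1 + q2); split; first by rewrite mulrnDl q1n q2n addr0.
move=> z w; rewrite !mulmx_enumE mulr_suml !mulr_sumr expQZD.
rewrite (reindex_inj (addIr x1)) /=; apply: eq_bigr => t _.
rewrite -[LHS]mulrA h1 addrK mulrCA [g _ _ * _]mulrA h2 !mulrA.
by rewrite [E q1 * E q2]mulrC.
Qed.

Lemma heis_normal_label g : heis_normal_mx g -> exists d, heis_label g d.
Proof.
move=> hg.
have /boolp.choice [d hd] : forall p : rho * rho, exists t : rho * rho * 'I_n,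
    g *m heis_mx p.1 p.2 = zeta RR n ^+ t.2 *: (heis_mx t.1.1 t.1.2 *m g).
  move=> [x y]; have [x' [y' [q [qn h]]]] := hg x y.
  have [k hk] := expQZ_zeta RR n0 qn; exists (x', y', k).
  apply: matrix_enumP => z w; rewrite heis_mxr mxE heis_mxl -hk.
  exact: h.
by exists [ffun p => d p] => x y; rewrite ffunE; apply: (hd (x, y)).
Qed.

(** Schur's lemma by hand: commuting with the characters X_(0,y) makes g diagonal, because beta
    separates points, and commuting with the translations makes the diagonal constant. *)
Lemma heis_commutant g : (forall x y, g *m heis_mx x y = heis_mx x y *m g) ->
  exists c, g = c%:M.
Proof.
move=> hg; exists (g (enum_rank 0) (enum_rank 0)).
have diag z w : z != w -> g (enum_rank z) (enum_rank w) = 0.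
  move=> zw; apply/eqP; apply: contraNT zw => gzw; rewrite -subr_eq0; apply/eqP.
  apply: (hbeta_nondegr hh) => y; rewrite (betaBr hh); apply: (@expQZ_eq1 RR).
  have := congr1 (fun M : 'M_#|rho| => M (enum_rank z) (enum_rank w)) (hg 0 y).
  rewrite heis_mxr heis_mxl addr0 subr0 [RHS]mulrC => /(mulfI gzw) e.
  by rewrite expQZB -e divff // expQZ_neq0.
apply: matrix_enumP => z w; rewrite mxE (inj_eq enum_rank_inj).
have [->|zw] := eqVneq z w; last by rewrite diag // mulr0n.
have := congr1 (fun M : 'M_#|rho| => M (enum_rank w) (enum_rank 0)) (hg w 0).
by rewrite heis_mxr heis_mxl add0r subrr !(beta0l hh) expQZ0 mulr1 mul1r mulr1n.
Qed.

Lemma heis_label_scalar g h d : g \in unitmx -> heis_label g d -> heis_label h d ->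
  exists c, h = c *: g.
Proof.
move=> ug hg hhd; have [|c hc] := @heis_commutant (invmx g *m h).
  move=> x y; rewrite -mulmxA hhd scalemxAl.
  have : zeta RR n ^+ (d (x, y)).2 *: heis_mx (d (x, y)).1.1 (d (x, y)).1.2 =
      g *m heis_mx x y *m invmx g by rewrite hg -scalemxAl mulmxK.
  move=> ->.
  by rewrite !mulmxA mulVmx // mul1mx.
by exists c; rewrite -[h](mulKVmx ug) hc mul_mx_scalar.
Qed.

End HeisenbergMatrices.

Lemma perm_mulmx_unit (K : fieldType) n (s : seq 'M[K]_n) (k : 'M[K]_n) :
  uniq s -> k \in unitmx -> (forall x, x \in s -> k *m x \in s) ->
  perm_eq [seq k *m x | x <- s] s.
Proof.
move=> us uk ks; have u1 : uniq [seq k *m x | x <- s].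
  by rewrite map_inj_uniq // => x y /(congr1 (mulmx (invmx k))); rewrite !mulKmx.
apply: uniq_perm => //; apply: (uniq_min_size _ _ _).2 => //; last by rewrite size_map.
by move=> _ /mapP[x xs ->]; apply: ks.
Qed.

Section CliffordFixesTypes.
Variables (RR : realType) (A : form_data) (hA : is_form_ring A).
Variables (rho : rep_data A) (hrho : is_rep rho) (m M : nat).
Variables (Tm : symm_choice (mat_form A m)) (hTm : is_symm_choice Tm).
Local Notation CC := (RR[i]).
Local Notation ones := (fun _ : 'I_M => 1 : int).
Local Notation Vm := (genus_rep rho m).
Local Notation rho1 := (sum_rep rho ones).
Local Notation Vm1 := (sum_rep Vm ones).

Let hh := rep_hermitian hA hrho.
Let hg := genus_hermitian hA hrho m.
Let hg1 : is_hermitian Vm1 := sum1_hermitian hg M.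

Definition grow (r : 'I_m) (x : {ffun 'I_M -> Vm}) : rho1 :=
  [ffun i => (x i : {ffun _ -> rho}) r].
Definition gcode (C : {set rho1}) : {set Vm1} :=
  [set x : Vm1 | [forall r, grow r x \in C]]%SET.

Lemma grow_add r (x y : Vm1) : grow r (x + y) = grow r x + grow r y.
Proof. by apply/ffunP => i; rewrite !ffunE. Qed.

Lemma grow_scale r (B : mat_form A m) (x : Vm1) :
  grow r (rscale B x) = \sum_j rscale ((B : 'M[A]_m) r j) (grow j x : rho1).
Proof.
by apply/ffunP => i; rewrite sum_ffunE !ffunE; apply: eq_bigr => j _; rewrite !ffunE.
Qed.

Lemma gcode_beta (x y : Vm1) : rbeta x y = \sum_r rbeta (grow r x) (grow r y).
Proof.
rewrite sum1_betaE; under eq_bigr do rewrite (genus_betaE hA hrho).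
rewrite exchange_big; apply: eq_bigr => r _; rewrite sum1_betaE.
by apply: eq_bigr => i _; rewrite !ffunE.
Qed.

Variable C : {set rho1}.
Hypothesis tC : type_code C.

Lemma gcode_is_code : is_code (gcode C).
Proof.
have hC := type_is_code tC; split.
- rewrite inE; apply/forallP => r; rewrite (_ : grow r _ = 0) ?code0 //.
  by apply/ffunP => i; rewrite !ffunE.
- move=> x y; rewrite !inE => /forallP xC /forallP yC; apply/forallP => r.
  by rewrite grow_add codeD.
- move=> B x; rewrite !inE => /forallP xC; apply/forallP => r.
  rewrite grow_scale; elim/big_rec: _ => [|j y _ yC]; first exact: code0.
  by apply: codeD => //; apply: codeZ.
Qed.

Lemma gcode_dual : dual_code (gcode C) = gcode C.
Proof.
have hC := type_is_code tC.
apply/finset.setP => x; apply/dualP/idP => [h|].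
  rewrite inE; apply/forallP => r; rewrite -(type_dual tC); apply/dualP => c cC.
  pose y : Vm1 := [ffun i => [ffun s => if s == r then (c : {ffun _ -> rho}) i else 0]].
  have yr s : grow s y = if s == r then c else 0.
    by apply/ffunP => i; rewrite !ffunE; case: (s == r); rewrite ?ffunE.
  rewrite -[RHS](h y).
    have e0 s : s != r -> rbeta (grow s x) (grow s y) = 0.
      by move=> sr; rewrite yr (negPf sr) (beta0r (sum1_hermitian hh M)).
    rewrite gcode_beta (bigD1 r isT) (big1 _ _ _ e0); apply: etrans (esym (addr0 _)).
    by rewrite yr eqxx.
  by rewrite inE; apply/forallP => s; rewrite yr; case: (s == r); rewrite ?code0.
rewrite inE => /forallP xC y; rewrite inE => /forallP yC.
rewrite gcode_beta big1 // => r _.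
by have := xC r; rewrite -{1}(type_dual tC) => /dualP; apply.
Qed.

Lemma rquad_gcode (q : fquad (mat_form A m)) (x : Vm1) : x \in gcode C -> rquad q x = 0.
Proof.
rewrite inE => /forallP xC; have [_ [CC CQ]] := type_iso tC.
have quadE phi r : rquad phi (grow r x) = \sum_i rquad phi ((x i : {ffun _ -> rho}) r).
  by apply: eq_bigr => i _; rewrite mulr1z ffunE.
have bilE mm r s : rbil mm (grow r x) (grow s x) =
    \sum_i rbil mm ((x i : {ffun _ -> rho}) r) ((x i : {ffun _ -> rho}) s).
  by apply: eq_bigr => i _; rewrite mulr1z !ffunE.
rewrite /= (eq_bigr (fun i => \sum_r rquad (q.1 r) ((x i : {ffun _ -> rho}) r) +
   \sum_p rbil (q.2 p) ((x i : {ffun _ -> rho}) (val p).1) ((x i : {ffun _ -> rho}) (val p).2)));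
  last by move=> i _; rewrite mulr1z.
rewrite big_split exchange_big /= [X in X + _]big1 ?add0r => [|r _]; last by rewrite -quadE CQ.
rewrite exchange_big big1 // => p _; rewrite -bilE (rbilE hA (sum_rep_is_rep RR hA hrho _)).
  have := xC (val p).1; rewrite -{1}(type_dual tC) => /dualP; apply.
  by apply: codeZ => //; apply: type_is_code.
by move=> i; rewrite /coprimez /gcdz /= gcd1n.
Qed.

(** With all multipliers equal to 1 no Galois sign occurs, and the diagonal action of each generator
    of C_m(rho), for any idempotent of the matrix ring, is an operator on the sum of M copies of
    V^m. There C^m is a self-dual code on which the quadratic maps vanish. *)
Lemma tact_clifford g : clifford_weil RR Tm Vm g -> forall x,
  tact (fun _ : 'I_M => g) (fun x => (x \in gcode C)%:R) x = (x \in gcode C)%:R.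
Proof.
have hC := gcode_is_code; have dC := gcode_dual.
elim=> [{}g|x|{}g h _ IHg _ IHh x|{}g _ IH x].
- case=> [[[r [s [rs sr]] ->]|[phi ->]]|[e he ->]] x.
  + rewrite cw_mE tact_opmx.
    rewrite (eq_bigr (fun w : Vm1 => kern_m RR r (x : Vm1) w * (w \in gcode C)%:R)); last first.
      by move=> w _; rewrite -(prod_kern_m RR ones).
    rewrite /kern_m (bigD1 (rscale s (x : Vm1)) isT) -(scaleA hg1) rs (hscale_one hg1).
    have e0 (w : Vm1) : w != rscale s (x : Vm1) ->
        ((x : Vm1) == rscale r w)%:R * (w \in gcode C)%:R = 0 :> CC.
      move=> ws; case: eqP => [xw|_]; last by rewrite mul0r.
      by rewrite xw -(scaleA hg1) sr (hscale_one hg1) eqxx in ws.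
    rewrite eqxx mul1r (big1 _ _ _ e0); apply: etrans (addr0 _) _.
    congr (nat_of_bool _)%:R; apply/idP/idP => [h|h]; last exact: (codeZ s hC h).
    by rewrite -(hscale_one hg1 x) -rs (scaleA hg1); apply: (codeZ r hC h).
  + rewrite cw_dE tact_opmx.
    rewrite (eq_bigr (fun w : Vm1 => kern_d RR 1 phi (x : Vm1) w * (w \in gcode C)%:R)); last first.
      by move=> w _; rewrite -(prod_kern_d RR ones).
    have e0 (w : Vm1) : w != x -> kern_d RR 1 phi (x : Vm1) w * (w \in gcode C)%:R = 0 :> CC.
      by move=> wx; rewrite /kern_d eq_sym (negPf wx) mulr0n mul0r.
    rewrite (bigD1 (x : Vm1) isT) (big1 _ _ _ e0); apply: etrans (addr0 _) _.
    rewrite /kern_d eqxx mulr1n; case: (boolP (x \in gcode C)) => xC; last by rewrite mulr0.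
    by rewrite mulr1z rquad_gcode // expQZ0 mulr1.
  + have hi := sreps_idem_data hTm he; have [ee _ _ _ _] := hi.
    rewrite cw_hE tact_opmx -[RHS](kern_h_fix RR hg1 hC dC hi).
    by apply: eq_bigr => w _; rewrite -(prod_kern_h RR hg hg1).
- exact: tact1.
- by rewrite tact_mul -[RHS]IHg; apply: eq_tact.
have [ug|ug] := boolP (g \in unitmx); last by rewrite /invmx (negPf ug) IH.
rewrite -[RHS](tact1 (fun x : {ffun 'I_M -> Vm} => (x \in gcode C)%:R : CC)) -(mulVmx ug).
by rewrite tact_mul; apply: eq_tact => w; rewrite IH.
Qed.

End CliffordFixesTypes.

Section DescentMonoid.
Variables (RR : realType) (A : form_data) (hA : is_form_ring A).
Variables (T : symm_choice A) (hT : is_symm_choice T).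
Hypothesis hwecA : weight_enumerator_conjecture RR T.
Variables (rho : rep_data A) (hrho : is_rep rho).
Variable m : nat.
Variables (Tm : symm_choice (mat_form A m.+1)) (hTm : is_symm_choice Tm).
Variable N0 : nat.
Hypothesis N0_gt0 : (0 < N0)%N.
Variable C0 : {set sum_rep rho (fun _ : 'I_N0 => 1 : int)}.
Hypothesis tC0 : type_code C0.
Local Notation CC := (RR[i]).
Local Notation Vm := (genus_rep rho m.+1).
Local Notation generator := (@descent_generator RR A rho m.+1 T).
Local Notation f := (conductor rho).

Let hh := rep_hermitian hA hrho.
Let hg := genus_hermitian hA hrho m.+1.

(** Words without inverses, so that inductions meet a single generator at a time. Being finite and
    made of invertible matrices, this monoid is in fact a group. *)
Inductive descent_monoid : 'M[CC]_#|Vm| -> Prop :=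
| DescentOne : descent_monoid 1%:M
| DescentMul k g of generator k & descent_monoid g : descent_monoid (op_mx (k 1) *m g).

Lemma descent_monoid_mul g h : descent_monoid g -> descent_monoid h ->
  descent_monoid (g *m h).
Proof.
by elim=> [|k {}g hk _ IH] hh'; rewrite ?mul1mx // -mulmxA; apply: DescentMul => //; apply: IH.
Qed.

Lemma descent_monoid_gen k : generator k -> descent_monoid (op_mx (k 1)).
Proof. by move=> hk; rewrite -[op_mx _]mulmx1; apply: DescentMul => //; apply: DescentOne. Qed.

Lemma descent_monoid_cw g : descent_monoid g -> clifford_weil RR Tm Vm g.
Proof.
elim=> [|k {}g hk _ IH]; first exact: GenOne.
by apply: GenMul => //; apply: (descent_generator_cw hA hrho hT hTm).
Qed.

Lemma clifford_unit g : clifford_weil RR Tm Vm g -> g \in unitmx.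
Proof.
elim=> [{}g|||]; last 1 first.
- by move=> h _; rewrite unitmx_inv.
- case=> [[[r ur ->]|[phi ->]]|[e he ->]]; first exact: cw_m_unit.
    exact: cw_d_unit.
  exact: (cw_h_unit RR hg (sreps_idem_data hTm he)).
- exact: unitmx1.
- by move=> h h' _ uh _ uh'; rewrite unitmx_mul uh.
Qed.

Lemma descent_monoid_heis g : descent_monoid g -> heis_normal_mx f g.
Proof.
elim=> [|k {}g hk _ IH]; first exact: (heis_normal_mx1 RR).
apply: heis_normal_mxM => //.
have := descent_generator_heis hA hrho hT hk; rewrite /heis_normal_mx.
by congr heis_normal; apply/funext => z; apply/funext => w; rewrite op_mxE.
Qed.

(* Both g and c g fix the weight enumerator of C0^m, which is of degree N0. *)
Lemma descent_scalar_root g c : descent_monoid g -> descent_monoid (c *: g) -> c ^+ N0 = 1.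
Proof.
move=> hg0 hcg; have h1 := tact_clifford hA hrho hTm tC0 (descent_monoid_cw hg0) 0.
have h2 := tact_clifford hA hrho hTm tC0 (descent_monoid_cw hcg) 0.
have z0 : (0 : sum_rep Vm (fun _ : 'I_N0 => 1 : int)) \in gcode m.+1 C0.
  by case: (gcode_is_code m.+1 tC0).
rewrite z0 in h1; rewrite z0 in h2.
rewrite -[LHS]mulr1 -[1 in LHS]h1 -[RHS]h2 /tact mulr_sumr; apply: eq_bigr => w _.
under [in RHS]eq_bigr do rewrite mxE.
by rewrite big_split /= prodr_const card_ord mulrA.
Qed.

(** Two elements with the same label differ by a scalar, which is an N0-th root of unity by
    [descent_scalar_root]; one representative [F d] for each label therefore suffices. *)
Lemma descent_monoid_finite : exists2 s : seq 'M[CC]_#|Vm|, uniq s &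
  forall g, g \in s <-> descent_monoid g.
Proof.
have f0 : (0 < f)%N := conductor_gt0 RR hrho.
pose label := {ffun Vm * Vm -> Vm * Vm * 'I_f}.
have /boolp.choice [F hF] : forall d : label, exists M : 'M[CC]_#|Vm|,
    (exists g, descent_monoid g /\ heis_label g d) -> descent_monoid M /\ heis_label M d.
  move=> d; have [[g hg0]|h] := pselect (exists g, descent_monoid g /\ heis_label g d).
    by exists g.
  by exists 0 => /h.
pose s0 := [seq zeta RR N0 ^+ (j : 'I_N0) *: F d | d <- enum [set: label]%SET, j <- enum 'I_N0].
have s0P g : descent_monoid g -> g \in s0.
  move=> hg0; have [d hd] := heis_normal_label f0 (descent_monoid_heis hg0).
  have [hF1 hF2] := hF d (ex_intro _ g (conj hg0 hd)).
  have [c cE] := heis_label_scalar hg (clifford_unit (descent_monoid_cw hF1)) hF2 hd.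
  have c1 : c ^+ N0 = 1 by apply: (descent_scalar_root hF1); rewrite -cE.
  have [j jE] := prim_rootP (zeta_prim RR N0_gt0) c1.
  apply/allpairsP; exists (d, j); split; rewrite ?mem_enum ?inE //.
  by rewrite cE jE.
pose s := undup [seq g <- s0 | `[< descent_monoid g >]].
exists s => [|g]; first exact: undup_uniq.
rewrite mem_undup mem_filter; split=> [/andP[/asboolP] //|hg0].
by apply/andP; split; [apply/asboolP|exact: s0P].
Qed.

(** For a = (1,..,1) the invariants of the generators are combinations of indicators of the C^m, and
    [tact_clifford] shows that the whole group fixes these. *)
Lemma clifford_fixes_invariants M (y : {ffun 'I_M -> Vm} -> CC) g :
  clifford_weil RR Tm Vm g ->
  (forall k, generator k -> forall u, tact (fun=> op_mx (k 1)) y u = y u) ->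
  forall u, tact (fun=> g) y u = y u.
Proof.
move=> hgH hy u.
have cop (i : 'I_M) : coprimez 1 f%:Z by rewrite /coprimez /gcdz /= gcd1n.
have [c hc] := descent_fixed_span hA hT hwecA hrho cop hy.
rewrite hc /tact; under eq_bigr do rewrite hc mulr_sumr.
rewrite exchange_big /=; apply: eq_bigr => C /is_typeP tC.
have allE w : all_rows C w = (w \in gcode m.+1 C) by rewrite inE.
rewrite -[RHS]mulr_natr allE -(tact_clifford hA hrho hTm tC hgH u) /tact mulr_sumr.
by apply: eq_bigr => w _; rewrite allE -[c C *+ _]mulr_natr mulrCA.
Qed.

Local Notation mon t x := (\prod_(p <- t) x (enum_rank p.1) (enum_rank p.2)).

(** A finite matrix group is recovered from its invariants in all tensor powers: an element fixing
    them cannot move the group off itself. *)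
Lemma clifford_sub_monoid g : clifford_weil RR Tm Vm g -> descent_monoid g.
Proof.
move=> hgH; have [s us sP] := descent_monoid_finite.
have s_unit k : k \in s -> k \in unitmx.
  by move/sP/descent_monoid_cw/clifford_unit.
have perm_s k : k \in s -> perm_eq [seq k *m x | x <- s] s.
  move=> ks; apply: perm_mulmx_unit => // [|x xs]; first exact: s_unit.
  by apply/sP/descent_monoid_mul; apply/sP.
(* With the column indices held fixed, the sum over s of products of entries is a tensor in the row
   indices. The generators permute s, so they fix this tensor, and hence so does g. *)
have base (t : seq (Vm * Vm)) : \sum_(k <- s) mon t (g *m k) = \sum_(k <- s) mon t k.
  pose tn (l : 'I_(size t)) := tnth (in_tuple t) l.
  pose y (w : {ffun 'I_(size t) -> Vm}) : CC :=
    \sum_(k <- s) \prod_l k (enum_rank (w l)) (enum_rank (tn l).2).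
  have yM h u : tact (fun=> h) y u =
      \sum_(k <- s) \prod_l (h *m k) (enum_rank (u l)) (enum_rank (tn l).2).
    rewrite /tact; under eq_bigr do rewrite mulr_sumr.
    rewrite exchange_big /=; apply: eq_bigr => k _.
    under [RHS]eq_bigr do rewrite mulmx_enumE.
    by rewrite bigA_distr_bigA; apply: eq_bigr => w _; rewrite big_split.
  have yinv u : tact (fun=> g) y u = y u.
    apply: clifford_fixes_invariants hgH _ u => k hk u; rewrite yM.
    have /perm_s ps : op_mx (k 1) \in s by apply/sP/descent_monoid_gen.
    by rewrite /y -[RHS](perm_big _ ps) big_map.
  have := yinv [ffun l => (tn l).1]; rewrite yM /y => e.
  transitivity (\sum_(k <- s) \prod_(l < size t)
     (g *m k) (enum_rank ([ffun l0 => (tn l0).1] l)) (enum_rank (tn l).2)).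
    by apply: eq_bigr => k _; rewrite big_tnth; apply: eq_bigr => l _; rewrite ffunE.
  by rewrite e; apply: eq_bigr => k _; rewrite [RHS]big_tnth; apply: eq_bigr => l _; rewrite ffunE.
(* The elements of s and their g-translates cannot be told apart by sums of
   values of polynomials in the matrix entries; if g were not in s, the polynomial
   Q vanishing at all of these matrices but 1 would do so. *)
pose Q (l : seq (Vm * Vm * CC)) (x : 'M[CC]_#|Vm|) : CC :=
  \prod_(p <- l) (x (enum_rank p.1.1) (enum_rank p.1.2) - p.2).
have poly l t : \sum_(k <- s) mon t (g *m k) * Q l (g *m k) = \sum_(k <- s) mon t k * Q l k.
  elim: l t => [|[[i j] c] l IH] t.
    by rewrite /Q; under eq_bigr do rewrite big_nil mulr1;
       under [RHS]eq_bigr do rewrite big_nil mulr1.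
  have step (x : 'M[CC]_#|Vm|) : mon t x * Q ((i, j, c) :: l) x =
      mon ((i, j) :: t) x * Q l x - c * (mon t x * Q l x).
    by rewrite /Q !big_cons /=; ring.
  by under eq_bigr do rewrite step; under [RHS]eq_bigr do rewrite step;
     rewrite !sumrB -!mulr_sumr !IH.
apply/sP; apply: contraT => gs.
have sep (x : 'M[CC]_#|Vm|) : exists p : Vm * Vm * CC, x != 1%:M ->
    x (enum_rank p.1.1) (enum_rank p.1.2) = p.2 /\
    (1%:M : 'M[CC]_#|Vm|) (enum_rank p.1.1) (enum_rank p.1.2) != p.2.
  case: (pselect (exists u w, x (enum_rank u) (enum_rank w) !=
      (1%:M : 'M[CC]_#|Vm|) (enum_rank u) (enum_rank w))).
    by move=> [u [w uw]]; exists (u, w, x (enum_rank u) (enum_rank w)) => _; split; rewrite 1?eq_sym.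
  move=> h; exists (0, 0, 0) => /eqP []; apply: matrix_enumP => u w.
  by apply/eqP; apply: contrapT => /negP uw; apply: h; exists u, w.
have [p hp] := boolp.choice sep.
pose bad := [seq x <- s ++ [seq g *m k | k <- s] | x != 1%:M].
have Q0 x : x \in bad -> Q [seq p y | y <- bad] x = 0.
  move=> xb; rewrite /Q big_map (big_rem x) //=.
  have x1 : x != 1%:M by move: xb; rewrite mem_filter => /andP[].
  by have [-> _] := hp x x1; rewrite subrr mul0r.
have Q1 : Q [seq p y | y <- bad] 1%:M != 0.
  rewrite /Q big_map prodf_seq_neq0; apply/allP => x; rewrite mem_filter => /andP[x1 _] /=.
  by rewrite subr_eq0; case: (hp x x1).
have one_s : 1%:M \in s by apply/sP; exact: DescentOne.
have := poly [seq p y | y <- bad] [::].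
rewrite big1_seq => [|k /andP[_ ks]]; last first.
  rewrite Q0 ?mulr0 // mem_filter mem_cat; apply/andP; split; last first.
    by apply/orP; right; apply: map_f.
  (* If g k = 1, then g is the inverse of k, which belongs to s because multiplication by k permutes
     s. *)
  apply: contraNneq gs => gk.
  have /perm_mem/(_ 1%:M) := perm_s k ks; rewrite one_s => /mapP[k' k's kk'].
  suff -> : g = k' by [].
  by rewrite -[k']mul1mx -gk -mulmxA -kk' mulmx1.
rewrite (big_rem 1%:M) //= big_nil mul1r big1_seq ?addr0.
  by move/esym/eqP; rewrite (negPf Q1).
move=> k /andP[_]; rewrite mem_rem_uniq // inE => /andP[k1 ks].
by rewrite Q0 ?mulr0 // mem_filter k1 mem_cat ks.
Qed.

End DescentMonoid.

(** * Conjugate polynomials *)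

Section LinSpan.
Variables (K : pzRingType) (U : lmodType K) (S : set U).

Lemma lin_span_sum (I : finType) (P : pred I) (c : I -> K) (y : I -> U) :
  (forall i, P i -> S (y i)) -> lin_span S (\sum_(i | P i) c i *: y i).
Proof.
move=> hy; exists #|P|, (fun i => c (enum_val i)), (fun i => y (enum_val i)).
split=> [i|]; first exact/hy/(enum_valP i).
by transitivity (\sum_(i in P) c i *: y i) => //; rewrite big_enum_val.
Qed.

End LinSpan.

(** A linear system over L that is solvable over an extension is solvable over L. This brings the
    complex coefficients of the descent down to K. *)
Lemma coef_descent (L C : fieldType) (iota : {rmorphism L -> C}) (I X : finType)
    (P : pred I) (g : I -> X -> L) (f : X -> L) (c : I -> C) :
  (forall x, iota (f x) = \sum_(i | P i) c i * iota (g i x)) ->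
  exists c' : I -> L, forall x, f x = \sum_(i | P i) c' i * g i x.
Proof.
move=> hc.
pose G : 'M[L]_(#|I|, #|X|) := \matrix_(i, j) (g (enum_val i) (enum_val j) *+ P (enum_val i)).
pose f' : 'rV[L]_#|X| := \row_j f (enum_val j).
have /submxP [D hD] : (f' <= G)%MS.
  rewrite -(map_submx iota); apply/submxP.
  exists (\row_i c (enum_val i)); apply/rowP => j; rewrite mxE [in RHS]mxE mxE hc.
  rewrite sum_enum_rank big_mkcond; apply: eq_bigr => i _; rewrite !mxE !enum_rankK.
  by case: (P i); rewrite ?mulr1n // mulr0n rmorph0 mulr0.
exists (fun i => D 0 (enum_rank i)) => x.
have := congr1 (fun M : 'rV_#|X| => M 0 (enum_rank x)) hD.
rewrite mxE enum_rankK => ->; rewrite mxE sum_enum_rank [RHS]big_mkcond.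
by apply: eq_bigr => i _; rewrite mxE !enum_rankK; case: (P i); rewrite ?mulr1n // mulr0n mulr0.
Qed.

Section Twist.
Variables (RR : realType) (A : form_data) (hA : is_form_ring A).
Variables (T : symm_choice A) (hT : is_symm_choice T).
Variables (rho : rep_data A) (hrho : is_rep rho) (m : nat).
Variables (L : splittingFieldType rat) (iota : {rmorphism L -> RR[i]}).
Variable F : {subfield L}.
Hypothesis hK : range iota = K_field RR rho.
Hypothesis hF : is_complement (cyclotomic_field RR (conductor rho))
            (sqrt_field RR rho) [set iota z | z in [set` F]].
Variables (N : nat) (a : 'I_N -> int).
Hypothesis ha : forall i, coprimez (a i) (conductor rho)%:Z.
Hypothesis hsign : sign_condition rho iota F a.
Local Notation CC := (RR[i]).
Local Notation f := (conductor rho).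
Local Notation gam b := (gamma rho iota F b).
Local Notation Vm := (genus_rep rho m).
Local Notation X := {ffun 'I_N -> Vm}.
Local Notation generator := (@descent_generator RR A rho m T).

Let hh := rep_hermitian hA hrho.

(** The conjugation is applied to a lift G over L, since the Galois group acts on L and not on the
    complex numbers. *)
Definition twist (G : 'M[L]_#|Vm|) (t : X -> L) (u : X) : L :=
  tact (fun i => map_mx (gam (a i)) G) t u.

Lemma twist_mul G H t u : twist (G *m H) t u = twist G (twist H t) u.
Proof.
rewrite /twist -tact_mul; congr (tact _ _ _); apply/funext => i.
exact: map_mxM.
Qed.

Lemma twist1 t u : twist 1%:M t u = t u.
Proof.
rewrite /twist -[RHS]tact1; congr (tact _ _ _); apply/funext => i.
exact: map_mx1.
Qed.

Lemma eq_twist G t t' u : t =1 t' -> twist G t u = twist G t' u.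
Proof. exact: eq_tact. Qed.

Lemma twist_sum (I : Type) (s : seq I) (P : pred I) (c : I -> L) (t : I -> X -> L) G u :
  twist G (fun w => \sum_(i <- s | P i) c i * t i w) u =
  \sum_(i <- s | P i) c i * twist G (t i) u.
Proof.
rewrite /twist /tact; under eq_bigr do rewrite mulr_sumr.
rewrite exchange_big; apply: eq_bigr => i _; rewrite mulr_sumr.
by apply: eq_bigr => w _; rewrite mulrCA.
Qed.

(** The sign s b is the same for all entries of the kernel, so over the coordinates of a tensor only
    the product of the s (a i) matters. *)
Definition conjugate_kernel (V : Type) (s : int -> int) (k : int -> V -> V -> CC) :=
  forall x w, exists z : L, iota z = k 1 x w /\
    forall b, coprimez b f%:Z -> iota (gam b z) = (s b)%:~R * k b x w.

Lemma conjugate_mulrb (V : Type) s k (b : V -> V -> bool) :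
  conjugate_kernel s k -> conjugate_kernel s (fun c (x w : V) => k c x w *+ b x w).
Proof.
move=> hk x w; have [z [hz gz]] := hk x w; exists (z *+ b x w); split.
  by rewrite rmorphMn hz.
by move=> c /gz e; rewrite !rmorphMn /= e mulrnAr.
Qed.

Lemma conjugate_expQZ (V : Type) (q : V -> V -> QmodZ) :
  (forall x w, q x w *+ f = 0) ->
  conjugate_kernel (fun=> 1) (fun b x w => expQZ RR (q x w *~ b)).
Proof.
move=> qf x w; have [z hz] := expQZ_range hrho hK (qf x w).
exists z; rewrite mulr1z; split=> // b cb.
by rewrite mul1r (gamma_expQZ hrho hK hF cb (qf x w)).
Qed.

Lemma conjugate_lift s (k : int -> rho -> rho -> CC) (r : 'I_m) : conjugate_kernel s k ->
  conjugate_kernel s (fun b => lift_kern r (k b)).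
Proof.
move=> hk; apply: conjugate_mulrb => x w; exact: hk.
Qed.

Lemma conjugate_kern_m r : conjugate_kernel (fun=> 1) (fun=> kern_m (rho := rho) RR r).
Proof.
move=> x w; exists (x == rscale r w)%:R; split; first by rewrite rmorph_nat.
by move=> b _; rewrite mul1r !rmorph_nat.
Qed.

Lemma conjugate_kern_h e v : symmetric_idempotent e ->
  conjugate_kernel (epsilon rho iota F e) (fun b => kern_h (rho := rho) RR b e v).
Proof.
move=> he x w; have [ee _] := he; have [s hs] := sqrt_range hK he.
have s0 : s != 0 by rewrite -(fmorph_eq0 iota) hs; exact: (idem_sqrt_neq0 RR rho e).
pose q (x w : rho) := rbeta (rscale e x) (rscale v w).
have qf x' w' : q x' w' *+ f = 0 by exact: (conductor_beta RR hrho).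
have [z [hz gz]] := conjugate_mulrb (fun x w : rho => rscale (1 - e) x == rscale (1 - e) w)
  (conjugate_expQZ qf) x w.
exists (s^-1 * z); split; first by rewrite (kern_h_simpl RR hh) // rmorphM fmorphV hz hs.
move=> b cb; rewrite (kern_h_simpl RR hh) // !rmorphM !fmorphV /= gz // mul1r.
rewrite (gamma_sqrt F b hs) rmorphM /= hs rmorph_int invfM mulrA; congr (_ * _).
by congr (_ * _); rewrite /epsilon; case: ifP => _; rewrite ?invr1 // invrN1.
Qed.

(** The sign condition enters here: each operator h contributes [epsilon], and the product over the
    coordinates is 1. The entries of the other generators involve roots of unity only. *)
Lemma generator_conjugate k : generator k ->
  exists2 s, conjugate_kernel s k & \prod_i s (a i) = 1.
Proof.
case=> [r c uc|r phi|r e he|p mm].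
- exists (fun=> 1); last by rewrite big1.
  exact: (conjugate_lift _ (conjugate_kern_m c)).
- exists (fun=> 1); last by rewrite big1.
  apply/conjugate_lift/conjugate_mulrb/(conjugate_expQZ (q := fun x w => rquad phi w)).
  by move=> x w; exact: (conductor_quad RR hrho).
- have se := sreps_symm hT he.
  exists (epsilon rho iota F e); last exact: hsign.
  by apply: conjugate_lift; apply: conjugate_kern_h.
exists (fun=> 1); last by rewrite big1.
apply/conjugate_mulrb/(conjugate_expQZ (q := fun x w : {ffun _ -> rho} =>
  rbil mm (w (val p).1) (w (val p).2))) => x w.
by rewrite (rbilE hA hrho); exact: (conductor_beta RR hrho).
Qed.

Lemma generator_twist k : generator k -> exists2 G : 'M[L]_#|Vm|,
  map_mx iota G = op_mx (k 1) &
  forall t u, iota (twist G t u) = tact (fun i => op_mx (k (a i))) (iota \o t) u.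
Proof.
move=> /generator_conjugate [s hk sP].
have /boolp.choice [z hz] : forall p : Vm * Vm, exists z : L, iota z = k 1 p.1 p.2 /\
    forall b, coprimez b f%:Z -> iota (gam b z) = (s b)%:~R * k b p.1 p.2.
  by move=> p; apply: hk.
exists (op_mx (fun x w => z (x, w))).
  by apply: matrix_enumP => x w; rewrite mxE !op_mxE; case: (hz (x, w)).
move=> t u; rewrite tact_opmx rmorph_sum; apply: eq_bigr => w _.
rewrite rmorphM; congr (_ * _); rewrite rmorph_prod.
under eq_bigr => i _.
  rewrite mxE op_mxE; have [_ ->] := hz (u i, w i); last exact: ha.
over.
by rewrite big_split /= -rmorph_prod sP mul1r.
Qed.

Definition twist_poly (t : X -> L) : 'rV[L]_#|Vm| -> L^o :=
  fun k => \sum_(w : X) t w * \prod_i gam (a i) (Defs.coord (w i) k).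

Lemma twist_poly_mul t G k : twist_poly t (k *m G) = twist_poly (twist G t) k.
Proof.
rewrite /twist_poly /twist /tact.
under [RHS]eq_bigr do rewrite mulr_suml.
rewrite exchange_big; apply: eq_bigr => w _.
under [RHS]eq_bigr do rewrite mulrAC mulrC.
rewrite -mulr_sumr; congr (_ * _).
under eq_bigr => i _.
  rewrite /Defs.coord mxE sum_enum_rank rmorph_sum.
over.
rewrite bigA_distr_bigA; apply: eq_bigr => u _.
rewrite -big_split; apply: eq_bigr => i _.
by rewrite rmorphM mxE mulrC.
Qed.

Lemma eq_twist_poly t t' k : t =1 t' -> twist_poly t k = twist_poly t' k.
Proof. by move=> e; apply: eq_bigr => w _; rewrite e. Qed.

Lemma twist_poly_sum (I : Type) (s : seq I) (P : pred I) (c : I -> L) (t : I -> X -> L) k :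
  twist_poly (fun w => \sum_(i <- s | P i) c i * t i w) k =
  \sum_(i <- s | P i) c i * twist_poly (t i) k.
Proof.
rewrite /twist_poly; under eq_bigr do rewrite mulr_suml.
rewrite exchange_big; apply: eq_bigr => i _; rewrite mulr_sumr.
by apply: eq_bigr => w _; rewrite mulrA.
Qed.

Lemma prod_gamma_fiber (G : gal_of {:L} -> 'I_N -> L) :
  \prod_(alpha in 'Gal({:L} / F)%g) \prod_(i in gamma_fiber rho iota F a alpha) G alpha i =
  \prod_i G (gam (a i)) i.
Proof.
rewrite [RHS](partition_big (fun i => gam (a i)) (mem 'Gal({:L} / F)%g)) /=; last first.
  by move=> i _; have [] := gammaP hrho hK hF (ha i).
apply: eq_bigr => alpha _; apply: eq_big => [i|i]; first by rewrite inE.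
by rewrite inE => /eqP ->.
Qed.

Local Notation d := (fun alpha : gal_of {:L} => #|gamma_fiber rho iota F a alpha|).

Lemma twist_poly_conj t : conj_poly rho F m d (twist_poly t).
Proof.
pose e (w : X) (v : Vm) alpha := #|[set i in gamma_fiber rho iota F a alpha | w i == v]|%SET.
have -> : twist_poly t = \sum_(w : X) t w *: conj_monomial rho F (e w).
  apply/funext => k; rewrite fct_sumE; apply: eq_bigr => w _; congr (_ * _).
  rewrite -(prod_gamma_fiber (fun alpha i => alpha (Defs.coord (w i) k))).
  apply: eq_bigr => alpha _; rewrite (partition_big w predT) //=.
  apply: eq_bigr => v _; rewrite -prodr_const; apply: eq_big => [i|i].
    by rewrite !inE.
  by case/andP => _ /eqP ->.
apply: lin_span_sum => w _; exists (e w) => // alpha _.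
rewrite -sum1_card (partition_big w predT) //=; apply: eq_bigr => v _.
by rewrite /e -sum1_card; apply: eq_bigl => i; rewrite !inE.
Qed.

(** The fibre of alpha has as many elements as the monomial has factors conjugated by alpha, so
    these factors can be distributed over it. The order is arbitrary, whence the tensor of a
    polynomial is not unique. *)
Lemma conj_monomial_twist (e : Vm -> gal_of {:L} -> nat) :
  (forall alpha, alpha \in 'Gal({:L} / F)%g -> (\sum_w e w alpha)%N = d alpha) ->
  exists w : X, forall k,
    conj_monomial rho F e k = \prod_i gam (a i) (Defs.coord (w i) k).
Proof.
move=> he; pose s alpha := flatten [seq nseq (e v alpha) v | v <- enum Vm].
pose fib alpha := enum (gamma_fiber rho iota F a alpha).
(* Within its fibre, i receives the factor whose place in the list [s] is the rank of i. The lists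
   have equal length, so the default 0 is never read. *)
exists [ffun i => nth 0 (s (gam (a i))) (index i (fib (gam (a i))))] => k.
rewrite -(prod_gamma_fiber (fun alpha i =>
  alpha (Defs.coord ([ffun i => nth 0 (s (gam (a i))) (index i (fib (gam (a i))))] i) k))).
apply: eq_bigr => alpha al.
have sz : size (s alpha) = size (fib alpha).
  rewrite -cardE -he // size_flatten /shape -map_comp sumnE big_map -[RHS]big_enum /=.
  by apply: eq_bigr => v _; rewrite size_nseq.
transitivity (\prod_(v <- s alpha) alpha (Defs.coord v k)).
  rewrite big_flatten big_map -[LHS]big_enum /=; apply: eq_bigr => v _.
  by rewrite big_nseq -Monoid.iteropE.
rewrite (big_nth 0) big_mkord sz.
rewrite -[RHS]big_enum /= -/(fib alpha).
rewrite [RHS]big_seq.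
rewrite (eq_bigr (fun i => alpha (Defs.coord (nth 0 (s alpha) (index i (fib alpha))) k)));
  last by move=> i; rewrite mem_enum inE ffunE => /eqP ->.
rewrite -big_seq [RHS]big_tnth; apply: eq_bigr => j _.
by rewrite (tnth_nth (tnth (in_tuple (fib alpha)) j)) index_uniq ?enum_uniq.
Qed.

End Twist.

Section Assembly.
Variables (RR : realType) (A : form_data) (hA : is_form_ring A).
Variables (T : symm_choice A) (hT : is_symm_choice T).
Hypothesis hwecA : weight_enumerator_conjecture RR T.
Variables (rho : rep_data A) (hrho : is_rep rho) (m : nat).
Variables (Tm : symm_choice (mat_form A m.+1)) (hTm : is_symm_choice Tm).
Variable N0 : nat.
Hypothesis N0_gt0 : (0 < N0)%N.
Variable C0 : {set sum_rep rho (fun _ : 'I_N0 => 1 : int)}.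
Hypothesis tC0 : type_code C0.
Variables (L : splittingFieldType rat) (iota : {rmorphism L -> RR[i]}).
Variable F : {subfield L}.
Hypothesis hK : range iota = K_field RR rho.
Hypothesis hF : is_complement (cyclotomic_field RR (conductor rho))
            (sqrt_field RR rho) [set iota z | z in [set` F]].
Variables (N : nat) (a : 'I_N -> int).
Hypothesis ha : forall i, coprimez (a i) (conductor rho)%:Z.
Hypothesis hsign : sign_condition rho iota F a.
Local Notation CC := (RR[i]).
Local Notation gam b := (gamma rho iota F b).
Local Notation Vm := (genus_rep rho m.+1).
Local Notation X := {ffun 'I_N -> Vm}.
Local Notation generator := (@descent_generator RR A rho m.+1 T).
Local Notation monoid := (@descent_monoid RR A T rho m).
Local Notation twist := (@twist RR A rho m.+1 L iota F N a).
Local Notation poly := (@twist_poly RR A rho m.+1 L iota F N a).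

Let gen_twist := generator_twist hA hT hrho (m := m.+1) hK hF ha hsign.

(** The lift is built along a word for g, generator by generator, because the conjugates are known
    only for generators. In particular g has its entries in K. *)
Lemma monoid_twist_fixed g (t : X -> L) :
  descent_fixed T a (iota \o t) -> monoid g ->
  exists2 G, map_mx iota G = g & forall u, twist G t u = t u.
Proof.
move=> ht; elim=> [|k {}g hk _ [G GE Gt]].
  by exists 1%:M => [|u]; [exact: map_mx1|exact: twist1].
have [G' G'E G't] := gen_twist hk.
exists (G' *m G) => [|u]; first by rewrite map_mxM G'E GE.
rewrite twist_mul (eq_twist iota F a G' u Gt); apply: (fmorph_inj iota).
by rewrite G't ht.
Qed.

Lemma monoid_lift g : monoid g -> exists G, map_mx iota G = g.
Proof.
move=> hg; have [|G GE _] := @monoid_twist_fixed g (fun=> 0) _ hg; last by exists G.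
move=> k _ u; rewrite /tact big1 /= ?rmorph0 // => w _.
by rewrite mulr0.
Qed.

Lemma ccwe_twist (C : {set sum_rep rho a}) :
  ccwe iota F m.+1 C = poly (fun x => (all_rows C x)%:R).
Proof.
apply/funext => k; rewrite /ccwe /twist_poly.
pose col (x : X) : {ffun 'I_m.+1 -> sum_rep rho a} := [ffun r => row_of a r x].
pose row (c : {ffun 'I_m.+1 -> sum_rep rho a}) : X :=
  [ffun i => [ffun r => (c r : {ffun 'I_N -> rho}) i]].
have colK : cancel col row by move=> x; apply/ffunP => i; apply/ffunP => r; rewrite !ffunE.
have rowK : cancel row col by move=> c; apply/ffunP => i; apply/ffunP => r; rewrite !ffunE.
rewrite (reindex col) /=; last by exists row => x _; [exact: colK|exact: rowK].
rewrite [RHS](eq_bigr (fun x : X => if all_rows C x then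
    \prod_i gam (a i) (Defs.coord (x i) k) else 0)); last first.
  by move=> x _; case: (all_rows C x); rewrite ?mul1r ?mul0r.
rewrite -big_mkcond; apply: eq_big => [x|x _].
  by apply: eq_forallb => r; rewrite ffunE.
rewrite (prod_gamma_fiber hrho hK hF ha (fun alpha i =>
  alpha (Defs.coord [ffun r => (col x r : {ffun 'I_N -> rho}) i] k))).
by apply: eq_bigr => i _; rewrite -{2}[x]colK /row ffunE.
Qed.

Lemma ccwe_invariant (C : {set sum_rep rho a}) : type_code C ->
  cw_invariant iota Tm (ccwe iota F m.+1 C).
Proof.
move=> tC G hG k; rewrite ccwe_twist.
have hGV : monoid (map_mx iota (invmx G)).
  by rewrite map_invmx; apply: (clifford_sub_monoid hA hT hwecA hrho hTm N0_gt0 tC0); exact: GenInv.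
have [|H HE Ht] := @monoid_twist_fixed _ (fun x => (all_rows C x)%:R) _ hGV.
  move=> g hg u; have := type_descent_fixed hA hT hwecA hrho ha tC hg u.
  by rewrite /= rmorph_nat => <-; apply: eq_tact => w; rewrite /= rmorph_nat.
by rewrite -(map_mx_inj HE) twist_poly_mul; apply: eq_twist_poly.
Qed.

Lemma invariant_span p :
  conj_poly rho F m.+1 (fun alpha : gal_of {:L} => #|gamma_fiber rho iota F a alpha|) p ->
  cw_invariant iota Tm p ->
  lin_span [set p | exists2 C : {set sum_rep rho a},
                      type_code C & p = ccwe iota F m.+1 C] p.
Proof.
move=> [n [c [y [hy pE]]]] inv.
have [w hw] : exists w : 'I_n -> X, forall i k, y i k = \prod_j gam (a j) (Defs.coord (w i j) k).
  have /boolp.choice [w hw] : forall i, exists w : X, forall k,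
      y i k = \prod_j gam (a j) (Defs.coord (w j) k).
    move=> i; have [e he ->] := hy i.
    exact: (conj_monomial_twist hrho hK hF ha he).
  by exists w.
pose t (x : X) : L := \sum_i c i * (w i == x)%:R.
have pt k : p k = poly t k.
  rewrite pE fct_sumE twist_poly_sum; apply: eq_bigr => i _; congr (_ * _).
  rewrite hw /twist_poly (bigD1 (w i)) //= eqxx mul1r [X in _ + X]big1 ?addr0 // => x xw.
  by rewrite eq_sym (negPf xw) mul0r.
have [s us sP] := descent_monoid_finite RR hA hT hrho hTm N0_gt0 tC0.
have [h hh] : exists h : 'M[CC]_#|Vm| -> 'M[L]_#|Vm|, forall g, monoid g -> map_mx iota (h g) = g.
  have /boolp.choice [h hh] : forall g, exists G : 'M[L]_#|Vm|, monoid g -> map_mx iota G = g.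
    by move=> g; have [/monoid_lift [G GE]|ng] := pselect (monoid g); [exists G|exists 0].
  by exists h.
have s0 : (size s)%:R != 0 :> L.
  rewrite -(fmorph_eq0 iota) rmorph_nat pnatr_eq0 size_eq0.
  by apply/eqP => s0; have := (sP 1%:M).2 (DescentOne _ _ _ _); rewrite s0.
(* The tensor t need not be invariant even though p is. Its average over the finite group is, and it
   still represents p because every translate of t does. *)
pose t' (x : X) : L := \sum_(g <- s) (size s)%:R^-1 * twist (h g) t x.
have pt' k : p k = poly t' k.
  rewrite twist_poly_sum (eq_big_seq (fun=> (size s)%:R^-1 * p k)) => [|g /sP hg].
    by rewrite big_const_seq count_predT iter_addr addr0 -mulrnAl -[_ *+ _]mulr_natr mulVf ?mul1r.
  congr (_ * _); rewrite -twist_poly_mul -pt -[in LHS](invmxK (h g)); apply: inv.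
  by rewrite map_invmx hh //; apply/GenInv/(descent_monoid_cw hA hT hrho hTm).
have fix_t' : descent_fixed T a (iota \o t').
  move=> k hk u; have [G GE Gt] := gen_twist hk; rewrite -Gt; congr (iota _).
  have kM : monoid (op_mx (k 1)) by apply: descent_monoid_gen.
  rewrite twist_sum.
  have ps : perm_eq [seq op_mx (k 1) *m g | g <- s] s.
    apply: perm_mulmx_unit => // [|g /sP hg].
      exact: (clifford_unit hA hrho hTm (descent_monoid_cw hA hT hrho hTm kM)).
    exact/sP/descent_monoid_mul.
  rewrite /t' -[RHS](perm_big _ ps) big_map; apply: eq_big_seq => g /sP hg.
  congr (_ * _); rewrite -twist_mul; congr (twist _ _ _).
  apply: (@map_mx_inj _ _ iota); rewrite map_mxM GE !hh //.
  exact: descent_monoid_mul.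
have [cc hcc] := descent_fixed_span hA hT hwecA hrho ha fix_t'.
(* Genus descent gives complex coefficients; since t' and the indicators take values in K,
   coefficients in K exist as well. *)
have [|c' hc'] := @coef_descent L CC iota _ _ (@is_type _ (sum_rep rho a))
    (fun C x => (all_rows C x)%:R) t' cc.
  by move=> x; apply: etrans (hcc x) _; apply: eq_bigr => C _; rewrite rmorph_nat mulr_natr.
rewrite (_ : p = \sum_(C | is_type C) c' C *: ccwe iota F m.+1 C).
  by apply: lin_span_sum => C /is_typeP tC; exists C.
apply/funext => k; rewrite pt' (eq_twist_poly iota F a k hc') twist_poly_sum fct_sumE.
by apply: eq_bigr => C _; rewrite -ccwe_twist.
Qed.

End Assembly.

Theorem corollary6p5
    (RR : realType)
    (A : form_data) (hA : is_form_ring A)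
    (T : symm_choice A) (hT : is_symm_choice T)
    (hwecA : weight_enumerator_conjecture RR T)
    (rho : rep_data A) (hrho : is_rep rho)
    (hcode : exists N0 : nat, (1 <= N0)%N /\
       exists C : {set sum_rep rho (fun _ : 'I_N0 => 1)}, type_code C)
    (m : nat) (hm : (1 <= m)%N)
    (Tm : symm_choice (mat_form A m)) (hTm : is_symm_choice Tm)
    (L : splittingFieldType rat) (iota : {rmorphism L -> RR[i]})
    (hK : range iota = K_field RR rho)
    (F : {subfield L})
    (hF : is_complement (cyclotomic_field RR (conductor rho))
            (sqrt_field RR rho) [set iota z | z in [set` F]])
    (hwec : weight_enumerator_property RR T rho)
    (N : nat) (a : 'I_N -> int)
    (ha : forall i, coprimez (a i) (conductor rho)%:Z)
    (hsign : sign_condition rho iota F a) :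
  let d := fun alpha : gal_of {:L} => #|gamma_fiber rho iota F a alpha| in
  [set p | conj_poly rho F m d p /\ cw_invariant iota Tm p] =
  lin_span [set p | exists2 C : {set sum_rep rho a},
                      type_code C & p = ccwe iota F m C].
Proof.
(* Positive genus is needed as [pw] with index m' has m' + 1 coordinates. *)
case: m hm Tm hTm => [//|m'] _ Tm' hTm' d.
have [N0 [N0_gt0 [C0 tC0]]] := hcode.
apply/seteqP; split=> p.
  case=> hp inv.
  exact: (invariant_span hA hT hwecA hrho hTm' N0_gt0 tC0 hK hF ha hsign hp inv).
case=> n [c [y [hy pE]]].
have /boolp.choice [C hC] : forall i, exists C : {set sum_rep rho a},
    type_code C /\ y i = ccwe iota F m'.+1 C.
  by move=> i; have [C tC yE] := hy i; exists C.
have tC i : type_code (C i) by case: (hC i).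
have yE i : y i = ccwe iota F m'.+1 (C i) by case: (hC i).
have pk k : p k = \sum_i c i * ccwe iota F m'.+1 (C i) k.
  by rewrite pE fct_sumE; apply: eq_bigr => i _; rewrite yE.
split.
  rewrite (_ : p = twist_poly iota F a (fun x => \sum_i c i * (all_rows (C i) x)%:R)).
    exact: (twist_poly_conj hrho hK hF ha).
  apply/funext => k; rewrite pk twist_poly_sum; apply: eq_bigr => i _.
  by rewrite (ccwe_twist hrho m' hK hF ha).
move=> G hG k; rewrite !pk; apply: eq_bigr => i _; congr (_ * _).
exact: (ccwe_invariant hA hT hwecA hrho hTm' N0_gt0 tC0 hK hF ha hsign (tC i) hG).
Qed.
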